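(* Let $h_1,h_2,h_3\in\mathbb R$ and $P>0$. If a rate tuple $(R_{12},R_{13},R_{21},R_{23},R_{31},R_{32})$ is achievable in the (non-restricted) Gaussian Y-channel with gains $h_1,h_2,h_3$ and power $P$, then there exists a joint distribution $p(x_1,x_2,x_3,x_r)$ of real random variables $(X_1,X_2,X_3,X_r)$ with $\mathbb E[X_a^2]\le P$ for $a\in\{1,2,3,r\}$ such that, for all distinct $j,k,l\in\{1,2,3\}$, $$R_{jk}+R_{jl}\leq\min\{I(X_j;Y_r|X_k,X_l,X_r),\ I(X_r;Y_k,Y_l|X_k,X_l)\},$$ $$R_{jl}+R_{kl}\leq\min\{I(X_j,X_k;Y_r|X_l,X_r),\ I(X_r;Y_l|X_l)\},$$ where $Y_r=h_1X_1+h_2X_2+h_3X_3+Z_r$ and $Y_m=h_mX_r+Z_m$ for $m\in\{1,2,3\}$, with $Z_r,Z_1,Z_2,Z_3$ i.i.d. $\mathcal N(0,1)$ independent of $(X_1,X_2,X_3,X_r)$.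
   Context: The (non-restricted, reciprocal) Gaussian Y-channel with real gains $h_1,h_2,h_3$ and power $P>0$: users $1,2,3$ and a relay $r$. For each ordered pair $(j,k)$ of distinct indices in $\{1,2,3\}$, user $j$ holds a message $m_{jk}$, uniform on $\{1,\dots,2^{nR_{jk}}\}$, intended for user $k$; the six messages are mutually independent. Over channel uses $i=1,\dots,n$, the relay receives $Y_{ri}=h_1X_{1i}+h_2X_{2i}+h_3X_{3i}+Z_{ri}$ and user $j$ receives $Y_{ji}=h_jX_{ri}+Z_{ji}$, all noise samples i.i.d. $\mathcal N(0,1)$ independent of the messages. Encoders $X_{ji}=f_{ji}(m_{jk},m_{jl},Y_j^{i-1})$ ($\{k,l\}=\{1,2,3\}\setminus\{j\}$), relay $X_{ri}=f_{ri}(Y_r^{i-1})$, power constraints $\frac1n\sum_i\mathbb E[X_{ai}^2]\le P$ for $a\in\{1,2,3,r\}$; user $j$ estimates $(m_{kj},m_{lj})$ from $(Y_j^n,m_{jk},m_{jl})$. A rate tuple is achievable if codes exist whose error probability (some message decoded wrongly) tends to $0$ as $n\to\infty$. Mutual informations are in bits. *)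

(* Defs.v *)
From HB Require Import structures.
From mathcomp Require Import all_boot all_order all_algebra.
From mathcomp Require Import all_classical all_reals all_analysis.
Set Implicit Arguments. Unset Strict Implicit. Unset Printing Implicit Defensive.
Import Order.TTheory GRing.Theory Num.Theory.
Import numFieldNormedType.Exports.
Local Open Scope classical_set_scope.
Local Open Scope ring_scope.

Section Info.
Context {R : realType} {d : measure_display} {T : measurableType d}.
Variable (Pr : probability T R).

Definition log2 (x : R) : R := ln x / ln 2.

Definition mi_term (p a b : R) : R := if p == 0 then 0 else p * log2 (p / (a * b)).

Definition qmeasurable (m : nat) (q : R -> 'I_m) := forall i, measurable (q @^-1` [set i]).

Definition cell (s : seq (T -> R)) (m : nat) (q : nat -> R -> 'I_m)
  (c : {ffun 'I_(size s) -> 'I_m}) : set T :=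
  [set t | forall i : 'I_(size s), q i (nth (fun=> 0) s i t) = c i].

Definition disc_mi (s1 s2 : seq (T -> R)) (m : nat) (q1 q2 : nat -> R -> 'I_m) : R :=
  \sum_(c1 : {ffun 'I_(size s1) -> 'I_m}) \sum_(c2 : {ffun 'I_(size s2) -> 'I_m})
    mi_term (fine (Pr (cell q1 c1 `&` cell q2 c2))) (fine (Pr (cell q1 c1)))
            (fine (Pr (cell q2 c2))).

Definition mutual_info (s1 s2 : seq (T -> R)) : \bar R :=
  ereal_sup [set x : \bar R | exists (m : nat) (q1 q2 : nat -> R -> 'I_m),
     (forall i, qmeasurable (q1 i)) /\ (forall i, qmeasurable (q2 i)) /\
     x = (disc_mi s1 s2 q1 q2)%:E].

(* conditional mutual information via the chain rule:
   I(A ; Y | C) := I(A, C ; Y) - I(C ; Y) *)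
Definition cond_mutual_info (a c y : seq (T -> R)) : \bar R :=
  (mutual_info (a ++ c) y - mutual_info c y)%E.
End Info.

(* Gaussian Y-channel: users are indexed by 'I_3 (0,1,2 stand for 1,2,3). *)

Section YChannel.
Context {R : realType}.

Definition gauss (B : set R) : \bar R := normal_prob 0 1 B.

Definition msize (n : nat) (r : R) : nat := `|Num.ceil (2 `^ (n%:R * r))|%N.

Definition cyl (i : nat) : set (set (nat -> R)) :=
  [set B | exists (s : nat) (A : set R), (s < i)%N /\ measurable A /\
                                         B = [set y | A (y s)]].

Definition past_measurable (i : nat) (F : (nat -> R) -> R) :=
  forall B : set R, measurable B -> <<s cyl i >> (F @^-1` B).

Definition past_measurable_nat (i : nat) (F : (nat -> R) -> nat) :=
  forall a : nat, <<s cyl i >> (F @^-1` [set a]).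

Definition past {T : Type} (V : nat -> T -> R) (i : nat) (t : T) : nat -> R :=
  fun s => if (s < i)%N then V s t else 0.

(* a code of length n:
   enc j i (own messages of j) (past outputs of j)   -- encoder of user j, time i
   rel i (past relay outputs)                       -- relay, time i
   dec j (own messages of j) (all n outputs of j) k -- estimate of m_kj
   Own messages of user j are passed as a function k |-> m_jk (with value 0 at k = j). *)
Definition code_measurable (n : nat)
  (enc : 'I_3 -> nat -> ('I_3 -> nat) -> (nat -> R) -> R)
  (rel : nat -> (nat -> R) -> R)
  (dec : 'I_3 -> ('I_3 -> nat) -> (nat -> R) -> 'I_3 -> nat) :=
  (forall j i own, (i < n)%N -> past_measurable i (enc j i own)) /\
  (forall i, (i < n)%N -> past_measurable i (rel i)) /\
  (forall j own k, past_measurable_nat n (fun y => dec j own y k)).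

Section Run.
Context {d : measure_display} {T : measurableType d}.
Variable (Pr : probability T R).

Definition own (m : 'I_3 -> 'I_3 -> T -> nat) (j : 'I_3) (t : T) : 'I_3 -> nat :=
  fun k => if k == j then 0%N else m j k t.

Definition ychannel_run (n : nat) (h : 'I_3 -> R) (Rt : 'I_3 -> 'I_3 -> R)
  (enc : 'I_3 -> nat -> ('I_3 -> nat) -> (nat -> R) -> R)
  (rel : nat -> (nat -> R) -> R)
  (m : 'I_3 -> 'I_3 -> T -> nat)
  (Z : 'I_3 -> nat -> T -> R) (Zr : nat -> T -> R)
  (X : 'I_3 -> nat -> T -> R) (Xr : nat -> T -> R)
  (Y : 'I_3 -> nat -> T -> R) (Yr : nat -> T -> R) :=
  (forall j k a, measurable (m j k @^-1` [set a])) /\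
  (forall j i, measurable_fun setT (Z j i)) /\
  (forall i, measurable_fun setT (Zr i)) /\
  (* the six messages are uniform on {0,..,M_jk - 1} and the noise samples
     are i.i.d. N(0,1), all mutually independent *)
  (forall (a : 'I_3 -> 'I_3 -> nat) (B : 'I_3 -> nat -> set R) (Br : nat -> set R),
     (forall j i, measurable (B j i)) -> (forall i, measurable (Br i)) ->
     Pr [set t | (forall j k, j != k -> m j k t = a j k) /\
                 (forall i, (i < n)%N -> Br i (Zr i t) /\ forall j, B j i (Z j i t))] =
     ((\prod_(j < 3) \prod_(k < 3 | j != k)
          (if (a j k < msize n (Rt j k))%N then (msize n (Rt j k))%:R^-1 else 0)) *
      \prod_(i < n) (fine (gauss (Br i)) * \prod_(j < 3) fine (gauss (B j i))))%:E) /\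
  (forall i t, (i < n)%N -> Yr i t = \sum_(j < 3) h j * X j i t + Zr i t) /\
  (forall j i t, (i < n)%N -> Y j i t = h j * Xr i t + Z j i t) /\
  (forall j i t, (i < n)%N -> X j i t = enc j i (own m j t) (past (Y j) i t)) /\
  (forall i t, (i < n)%N -> Xr i t = rel i (past Yr i t)).

Definition power_ok (n : nat) (Pw : R) (X : 'I_3 -> nat -> T -> R) (Xr : nat -> T -> R) :=
  (forall j, (\sum_(i < n) \int[Pr]_t ((X j i t) ^+ 2)%:E <= (n%:R * Pw)%:E)%E) /\
  (\sum_(i < n) \int[Pr]_t ((Xr i t) ^+ 2)%:E <= (n%:R * Pw)%:E)%E.

Definition error_prob (n : nat)
  (dec : 'I_3 -> ('I_3 -> nat) -> (nat -> R) -> 'I_3 -> nat)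
  (m : 'I_3 -> 'I_3 -> T -> nat) (Y : 'I_3 -> nat -> T -> R) : \bar R :=
  Pr [set t | exists j k : 'I_3, j != k /\ dec j (own m j t) (past (Y j) n t) k != m k j t].
End Run.

(* achievability of the rate tuple Rt (Rt j k = R_jk; diagonal entries unused) *)
Definition achievable (h : 'I_3 -> R) (Pw : R) (Rt : 'I_3 -> 'I_3 -> R) :=
  exists (enc : nat -> 'I_3 -> nat -> ('I_3 -> nat) -> (nat -> R) -> R)
         (rel : nat -> nat -> (nat -> R) -> R)
         (dec : nat -> 'I_3 -> ('I_3 -> nat) -> (nat -> R) -> 'I_3 -> nat)
         (pe : nat -> R),
    pe @ \oo --> 0 /\
    forall n : nat, code_measurable n (enc n) (rel n) (dec n) /\
      exists (d : measure_display) (T : measurableType d) (Pr : probability T R)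
             (m : 'I_3 -> 'I_3 -> T -> nat)
             (Z : 'I_3 -> nat -> T -> R) (Zr : nat -> T -> R)
             (X : 'I_3 -> nat -> T -> R) (Xr : nat -> T -> R)
             (Y : 'I_3 -> nat -> T -> R) (Yr : nat -> T -> R),
        ychannel_run Pr n h Rt (enc n) (rel n) m Z Zr X Xr Y Yr /\
        power_ok Pr n Pw X Xr /\
        (error_prob Pr n (dec n) m Y <= (pe n)%:E)%E.
End YChannel.

Section SingleLetter.
Context {R : realType}.

Definition single_letter {d : measure_display} {T : measurableType d}
  (Pr : probability T R) (Pw : R)
  (X : 'I_3 -> T -> R) (Xr : T -> R) (Z : 'I_3 -> T -> R) (Zr : T -> R) :=
  (forall j, measurable_fun setT (X j)) /\ measurable_fun setT Xr /\
  (forall j, measurable_fun setT (Z j)) /\ measurable_fun setT Zr /\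
  (forall (A : 'I_3 -> set R) (Ar : set R) (B : 'I_3 -> set R) (Br : set R),
     (forall j, measurable (A j)) -> measurable Ar ->
     (forall j, measurable (B j)) -> measurable Br ->
     Pr [set t | (forall j, A j (X j t)) /\ Ar (Xr t) /\
                 (forall j, B j (Z j t)) /\ Br (Zr t)] =
     (fine (Pr [set t | (forall j, A j (X j t)) /\ Ar (Xr t)]) *
      fine (gauss Br) * \prod_(j < 3) fine (gauss (B j)))%:E) /\
  (forall j, (\int[Pr]_t ((X j t) ^+ 2)%:E <= Pw%:E)%E) /\
  (\int[Pr]_t ((Xr t) ^+ 2)%:E <= Pw%:E)%E.
End SingleLetter.

(* Main.v *)
(* Two facts are combined.

   Jointly Gaussian inputs.  Let L be the user of largest gain and A, B the other two.  Take
   X_L and X_r independent N(0, P), and (X_A, X_B) Gaussian with correlation rho, independent of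
   them, with |rho| < 1.  All the mutual informations of the single-letter region are then
   explicit logarithms, and the region contains every tuple satisfying six scalar inequalities
   in rho.  Mutual information being a supremum over quantizations, an upper bound on it comes
   from an integrated log-likelihood ratio (Jensen cell by cell), and a lower bound from fine
   quantizations of a clipped Gaussian log-likelihood ratio.

   Converse.  For a code of length n, compare the law P of all the channel outputs with a law Q
   under which each output is Gaussian around a linear prediction that does not depend on the
   messages crossing a given cut.  If M values of these messages are decoded with probability
   1 - pe under P, then they are with probability at most 1/M under Q, whence
   (1 - pe) ln M <= 1 + E_P[ln dP/dQ], and the last expectation only involves prediction errors,
   which the power constraints bound.  With rho_n the average correlation of the inputs of A and
   B, predicting x_A by rho_n x_B gives the six scalar inequalities for rho_n up to o(1).

   Finally the worst slack in these inequalities is continuous in rho, so that its maximizer on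
   [-1, 1] satisfies them all; if it is 1 or -1 then A and B have rate 0 and rho = 0 works. *)

(* The choice of L is what leaves a single correlation to control. The two rates into A (or into B)
   are limited by the downlink to the capacity at h_A^2 P (or h_B^2 P), hence at h_L^2 P, and X_L
   alone achieves that on the uplink once it is independent of the other inputs. So the converse
   never has to follow correlations with X_L. The only other pair cut, from {A, B} to L, depends on
   rho through rho h_A h_B, while the individual cuts of A and B lose a factor 1 - rho^2. One value
   of rho must therefore serve these three inequalities together, which is why the limit needs a
   compactness argument.

   A conditional mutual information is a difference of two suprema: bounding it from below takes a
   lower bound on the first and a finite upper bound on the second.

   In the converse, feedback is harmless because, given all messages, each output is a function of
   earlier outputs plus fresh noise, so dP/dQ is a product over the outputs. The inequality 1 + x <=
   e^x, used pointwise on this product, takes the place of Fano's inequality and keeps every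
   integrand nonnegative. *)
Require Import Defs.
From HB Require Import structures.
From mathcomp Require Import all_boot all_order all_algebra.
From mathcomp Require Import all_classical all_reals all_analysis.
From mathcomp Require Import measurable_realfun ring lra.
Set Implicit Arguments. Unset Strict Implicit. Unset Printing Implicit Defensive.
Import Order.TTheory GRing.Theory Num.Theory.
Import numFieldNormedType.Exports.
Local Open Scope classical_set_scope.
Local Open Scope ring_scope.

(** * Gaussian densities *)

Section LebesgueInvariance.
Context {R : realType}.
Local Notation mu := (@lebesgue_measure R).

Lemma lebesgue_measure_shift (c : R) (A : set R) : measurable A ->
  pushforward mu (fun x : measurableTypeR R => x + c : measurableTypeR R) A = mu A.
Proof.
have mc : measurable_fun setT (fun x : measurableTypeR R => x + c : measurableTypeR R).
  by apply: measurable_funD.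
pose mf := isMeasurableFun.Build _ _ _ _ _ mc.
pose f : {mfun _ >-> _} := HB.pack (fun x : measurableTypeR R => x + c : measurableTypeR R) mf.
move=> mA; apply/esym.
apply: (@lebesgue_measure_unique R (pushforward mu f)) => //= _ [[a b]] _ <-.
rewrite /pushforward.
have -> : f @^-1` `]a, b]%classic = `](a - c), (b - c)]%classic.
  by apply/seteqP; split => x /=; rewrite !in_itv /= ltrBlDr lerBrDr.
rewrite !lebesgue_measure_itv/= !lte_fin ltrD2r -!EFinB.
by rewrite (_ : b - c - (a - c) = b - a) //; ring.
Qed.

Lemma ge0_integral_shift (c : R) (f : R -> \bar R) :
  measurable_fun setT f -> (forall x, 0 <= f x)%E ->
  (\int[mu]_x f (x + c)%R = \int[mu]_x f x)%E.
Proof.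
move=> mf f0.
have mc : measurable_fun setT (fun x : measurableTypeR R => x + c : measurableTypeR R).
  by apply: measurable_funD.
rewrite -[LHS](@ge0_integral_pushforward _ _ _ _ R _ mc mu setT f) //.
by apply: eq_measure_integral => A mA _; exact: lebesgue_measure_shift.
Qed.

Lemma ge0_integral_opp (f : R -> \bar R) :
  measurable_fun setT f -> (forall x, 0 <= f x)%E ->
  (\int[mu]_x f (- x)%R = \int[mu]_x f x)%E.
Proof.
move=> mf f0.
have mc : measurable_fun setT (fun x : measurableTypeR R => - x : measurableTypeR R).
  by apply: measurable_funN.
rewrite -[LHS](@ge0_integral_pushforward _ _ _ _ R _ mc mu setT f) //.
by apply: eq_measure_integral => A mA _; exact: lebesgue_measureN.
Qed.

End LebesgueInvariance.

Section GaussianDensity.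
Context {R : realType}.
Local Notation mu := (@lebesgue_measure R).

(* the N(0, v) density; the variance is kept in the exponent so that identities between densities
   reduce to additions of exponents *)
Definition gpdf (v x : R) : R := expR (- (ln (2 * pi * v) + x ^+ 2 / v) / 2).

Lemma gpdf_gt0 v x : 0 < gpdf v x. Proof. exact: expR_gt0. Qed.

Lemma gpdf_ge0 v x : 0 <= gpdf v x. Proof. exact: expR_ge0. Qed.

Lemma measurable_gpdf v : measurable_fun setT (gpdf v).
Proof.
apply: measurableT_comp => //; apply: measurable_funM => //; apply: measurable_funN.
by apply: measurable_funD => //; apply: measurable_funM => //; apply: measurable_funX.
Qed.

Lemma measurable_EFin_gpdf v : measurable_fun setT (fun x => (gpdf v x)%:E).
Proof. by apply/measurable_EFinP; exact: measurable_gpdf. Qed.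

Lemma gpdfE v x : 0 < v -> gpdf v x = normal_pdf 0 (Num.sqrt v) x.
Proof.
move=> v0; have s0 : Num.sqrt v != 0 by rewrite gt_eqF// sqrtr_gt0.
have p0 : 0 < 2 * pi * v :> R by rewrite !mulr_gt0// pi_gt0.
rewrite normal_pdfE// /normal_peak /normal_fun subr0 sqr_sqrtr ?ltW//.
rewrite (_ : v * pi *+ 2 = 2 * pi * v); last by rewrite -mulr_natl; ring.
rewrite /gpdf (_ : - _ / 2 = - (ln (2 * pi * v) / 2) + - x ^+ 2 / (v *+ 2)); last first.
  by rewrite -[v *+ 2]mulr_natl; field; rewrite gt_eqF.
rewrite expRD expRN; congr (_^-1 * _).
by rewrite -powR12_sqrt ?ltW// /powR gt_eqF// mulrC.
Qed.

Lemma integral_gpdf v (m : R) : 0 < v -> (\int[mu]_x (gpdf v (x - m)%R)%:E = 1)%E.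
Proof.
move=> v0.
rewrite (ge0_integral_shift (- m) (f := fun x => (gpdf v x)%:E)); first last.
- by move=> x; rewrite lee_fin gpdf_ge0.
- exact: measurable_EFin_gpdf.
under eq_integral do rewrite gpdfE//.
exact: integral_normal_pdf.
Qed.

Lemma integral_gpdf0 v : 0 < v -> (\int[mu]_x (gpdf v x)%:E = 1)%E.
Proof. by move=> v0; rewrite -[RHS](integral_gpdf 0 v0); under [RHS]eq_integral do rewrite subr0. Qed.

(* Bayes' rule for y = a x + z with x ~ N(0, v) and z ~ N(0, w) *)
Lemma gpdf_bayes v w a x y (u := w + a ^+ 2 * v) : 0 < v -> 0 < w ->
  gpdf v x * gpdf w (y - a * x) = gpdf u y * gpdf (v * w / u) (x - a * v / u * y).
Proof.
move=> v0 w0.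
have u0 : 0 < u by rewrite ltr_wpDr// mulr_ge0 ?sqr_ge0// ltW.
have pp : 0 < 2 * pi :> R by rewrite mulr_gt0// pi_gt0.
rewrite /gpdf -!expRD; congr expR.
rewrite !lnM ?posrE ?divr_gt0 ?mulr_gt0 ?invr_gt0 ?pi_gt0// lnV ?posrE//.
have un : w + a ^+ 2 * v != 0 by rewrite gt_eqF.
by rewrite /u; field; rewrite un !gt_eqF.
Qed.

Lemma gpdf_tilt v s x : 0 < v -> 0 < 1 + s ->
  gpdf v x * expR (- (s * (x ^+ 2 / v) / 2)) = expR (- ln (1 + s) / 2) * gpdf (v / (1 + s)) x.
Proof.
move=> v0 s0; rewrite /gpdf -!expRD; congr expR.
rewrite !lnM ?posrE ?mulr_gt0 ?invr_gt0 ?pi_gt0// lnV ?posrE//.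
by field; rewrite !gt_eqF.
Qed.

End GaussianDensity.

Section GaussianMoments.
Context {R : realType}.
Local Notation mu := (@lebesgue_measure R).

(** Writing the tilt [1 + s] as [r ^+ 2] makes the total mass [r^-1] free of square roots. Both
    [r > 1] and [r < 1] are used, to bound the second moment from each side. *)
Lemma integral_gpdf_tilt (v r : R) : 0 < v -> 0 < r ->
  (\int[mu]_x (gpdf v x * expR (- ((r ^+ 2 - 1) * (x ^+ 2 / v) / 2)))%:E = (r^-1)%:E)%E.
Proof.
move=> v0 r0.
have s0 : 0 < 1 + (r ^+ 2 - 1) by rewrite addrC subrK exprn_gt0.
under eq_integral do rewrite gpdf_tilt// EFinM.
rewrite ge0_integralZl//; last first.
- by move=> x _; rewrite lee_fin gpdf_ge0.
- exact: measurable_EFin_gpdf.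
rewrite integral_gpdf0 ?divr_gt0// mule1 addrC subrK lnXn//.
by rewrite -[_ *+ 2]mulr_natl mulNr mulrAC divff// mul1r expRN lnK// posrE.
Qed.

Let msq (v : R) : measurable_fun setT (fun x : R => (x ^+ 2 / v * gpdf v x)%:E).
Proof.
apply/measurable_EFinP; apply: measurable_funM; last exact: measurable_gpdf.
by apply: measurable_funM => //; exact: measurable_funX.
Qed.

Let mtilt (v r : R) : measurable_fun setT
  (fun x : R => (gpdf v x * expR (- ((r ^+ 2 - 1) * (x ^+ 2 / v) / 2)))%:E).
Proof.
apply/measurable_EFinP; apply: measurable_funM; first exact: measurable_gpdf.
apply: measurableT_comp => //; apply: measurable_funN; apply: measurable_funM => //.
by apply: measurable_funM => //; apply: measurable_funM => //; exact: measurable_funX.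
Qed.

Let g0 (v : R) (x : R) : setT x -> (0 <= (gpdf v x)%:E)%E.
Proof. by move=> _; rewrite lee_fin gpdf_ge0. Qed.

Let sq_ge0 (v x : R) : 0 < v -> (0 <= (x ^+ 2 / v * gpdf v x)%:E)%E.
Proof. by move=> v0; rewrite lee_fin mulr_ge0 ?gpdf_ge0// divr_ge0 ?sqr_ge0// ltW. Qed.

(* The bounds come from integrating [1 + y <= expR y] against N(0, v) with [y] proportional to
   [x ^+ 2]: both sides are Gaussian integrals, and they agree to first order at [r = 1]. *)
Lemma integral_sqr_gpdf (v : R) : 0 < v -> (\int[mu]_x (x ^+ 2 * gpdf v x)%:E = v%:E)%E.
Proof.
move=> v0.
pose m2 := (\int[mu]_x (x ^+ 2 / v * gpdf v x)%:E)%E.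
have m20 : (0 <= m2)%E by apply: integral_ge0 => x _; exact: sq_ge0.
have lo r : 1 < r -> (1 <= (r^-1)%:E + ((r ^+ 2 - 1) / 2)%:E * m2)%E.
  move=> r1; have r0 : 0 < r by apply: lt_trans r1.
  have s0 : 0 <= (r ^+ 2 - 1) / 2 by rewrite divr_ge0// subr_ge0 expr_ge1// ltW.
  have s0e : (0 <= ((r ^+ 2 - 1) / 2)%:E)%E by rewrite lee_fin.
  rewrite -(integral_gpdf_tilt v0 r0) -(ge0_integralZl mu measurableT (msq v) (fun x _ => sq_ge0 x v0) s0e).
  have g1 x : setT x -> (0 <= (gpdf v x * expR (- ((r ^+ 2 - 1) * (x ^+ 2 / v) / 2)))%:E)%E.
    by move=> _; rewrite lee_fin; exact: (mulr_ge0 (gpdf_ge0 _ _) (expR_ge0 _)).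
  have g2 x : setT x -> (0 <= ((r ^+ 2 - 1) / 2)%:E * (x ^+ 2 / v * gpdf v x)%:E)%E.
    by move=> _; rewrite mule_ge0 ?lee_fin//; have := sq_ge0 x v0; rewrite lee_fin.
  rewrite -(ge0_integralD mu measurableT g1 (mtilt v r) g2 (measurable_funeM _ (msq v))).
  rewrite -(integral_gpdf0 v0); apply: ge0_le_integral.
  - exact: measurableT.
  - exact: g0.
  - exact: measurable_EFin_gpdf.
  - by apply: emeasurable_funD; [exact: mtilt|exact: (measurable_funeM _ (msq v))].
  - move=> x _; rewrite -EFinM -EFinD lee_fin.
    rewrite [leRHS](_ : _ = gpdf v x * (expR (- ((r ^+ 2 - 1) * (x ^+ 2 / v) / 2)) +
       (r ^+ 2 - 1) * (x ^+ 2 / v) / 2)); last by ring.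
    rewrite ler_peMr ?gpdf_ge0// -lerBlDr.
    exact: expR_ge1Dx.
have up r : 0 < r < 1 -> (1 + ((1 - r ^+ 2) / 2)%:E * m2 <= (r^-1)%:E)%E.
  move=> /andP[r0 r1].
  have s0 : 0 <= (1 - r ^+ 2) / 2 by rewrite divr_ge0// subr_ge0 expr_le1// ltW.
  have s0e : (0 <= ((1 - r ^+ 2) / 2)%:E)%E by rewrite lee_fin.
  rewrite -(integral_gpdf_tilt v0 r0) -(ge0_integralZl mu measurableT (msq v) (fun x _ => sq_ge0 x v0) s0e).
  rewrite -(integral_gpdf0 v0).
  have g1 x : setT x -> (0 <= (gpdf v x)%:E)%E by move=> _; rewrite lee_fin gpdf_ge0.
  have g2 x : setT x -> (0 <= ((1 - r ^+ 2) / 2)%:E * (x ^+ 2 / v * gpdf v x)%:E)%E.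
    by move=> _; rewrite mule_ge0 ?lee_fin//; have := sq_ge0 x v0; rewrite lee_fin.
  rewrite -(ge0_integralD mu measurableT g1 (measurable_EFin_gpdf v) g2 (measurable_funeM _ (msq v))).
  apply: ge0_le_integral.
  - exact: measurableT.
  - by move=> x Tx; rewrite adde_ge0 ?g1 ?g2.
  - by apply: emeasurable_funD; [exact: measurable_EFin_gpdf|exact: (measurable_funeM _ (msq v))].
  - exact: mtilt.
  - move=> x _; rewrite -EFinM -EFinD lee_fin.
    rewrite [leLHS](_ : _ = gpdf v x * (1 + - ((r ^+ 2 - 1) * (x ^+ 2 / v) / 2))); last by ring.
    by rewrite ler_pM2l ?gpdf_gt0// expR_ge1Dx.
(* The bound [up] at one value, [r = 1/2], has a positive coefficient on [m2] and a finite
   right-hand side. *)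
have m2fin : m2 \is a fin_num.
  rewrite ge0_fin_numE//.
  have := up (2^-1) ltac:(by apply/andP; split; lra).
  case: (m2) m20 => [r r0|_|//]; first by rewrite ltry.
  by rewrite gt0_muley ?addey ?leye_eq//; rewrite lte_fin; lra.
have m2E : m2 = 1%E.
  have [m m2m] : exists m, m2 = m%:E by exists (fine m2); rewrite fineK.
  rewrite m2m in lo up *; congr EFin; apply/eqP; rewrite eq_le; apply/andP; split.
    apply/ler_addgt0Pr => e e0.
    (* [dl <= 1/4] keeps the factor [5 - 11 dl + 4 dl ^+ 2] below positive, and [dl <= e / 4] turns
       [1 + 4 dl] into at most [1 + e]. *)
    have [dl [dl0 dl1 dle]] : exists dl : R, [/\ 0 < dl, dl <= 4^-1 & dl <= e / 4].
      exists (Num.min (4^-1) (e / 4)); split; last 2 first.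
      - by rewrite ge_min lexx.
      - by rewrite ge_min lexx orbT.
      - by rewrite lt_min; apply/andP; split; lra.
    have := up (1 - dl) ltac:(by apply/andP; split; lra).
    rewrite -EFinM -EFinD lee_fin -(ler_pM2l (x := 1 - dl)); last lra.
    rewrite divff; last by rewrite gt_eqF//; lra.
    move=> H.
    suff : m <= 1 + 4 * dl by lra.
    rewrite leNgt; apply/negP => mlt.
    suff : 1 < (1 - dl) * (1 + (1 - (1 - dl) ^+ 2) / 2 * m) by lra.
    apply: (@lt_le_trans _ _ ((1 - dl) * (1 + (1 - (1 - dl) ^+ 2) / 2 * (1 + 4 * dl)))).
      rewrite -subr_gt0.
      rewrite (_ : _ - 1 = dl ^+ 2 / 2 * (5 - 11 * dl + 4 * dl ^+ 2)); last by field.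
      by rewrite mulr_gt0 ?divr_gt0 ?exprn_gt0//; nra.
    have A0 : 0 < (1 - (1 - dl) ^+ 2) / 2.
      by rewrite (_ : _ / 2 = dl * (2 - dl) / 2); [rewrite divr_gt0// mulr_gt0//; lra|field].
    have d0 : 0 < 1 - dl by lra.
    by rewrite ler_pM2l// lerD2l ler_pM2l// ltW.
  apply/ler_addgt0Pr => e e0.
  have [dl [dl0 dle]] : exists dl : R, 0 < dl /\ dl = e / 2.
    by exists (e / 2); rewrite divr_gt0.
  have := lo (1 + dl) ltac:(lra).
  rewrite -EFinM -EFinD lee_fin -(ler_pM2l (x := 1 + dl)); last lra.
  rewrite mulrDr divff; last by rewrite gt_eqF//; lra.
  move=> H.
  suff : 1 - 2 * dl <= m by lra.
  rewrite leNgt; apply/negP => mlt.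
  suff : (1 + dl) * (((1 + dl) ^+ 2 - 1) / 2 * m) < dl by lra.
  apply: (@le_lt_trans _ _ ((1 + dl) * (((1 + dl) ^+ 2 - 1) / 2 * (1 - 2 * dl)))).
    have A0 : 0 < ((1 + dl) ^+ 2 - 1) / 2.
      by rewrite (_ : _ / 2 = dl * (2 + dl) / 2); [rewrite divr_gt0// mulr_gt0//; lra|field].
    have d0 : 0 < 1 + dl by lra.
    by rewrite ler_pM2l// ler_pM2l// ltW.
  rewrite -subr_gt0.
  rewrite (_ : _ - _ = dl ^+ 2 / 2 * (1 + 5 * dl + 2 * dl ^+ 2)); last by field.
  by rewrite mulr_gt0 ?divr_gt0 ?exprn_gt0//; nra.
transitivity (v%:E * m2)%E; last by rewrite m2E mule1.
rewrite -(ge0_integralZl mu measurableT (msq v) (fun x _ => sq_ge0 x v0)) ?lee_fin ?ltW//.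
by apply: eq_integral => x _; rewrite -EFinM; congr EFin; field; rewrite gt_eqF.
Qed.

(** Adding the integral to its image under [x -> - x] cancels the cross term, so only nonnegative
    integrands are ever split. *)
Lemma integral_sqrD_gpdf (v e : R) : 0 < v ->
  (\int[mu]_x ((e + x)%R ^+ 2 * gpdf v x)%:E = (e ^+ 2 + v)%:E)%E.
Proof.
move=> v0; set I := LHS.
have mI (s : R) : measurable_fun setT (fun x : R => ((e + s * x)%R ^+ 2 * gpdf v x)%:E).
  apply/measurable_EFinP; apply: measurable_funM; last exact: measurable_gpdf.
  by apply: measurable_funX; apply: measurable_funD => //; exact: measurable_funM.
have I0 (s x : R) : (0 <= ((e + s * x)%R ^+ 2 * gpdf v x)%:E)%E.
  by rewrite lee_fin mulr_ge0 ?gpdf_ge0 ?sqr_ge0.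
have mI1 : measurable_fun setT (fun x : R => ((e + x)%R ^+ 2 * gpdf v x)%:E).
  by have := mI 1; apply: eq_measurable_fun => x _; rewrite mul1r.
have I01 x : (0 <= ((e + x)%R ^+ 2 * gpdf v x)%:E)%E by have := I0 1 x; rewrite mul1r.
have IN : I = (\int[mu]_x ((e + -1 * x)%R ^+ 2 * gpdf v x)%:E)%E.
  rewrite /I -(ge0_integral_opp mI1 I01).
  by apply: eq_integral => x _; rewrite mulN1r /gpdf sqrrN.
have II : (I + I = (2 * (e ^+ 2 + v))%:E)%E.
  rewrite {2}IN /I -(ge0_integralD mu measurableT (fun x _ => I01 x) mI1 (fun x _ => I0 (-1) x) (mI (-1))).
  transitivity (\int[mu]_x ((2 * e ^+ 2)%:E * (gpdf v x)%:E + 2%:E * (x ^+ 2 * gpdf v x)%:E))%E.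
    by apply: eq_integral => x _; rewrite -!EFinM -!EFinD; congr EFin; ring.
  have m1 := @measurable_EFin_gpdf R v.
  have m2 : measurable_fun setT (fun x : R => (x ^+ 2 * gpdf v x)%:E).
    apply/measurable_EFinP; apply: measurable_funM; last exact: measurable_gpdf.
    exact: measurable_funX.
  have p1 x : (0 <= (gpdf v x)%:E)%E by rewrite lee_fin gpdf_ge0.
  have p2 x : (0 <= (x ^+ 2 * gpdf v x)%:E)%E by rewrite lee_fin mulr_ge0 ?gpdf_ge0 ?sqr_ge0.
  have e0 : (0 <= (2 * e ^+ 2)%:E)%E by rewrite lee_fin mulr_ge0 ?sqr_ge0.
  have e1 : (0 <= (2%:E : \bar R))%E by rewrite lee_fin.
  rewrite (ge0_integralD mu measurableT (fun x _ => mule_ge0 e0 (p1 x)) (measurable_funeM _ m1)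
    (fun x _ => mule_ge0 e1 (p2 x)) (measurable_funeM _ m2)).
  rewrite (ge0_integralZl mu measurableT m1 (fun x _ => p1 x) e0).
  rewrite (ge0_integralZl mu measurableT m2 (fun x _ => p2 x) e1).
  by rewrite integral_gpdf0// integral_sqr_gpdf// -!EFinM -EFinD; congr EFin; ring.
have I_ge0 : (0 <= I)%E by apply: integral_ge0 => x _; exact: I01.
move: I_ge0 II; case: (I) => [r _ [rr]|//|//].
by congr EFin; lra.
Qed.

End GaussianMoments.

(** * Variables that are Gaussian given the past *)

(** Extending both components by [point] outside [D] reduces the claim to functions measurable on
    the whole space. *)
Lemma measurable_fun_pairS {d d1 d2 : measure_display} {T : measurableType d}
    {T1 : measurableType d1} {T2 : measurableType d2} (D : set T) (f : T -> T1) (g : T -> T2) :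
  measurable D -> measurable_fun D f -> measurable_fun D g ->
  measurable_fun D (fun x => (f x, g x)).
Proof.
move=> mD mf mg.
have ext dS (S : measurableType dS) (h : T -> S) : measurable_fun D h ->
    measurable_fun setT (fun x => if x \in D then h x else point).
  move=> mh; apply: measurable_fun_if => //.
    apply: (measurable_fun_bool true); rewrite setTI (_ : _ @^-1` _ = D) //.
    by apply/seteqP; split => x; [exact: set_mem|exact: mem_set].
  by apply: measurable_funS mh => // x [_]; exact: set_mem.
apply: (eq_measurable_fun (fun x => (if x \in D then f x else point, if x \in D then g x else point))).
  by move=> x xD; rewrite xD.
by apply: measurable_funTS; apply: measurable_fun_pair; exact: ext.
Qed.

Section NonnegativeIntegrals.
Context {d : measure_display} {T : measurableType d} {R : realType}.
Local Open Scope ereal_scope.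

(** Measurability is relative to the message event [D], since past outputs are only known to be
    measurable there. Nonnegativity gives linearity and Tonelli without integrability conditions. *)
Definition nnfun (D : set T) (f : T -> \bar R) :=
  measurable_fun D f /\ forall x, 0 <= f x.

Lemma nnfun_EFin (D : set T) (f : T -> R) :
  measurable_fun D f -> (forall x, (0 <= f x)%R) -> nnfun D (EFin \o f).
Proof. by move=> mf f0; split; [exact/measurable_EFinP|move=> x; rewrite lee_fin]. Qed.

Lemma nnfunD D f g : nnfun D f -> nnfun D g -> nnfun D (f \+ g).
Proof.
move=> [mf f0] [mg g0]; split; first exact: emeasurable_funD.
by move=> x; rewrite adde_ge0.
Qed.

Lemma nnfunM D f g : nnfun D f -> nnfun D g -> nnfun D (f \* g).
Proof.
move=> [mf f0] [mg g0]; split; first exact: emeasurable_funM.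
by move=> x; rewrite mule_ge0.
Qed.

Lemma nnfun_cst D k : 0 <= k -> nnfun D (cst k).
Proof. by move=> k0; split=> //; exact: measurable_cst. Qed.

Lemma nnfunZ D k f : 0 <= k -> nnfun D f -> nnfun D (fun x => k * f x).
Proof. by move=> k0 nf; apply: nnfunM => //; exact: nnfun_cst. Qed.

Lemma nnfun_sum D I (s : seq I) (f : I -> T -> \bar R) :
  (forall i, nnfun D (f i)) -> nnfun D (fun x => \sum_(i <- s) f i x).
Proof.
move=> nf; split; first by apply: emeasurable_sum => i; case: (nf i).
by move=> x; apply: sume_ge0 => i _; case: (nf i).
Qed.

Lemma nnfun_indic (D A : set T) : measurable A -> nnfun D (fun x => (\1_A x)%:E).
Proof.
by move=> mA; apply: (nnfun_EFin (f := \1_A)) => //; exact: measurable_indic.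
Qed.

Variable mu : {measure set T -> \bar R}.

Lemma nnint_ge0 D f : nnfun D f -> 0 <= \int[mu]_(x in D) f x.
Proof. by move=> [_ f0]; apply: integral_ge0 => x _. Qed.

Lemma nnint_le D f g : measurable D -> nnfun D f -> nnfun D g ->
  (forall x, D x -> f x <= g x) -> \int[mu]_(x in D) f x <= \int[mu]_(x in D) g x.
Proof. by move=> mD [mf f0] [mg g0] fg; apply: ge0_le_integral. Qed.

Lemma nnintD D f g : measurable D -> nnfun D f -> nnfun D g ->
  \int[mu]_(x in D) (f x + g x) = \int[mu]_(x in D) f x + \int[mu]_(x in D) g x.
Proof.
by move=> mD [mf f0] [mg g0]; exact: (ge0_integralD mu mD (fun x _ => f0 x) mf (fun x _ => g0 x) mg).
Qed.

Lemma nnintZ D k f : measurable D -> 0 <= k -> nnfun D f ->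
  \int[mu]_(x in D) (k * f x) = k * \int[mu]_(x in D) f x.
Proof. by move=> mD k0 [mf f0]; exact: (ge0_integralZl mu mD mf (fun x _ => f0 x) k0). Qed.

Lemma nnint_sum D I (s : seq I) (f : I -> T -> \bar R) : measurable D ->
  (forall i, nnfun D (f i)) ->
  \int[mu]_(x in D) (\sum_(i <- s) f i x) = \sum_(i <- s) \int[mu]_(x in D) f i x.
Proof.
move=> mD nf; apply: ge0_integral_sum => //; first by move=> i; case: (nf i).
by move=> i x _; case: (nf i).
Qed.

Lemma nnint_indic D A : measurable D -> measurable A ->
  \int[mu]_(x in D) (\1_A x)%:E = mu (A `&` D).
Proof. by move=> mD mA; rewrite integral_indic. Qed.

End NonnegativeIntegrals.

Lemma nnfun_comp {d d' : measure_display} {T : measurableType d} {S : measurableType d'}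
    {R : realType} (D : set T) (U : T -> S) (f : S -> \bar R) :
  measurable_fun D U -> nnfun setT f -> nnfun D (f \o U).
Proof. by move=> mU [mf f0]; split=> [|x]; [exact: measurableT_comp|exact: f0]. Qed.

Section ConditionallyGaussian.
Context {R : realType}.
Local Notation mu := (@lebesgue_measure R).
Local Open Scope ereal_scope.

(** The conditional expectation of [F (U, W)] given [U = u] when [W] is N(0, v) and independent of
    [U]. *)
Definition gint {dS} {S : measurableType dS} (v : R) (F : S * R -> \bar R) (u : S) : \bar R :=
  \int[mu]_w (F (u, w) * (gpdf v w)%:E).

Lemma nnfun_gpdf (v : R) : nnfun setT (fun w : R => (gpdf v w)%:E).
Proof. by split=> [|x]; [exact: measurable_EFin_gpdf|rewrite lee_fin gpdf_ge0]. Qed.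

Lemma nnfun_section1 {dS} {S : measurableType dS} (F : S * R -> \bar R) u :
  nnfun setT F -> nnfun setT (fun w : R => F (u, w)).
Proof.
by move=> [mF F0]; split=> // ; apply: (measurableT_comp mF); exact: pair1_measurable.
Qed.

Lemma nnfun_gint_body {dS} {S : measurableType dS} v (F : S * R -> \bar R) u : nnfun setT F ->
  nnfun setT (fun w : R => F (u, w) * (gpdf v w)%:E).
Proof. by move=> nF; apply: nnfunM; [exact: nnfun_section1|exact: nnfun_gpdf]. Qed.

Lemma nnfun_gint {dS} {S : measurableType dS} v (F : S * R -> \bar R) :
  nnfun setT F -> nnfun setT (gint v F).
Proof.
move=> nF; split; last by move=> u; apply: nnint_ge0; exact: nnfun_gint_body.
have nG : nnfun setT (fun p : S * R => F p * (gpdf v p.2)%:E).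
  by apply: nnfunM => //; exact: (nnfun_comp measurable_snd (nnfun_gpdf v)).
exact: (measurable_fun_fubini_tonelli_F (m2 := mu) _ nG.1 nG.2).
Qed.

Context {d : measure_display} {T : measurableType d}.
Variables (P : {measure set T -> \bar R}) (D : set T).
Hypothesis mD : measurable D.

(* On the event [D], the real variable [W] is N(0, v) and independent of [U]. *)
Definition gauss_given {dS} {S : measurableType dS} (U : T -> S) (v : R) (W : T -> R) :=
  [/\ measurable_fun D U, measurable_fun D W, (0 < v)%R &
   forall F : S * R -> \bar R, nnfun setT F ->
     \int[P]_(t in D) F (U t, W t) = \int[P]_(t in D) gint v F (U t)].

Lemma gauss_given_map {dS} {S : measurableType dS} {dS'} {S' : measurableType dS'}
    (U : T -> S) (phi : S -> S') v W :
  measurable_fun setT phi -> gauss_given U v W -> gauss_given (phi \o U) v W.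
Proof.
move=> mphi [mU mW v0 H]; split=> //; first exact: measurableT_comp.
move=> F nF; rewrite (H (fun p => F (phi p.1, p.2))) //.
apply: (nnfun_comp (U := fun p : S * R => (phi p.1, p.2))) => //.
by apply: measurable_fun_pair => //=; exact: measurableT_comp.
Qed.

Lemma gauss_given_ext {dS} {S : measurableType dS} (U U' : T -> S) v v' W W' :
  U =1 U' -> v = v' -> W =1 W' -> gauss_given U v W -> gauss_given U' v' W'.
Proof. by move=> /funext -> -> /funext ->. Qed.

(* [U] and [X] observed, then [y = a X + z]: the joint law written in the order [y], then [X]. *)
Lemma gauss_given_joint {dS} {S : measurableType dS} (U : T -> S) v X w Z a
    (u := (w + a ^+ 2 * v)%R) :
  gauss_given U v X -> gauss_given (fun t => (U t, X t)) w Z ->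
  forall F : S * R * R -> \bar R, nnfun setT F ->
  \int[P]_(t in D) F (U t, X t, a * X t + Z t)%R =
  \int[P]_(t in D) \int[mu]_y
     ((\int[mu]_x (F (U t, x, y) * (gpdf (v * w / u) (x - a * v / u * y)%R)%:E)) * (gpdf u y)%:E).
Proof.
move=> [mU mX v0 HX] [mUX mZ w0 HZ] F nF.
have u0 : (0 < u)%R by rewrite ltr_wpDr// mulr_ge0 ?sqr_ge0// ltW.
pose G (q : S * R * R) := F (q.1, (a * q.1.2 + q.2)%R).
have nG : nnfun setT G.
  apply: (nnfun_comp (U := fun q : S * R * R => (q.1, (a * q.1.2 + q.2)%R))) nF.
  apply: measurable_fun_pair => /=; first exact: measurable_fst.
  apply: measurable_funD => //; apply: measurable_funM => //.
  exact: (measurableT_comp measurable_snd).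
rewrite (HZ G nG) (HX (gint w G) (nnfun_gint w nG)).
apply: eq_integral => t _; set s := U t.
pose K (x y : R) := F (s, x, y) * (gpdf v x * gpdf w (y - a * x))%:E.
have nK : nnfun setT (fun p : R * R => K p.1 p.2).
  apply: nnfunM.
    apply: (nnfun_comp (U := fun p : R * R => (s, p.1, p.2))) nF.
    by apply: measurable_fun_pair => //=; apply: measurable_fun_pair.
  apply: (nnfun_EFin (f := fun p : R * R => (gpdf v p.1 * gpdf w (p.2 - a * p.1))%R)).
    apply: measurable_funM; first exact: (measurableT_comp (measurable_gpdf v)).
    apply: (measurableT_comp (measurable_gpdf w)); apply: measurable_funB => //.
    exact: measurable_funM.
  by move=> p; rewrite mulr_ge0 ?gpdf_ge0.
transitivity (\int[mu]_x \int[mu]_y K x y).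
  apply: eq_integral => x _; rewrite /gint.
  have nf : nnfun setT (fun y : R => F (s, x, y) * (gpdf w (y - a * x))%:E).
    apply: nnfunM; first exact: (nnfun_section1 (s, x)).
    apply: (nnfun_EFin (f := fun y : R => gpdf w (y - a * x))).
      by apply: (measurableT_comp (measurable_gpdf w)); apply: measurable_funB.
    by move=> y; rewrite gpdf_ge0.
  transitivity ((gpdf v x)%:E * \int[mu]_y (F (s, x, y) * (gpdf w (y - a * x))%:E)).
    rewrite [LHS]muleC; apply: (f_equal (fun z => (gpdf v x)%:E * z)); apply: etrans (ge0_integral_shift (a * x)%R nf.1 nf.2).
    by apply: eq_integral => z _; rewrite /G/= addrK addrC.
  rewrite -nnintZ// ?lee_fin ?gpdf_ge0//.
  by apply: eq_integral => y _; rewrite /K EFinM muleCA.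
transitivity (\int[mu]_y \int[mu]_x K x y).
  exact: (fubini_tonelli (m1 := mu) (m2 := mu) (fun p : R * R => K p.1 p.2) nK.1 nK.2).
apply: eq_integral => y _ /=.
have nf : nnfun setT (fun x : R => F (s, x, y) * (gpdf (v * w / u) (x - a * v / u * y))%:E).
  apply: nnfunM.
    apply: (nnfun_comp (U := fun x : R => (s, x, y))) nF.
    by apply: measurable_fun_pair => //=; apply: measurable_fun_pair.
  apply: (nnfun_EFin (f := fun x : R => gpdf (v * w / u) (x - a * v / u * y))).
    by apply: (measurableT_comp (measurable_gpdf _)); apply: measurable_funB.
  by move=> x; rewrite gpdf_ge0.
rewrite muleC -nnintZ// ?lee_fin ?gpdf_ge0//.
apply: eq_integral => x _; rewrite /K (gpdf_bayes _ _ _ v0 w0) -/u.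
by rewrite EFinM muleCA.
Qed.

(** In the joint law written [y] first, a function of [U] and [y] alone leaves the kernel of [X] to
    integrate to 1. *)
Lemma gauss_given_add {dS} {S : measurableType dS} (U : T -> S) v X w Z a :
  gauss_given U v X -> gauss_given (fun t => (U t, X t)) w Z ->
  gauss_given U (w + a ^+ 2 * v) (fun t => a * X t + Z t)%R.
Proof.
move=> gX gZ; have [mU mX v0 _] := gX; have [_ mZ w0 _] := gZ.
have u0 : (0 < w + a ^+ 2 * v)%R by rewrite ltr_wpDr// mulr_ge0 ?sqr_ge0// ltW.
split=> //; first by apply: measurable_funD => //; exact: measurable_funM.
move=> F nF.
have nG : nnfun setT (fun q : S * R * R => F (q.1.1, q.2)).
  apply: (nnfun_comp (U := fun q : S * R * R => (q.1.1, q.2))) nF.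
  by apply: measurable_fun_pair => //=; exact: (measurableT_comp measurable_fst).
rewrite (gauss_given_joint a gX gZ nG) /=.
apply: eq_integral => t _; apply: eq_integral => y _.
apply: (f_equal (fun z => z * (gpdf _ y)%:E)).
have F0 : 0 <= F (U t, y) by exact: nF.2.
have v'0 : (0 < v * w / (w + a ^+ 2 * v))%R by rewrite divr_gt0 ?mulr_gt0.
rewrite nnintZ//; first by rewrite integral_gpdf// mule1.
apply: (nnfun_EFin (f := fun x : R => gpdf _ (x - _))) => [|x]; last exact: gpdf_ge0.
by apply: (measurableT_comp (measurable_gpdf _)); apply: measurable_funB.
Qed.

(** [a * v / u * Y] is the linear minimum mean square error estimate of [X] from [Y]. Its error is
    Gaussian and independent of what has been observed. *)
Lemma gauss_given_bayes {dS} {S : measurableType dS} (U : T -> S) v X w Z a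
    (u := (w + a ^+ 2 * v)%R) (Y := fun t => (a * X t + Z t)%R) :
  gauss_given U v X -> gauss_given (fun t => (U t, X t)) w Z ->
  gauss_given (fun t => (U t, Y t)) (v * w / u) (fun t => X t - a * v / u * Y t)%R.
Proof.
move=> gX gZ; have [mU mX v0 _] := gX; have [_ mZ w0 _] := gZ.
have gY := gauss_given_add a gX gZ; have [_ mY u0 HY] := gY.
have v'0 : (0 < v * w / u)%R by rewrite divr_gt0 ?mulr_gt0.
split=> //; first exact: measurable_fun_pairS.
  by apply: measurable_funB => //; exact: measurable_funM.
move=> F nF; pose k := (a * v / u)%R.
have nG : nnfun setT (fun q : S * R * R => F (q.1.1, q.2, (q.1.2 - k * q.2)%R)).
  apply: (nnfun_comp (U := fun q : S * R * R => (q.1.1, q.2, (q.1.2 - k * q.2)%R))) nF.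
  apply: measurable_fun_pair => /=.
    by apply: measurable_fun_pair => //=; exact: (measurableT_comp measurable_fst).
  apply: measurable_funB; first exact: (measurableT_comp measurable_snd).
  exact: measurable_funM.
rewrite (gauss_given_joint a gX gZ nG) /=.
rewrite (HY (gint (v * w / u) F) (nnfun_gint _ nF)).
apply: eq_integral => t _; apply: eq_integral => y _.
apply: (f_equal (fun z => z * (gpdf _ y)%:E)).
have nf := nnfun_gint_body (v * w / u) (U t, y) nF.
apply: etrans (ge0_integral_shift (- (k * y))%R nf.1 nf.2).
by apply: eq_integral.
Qed.

(** The case [a = 0] of the two preceding lemmas: independent Gaussian variables may be revealed in
    either order. *)
Lemma gauss_given_swap {dS} {S : measurableType dS} (U : T -> S) v X w Z :
  gauss_given U v X -> gauss_given (fun t => (U t, X t)) w Z ->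
  gauss_given U w Z /\ gauss_given (fun t => (U t, Z t)) v X.
Proof.
move=> gX gZ; have [_ _ v0 _] := gX; have [_ _ w0 _] := gZ.
split.
  apply: gauss_given_ext (gauss_given_add 0 gX gZ) => // [|t].
    by rewrite expr0n/= mul0r addr0.
  by rewrite mul0r add0r.
apply: gauss_given_ext (gauss_given_bayes 0 gX gZ) => [t||t].
- by rewrite mul0r add0r.
- by rewrite expr0n/= mul0r addr0 mulfK// gt_eqF.
- by rewrite !mul0r subr0.
Qed.

End ConditionallyGaussian.

(** * Quantized mutual information *)

Section SequenceSpace.
Context {R : realType}.

Definition cylinders : set (set (nat -> R)) :=
  [set B | exists (s : nat) (A : set R), measurable A /\ B = [set y | A (y s)]].

(** A single measurable space for tuples and for pasts of every length, padded with 0. It carries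
    the product sigma-algebra. *)
Definition seqspace := g_sigma_algebraType cylinders.

Lemma measurable_coord (s : nat) : measurable_fun setT (fun y : seqspace => y s).
Proof. by move=> _ A mA; rewrite setTI; apply: sub_sigma_algebra; exists s, A. Qed.

Lemma measurable_to_seqspace {d} {T : measurableType d} (D : set T) (f : T -> seqspace) :
  (forall s, measurable_fun D (fun t => f t s)) -> measurable_fun D f.
Proof.
move=> mf mD.
have H : preimage_set_system D f cylinders `<=` measurable.
  by move=> _ [_ [s [A [mA ->]]] <-]; exact: (mf s).
exact: (@measurability _ _ T seqspace D f cylinders erefl H mD).
Qed.

End SequenceSpace.
Arguments seqspace R : clear implicits.

Section FiniteValued.
Context {d : measure_display} {T : measurableType d} {R : realType} {I : finType}.
Variables (mu : {finite_measure set T -> \bar R}) (kappa : T -> I).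
Hypothesis mkappa : forall i, measurable (kappa @^-1` [set i]).

Let decomp (phi : I -> R) t :
  (phi (kappa t))%:E = (\sum_i (phi i)%:E * (\1_(kappa @^-1` [set i]) t)%:E)%E.
Proof.
rewrite (bigD1 (kappa t))//= big1 => [|i /eqP ik].
  by rewrite adde0 indicE mem_set// mule1.
by rewrite indicE memNset ?mule0// => /esym.
Qed.

Let int1 (phi : I -> R) i :
  mu.-integrable setT (fun t => ((phi i)%:E * (\1_(kappa @^-1` [set i]) t)%:E)%E).
Proof. by apply: integrableZl => //; exact: integrable_indic. Qed.

Lemma integrable_finite_valued (phi : I -> R) :
  mu.-integrable setT (fun t => (phi (kappa t))%:E).
Proof.
rewrite (_ : (fun t => _) = (fun t => (\sum_i (phi i)%:E * (\1_(kappa @^-1` [set i]) t)%:E)%E)).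
  by apply: integrable_sum => // i _; exact: int1.
by apply/funext => t; exact: decomp.
Qed.

Lemma measurable_finite_valued (phi : I -> R) : measurable_fun setT (fun t => phi (kappa t)).
Proof. by apply/measurable_EFinP; exact: measurable_int (integrable_finite_valued phi). Qed.

Lemma integral_finite_valued (phi : I -> R) :
  (\int[mu]_t (phi (kappa t))%:E = (\sum_i phi i * fine (mu (kappa @^-1` [set i])))%:E)%E.
Proof.
under eq_integral do rewrite decomp.
rewrite integral_sum => [||i]; [|exact: measurableT|exact: int1].
rewrite -sumEFin; apply: eq_bigr => i _.
rewrite integralZl; [|exact: measurableT|exact: integrable_indic].
by rewrite integral_indic// setIT EFinM fineK// fin_num_measure.
Qed.

End FiniteValued.

(** * Upper bound on mutual information from a log-likelihood ratio *)

Section MutualInformationBounds.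
Context {d : measure_display} {T : measurableType d} {R : realType}.
Variable Pr : probability T R.

Definition tup (s : seq (T -> R)) (t : T) : seqspace R := fun i => nth (fun=> 0) s i t.

Definition measurable_list (s : seq (T -> R)) := forall i, measurable_fun setT (nth (fun=> 0) s i).

Lemma measurable_tup s : measurable_list s -> measurable_fun setT (tup s).
Proof. by move=> ms; apply: measurable_to_seqspace => i; exact: ms. Qed.

Lemma measurable_list_nil : measurable_list [::].
Proof. by move=> i; rewrite nth_nil. Qed.

Lemma measurable_list_cons X s :
  measurable_fun setT X -> measurable_list s -> measurable_list (X :: s).
Proof. by move=> mX ms [|i]; [exact: mX|exact: (ms i)]. Qed.

Definition cell_index (s : seq (T -> R)) (m : nat) (q : nat -> R -> 'I_m) (t : T) :
  {ffun 'I_(size s) -> 'I_m} := [ffun i : 'I_(size s) => q i (nth (fun=> 0) s i t)].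

Lemma cellE s m (q : nat -> R -> 'I_m) c : cell (s := s) q c = @cell_index s m q @^-1` [set c].
Proof.
apply/seteqP; split => t /=.
  by move=> H; apply/ffunP => i; rewrite ffunE H.
by move=> <- i; rewrite ffunE.
Qed.

Definition cell_set (s : seq (T -> R)) m (q : nat -> R -> 'I_m) (c : {ffun 'I_(size s) -> 'I_m}) : set (seqspace R) :=
  [set y | forall i : 'I_(size s), q i (y i) = c i].

Lemma measurable_cell_set s m (q : nat -> R -> 'I_m) c :
  (forall i, qmeasurable (q i)) -> measurable (@cell_set s m q c).
Proof.
move=> mq; rewrite (_ : cell_set q c =
    \bigcap_(i in [set: 'I_(size s)]) ((fun y : seqspace R => y i) @^-1` (q i @^-1` [set c i]))).
  apply: fin_bigcap_measurable => // i _.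
  by rewrite -[X in measurable X]setTI; apply: measurable_coord => //; exact: mq.
apply/seteqP; split => y /=; first by move=> H i _; exact: H.
by move=> H i; exact: H.
Qed.

Lemma measurable_cell s m (q : nat -> R -> 'I_m) c : measurable_list s ->
  (forall i, qmeasurable (q i)) -> measurable (@cell R d T s m q c).
Proof.
move=> ms mq; rewrite (_ : cell q c = tup s @^-1` (cell_set q c)) //.
rewrite -[X in measurable X]setTI; apply: (measurable_tup ms) => //.
exact: measurable_cell_set.
Qed.

Lemma ln2_gt0 : 0 < ln 2 :> R.
Proof. by rewrite ln_gt0// ltr1n. Qed.

(** The Donsker-Varadhan bound in one cell: [1 + x <= expR x] at [x = f - ln (p / (a * b))]. Any [f]
    is allowed, with equality at the log-likelihood ratio of the cell. *)
Lemma mi_term_ge (p a b f : R) : 0 <= p -> p <= a -> p <= b ->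
  p * f + p - a * b * expR f <= mi_term p a b * ln 2.
Proof.
move=> p0 pa pb; rewrite /mi_term; case: eqVneq => [->|pn0].
  rewrite !mul0r addr0 add0r oppr_le0 mulr_ge0 ?expR_ge0// mulr_ge0//.
    exact: le_trans pa.
  exact: le_trans pb.
have p1 : 0 < p by rewrite lt_neqAle eq_sym pn0.
have a1 : 0 < a by apply: lt_le_trans pa.
have b1 : 0 < b by apply: lt_le_trans pb.
have k0 : 0 < p / (a * b) by rewrite divr_gt0// mulr_gt0.
rewrite /log2 mulrA mulrAC divfK ?gt_eqF ?ln2_gt0//.
have := expR_ge1Dx (f - ln (p / (a * b))).
rewrite expRD expRN lnK// -(ler_pM2l p1) => H.
rewrite -subr_ge0; rewrite -subr_ge0 in H; apply: le_trans H _.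
rewrite le_eqVlt; apply/orP; left; apply/eqP; field.
by rewrite !gt_eqF.
Qed.

(** [g] stands for the log-likelihood ratio of the joint law to the product law; the hypothesis on
    rectangles is all that is needed of it, since the cells of a quantization are rectangles.
    Jensen's inequality in each cell gives its term at most the integral of [g] over the cell. *)
Lemma mutual_info_le s1 s2 (g : T -> R) (e : R) :
  measurable_list s1 -> measurable_list s2 ->
  Pr.-integrable setT (EFin \o g) -> (\int[Pr]_t (g t)%:E = e%:E)%E ->
  (forall B1 B2 : set (seqspace R), measurable B1 -> measurable B2 ->
     (\int[Pr]_(t in tup s1 @^-1` B1 `&` tup s2 @^-1` B2) (expR (- g t))%:E <=
      Pr (tup s1 @^-1` B1) * Pr (tup s2 @^-1` B2))%E) ->
  (mutual_info Pr s1 s2 <= (e / ln 2)%:E)%E.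
Proof.
move=> ms1 ms2 ig ie H; apply: ge_ereal_sup => _ [m [q1 [q2 [mq1 [mq2 ->]]]]].
rewrite lee_fin /disc_mi ler_pdivlMr ?ln2_gt0//.
pose C (c : {ffun 'I_(size s1) -> 'I_m} * {ffun 'I_(size s2) -> 'I_m}) : set T :=
  cell q1 c.1 `&` cell q2 c.2.
have mC c : measurable (C c) by apply: measurableI; exact: measurable_cell.
have mg : measurable_fun setT g by apply/measurable_EFinP; exact: (measurable_int _ ig).
have igC c : Pr.-integrable (C c) (EFin \o g) by apply: integrableS ig.
pose G c : R := fine (\int[Pr]_(t in C c) (g t)%:E).
have GE c : (\int[Pr]_(t in C c) (g t)%:E = (G c)%:E)%E.
  by rewrite /G fineK//; apply: integrable_fin_num.
have Csum : \sum_c G c = e.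
  apply: EFin_inj; rewrite -ie -sumEFin.
  have UC : \big[setU/set0]_(c <- index_enum _) C c = setT.
    apply/seteqP; split => // t _; rewrite -bigcup_seq.
    exists (@cell_index s1 m q1 t, @cell_index s2 m q2 t); first by rewrite /= mem_index_enum.
    by rewrite /C !cellE; split.
  rewrite -[in RHS]UC integral_bigsetU_EFin//; first by apply: eq_bigr => c _; rewrite GE.
  - exact: index_enum_uniq.
  - move=> [a1 a2] [b1 b2] _ _ [t []].
    by rewrite /C !cellE /= => -[] -> -> [] -> ->.
  - by apply/measurable_EFinP; exact: measurable_funTS.

rewrite pair_bigA/= -Csum mulr_suml; apply: ler_sum => -[c1 c2] _ /=.
set c := (c1, c2); rewrite -/(C c).
have mc1 : measurable (cell q1 c1) by exact: measurable_cell.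
have mc2 : measurable (cell q2 c2) by exact: measurable_cell.
rewrite /mi_term; case: eqVneq => [p0|pn0].
  rewrite mul0r -lee_fin -GE null_set_integral ?lexx//.
    by apply/measurable_EFinP; exact: measurable_funTS.
  by transitivity ((fine (Pr (C c)))%:E); [rewrite fineK// fin_num_measure|rewrite p0].
rewrite /log2 mulrA divfK ?gt_eqF ?ln2_gt0//.
set p := fine (Pr (C c)) in pn0 *; set a := fine (Pr (cell q1 c1)); set b := fine (Pr (cell q2 c2)).
have pE : Pr (C c) = p%:E by rewrite fineK// fin_num_measure.
have aE : Pr (cell q1 c1) = a%:E by rewrite fineK// fin_num_measure.
have bE : Pr (cell q2 c2) = b%:E by rewrite fineK// fin_num_measure.
have p1 : 0 < p by rewrite lt_neqAle eq_sym pn0 -lee_fin -pE measure_ge0.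
have pa : p <= a by rewrite -lee_fin -pE -aE le_measure// ?inE//; exact: subIsetl.
have pb : p <= b by rewrite -lee_fin -pE -bE le_measure// ?inE//; exact: subIsetr.
have a1 : 0 < a by apply: lt_le_trans pa.
have b1 : 0 < b by apply: lt_le_trans pb.
set k := p / (a * b).
have k0 : 0 < k by rewrite divr_gt0// mulr_gt0.
have nexp : nnfun (C c) (fun t => (expR (- g t))%:E).
  apply: (nnfun_EFin (f := fun t => expR (- g t))) => [|t]; last exact: expR_ge0.
  by apply: measurableT_comp => //; apply: measurable_funTS; exact: measurable_funN.
have expC : (\int[Pr]_(t in C c) (expR (- g t))%:E <= (a * b)%:E)%E.
  have := H _ _ (measurable_cell_set c1 mq1) (measurable_cell_set c2 mq2).
  by rewrite EFinM -aE -bE.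
have iexp : Pr.-integrable (C c) (fun t => (expR (- g t))%:E).
  apply/integrableP; split; first exact: nexp.1.
  under eq_integral do rewrite gee0_abs ?lee_fin ?expR_ge0//.
  by apply: le_lt_trans expC _; rewrite ltry.
(* Jensen's inequality in tangent form: [1 + (ln k - g) <= k * expR (- g)]. The right-hand side
   integrates to at most [k * a * b = p]. *)
have : (\int[Pr]_(t in C c) ((ln k + 1)%:E - (g t)%:E) <=
        \int[Pr]_(t in C c) (k%:E * (expR (- g t))%:E))%E.
  apply: le_integral => //.
  - by apply: (@integrableB _ _ _ _ _ _ (EFin \o cst (ln k + 1)) (EFin \o g)) => //;
      exact: finite_measure_integrable_cst.
  - exact: integrableZl.
  - move=> t _; rewrite -EFinB -EFinM lee_fin.
    have := expR_ge1Dx (ln k - g t); rewrite expRD lnK//; lra.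
rewrite (@integralB_EFin _ _ _ _ _ (cst (ln k + 1)) g)//; last exact: finite_measure_integrable_cst.
have icst : (\int[Pr]_(t in C c) (cst (ln k + 1) t)%:E = ((ln k + 1) * p)%:E)%E.
  by rewrite EFinM -pE; exact: (integral_cst _ (mC c) (ln k + 1)%:E).
rewrite integralZl// icst.
set J := (\int[Pr]_(t in C c) (expR (- g t))%:E)%E in expC *.
have [j jE] : exists j, J = j%:E.
  by exists (fine J); rewrite fineK//; apply: integrable_fin_num.
rewrite jE lee_fin in expC; rewrite GE jE -!EFinM -EFinB lee_fin => H1.
have : k * j <= p.
  rewrite /k -[leRHS](divfK (x := a * b)); last by rewrite gt_eqF// mulr_gt0.
  by rewrite ler_pM2l.
by move=> H2; rewrite mulrC; lra.
Qed.

End MutualInformationBounds.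

(** * Quantizers that become fine everywhere, and clipping *)

Section Quantizer.
Context {R : realType}.

(** A grid of step [1 / (m + 1)] on [[-m, m]]. Where points outside the interval are sent is
    immaterial, because each real is inside for large [m]. *)
Definition quant (m : nat) (x : R) : 'I_(2 * m * m.+1).+1 :=
  inord (Num.truncn ((x + m%:R) * m.+1%:R)).

Definition unquant (m : nat) (k : 'I_(2 * m * m.+1).+1) : R := k%:R / m.+1%:R - m%:R.

Lemma qmeasurable_quant m : qmeasurable (quant m).
Proof.
(* The integer part is nondecreasing, hence measurable; [inord] then merges countably many of its
   level sets. *)
move=> i; pose f (x : R) : R := (Num.truncn ((x + m%:R) * m.+1%:R))%:R.
have mf : measurable_fun setT f.
  apply: nondecreasing_measurable => // x y xy.
  by rewrite /f ler_nat le_truncn// ler_wpM2r// lerD2r.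
rewrite (_ : _ @^-1` _ =
    \bigcup_(k in [set k : nat | inord k = i]) (f @^-1` [set k%:R])); last first.
  apply/seteqP; split => x /=.
    by move=> <-; exists (Num.truncn ((x + m%:R) * m.+1%:R)).
  by move=> [k /= <-] /eqP; rewrite eqr_nat => /eqP <-.
apply: bigcup_measurable => k _; rewrite -[X in measurable X]setTI.
by apply: mf => //; exact: measurable_set1.
Qed.

Lemma quantK_cvg (x : R) : (fun m => unquant (quant m x)) @ \oo --> x.
Proof.
apply/cvgrPdist_le => e e0; near=> m.
have xm : `|x| < m%:R by near: m; exact: nbhs_infty_gtr.
have me : m.+1%:R^-1 < e by near: m; exact: (near_infty_natSinv_lt (PosNum e0)).
have m0 : 0 < m.+1%:R :> R by rewrite ltr0n.
have y0 : 0 <= (x + m%:R) * m.+1%:R.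
  by rewrite mulr_ge0//; move: xm; rewrite ltr_norml => /andP[]; lra.
have /andP[y1 y2] := truncn_itv y0.
set y := (x + m%:R) * m.+1%:R in y0 y1 y2.
have ym : y < (2 * m * m.+1)%:R.
  rewrite natrM ltr_pM2r// natrM; move: xm; rewrite ltr_norml => /andP[]; lra.
have ty : (Num.truncn y < (2 * m * m.+1).+1)%N.
  by rewrite ltnS ltnW// -(ltr_nat R); apply: le_lt_trans ym.
rewrite /unquant /quant -/y inordK//.
set k := Num.truncn y in y1 y2 *.
have -> : x - (k%:R / m.+1%:R - m%:R) = (y - k%:R) / m.+1%:R.
  by rewrite /y; field; rewrite gt_eqF.
rewrite normrM ger0_norm; last by lra.
rewrite ger0_norm ?invr_ge0 ?ltW//.
apply: le_lt_trans _ me; rewrite ler_piMl// ?invr_ge0 ?ltW//.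
by move: y2; rewrite -natr1; lra.
Unshelve. all: by end_near. Qed.

Definition reconstruct m n (c : {ffun 'I_n -> 'I_(2 * m * m.+1).+1}) : nat -> R :=
  fun i => if insub i is Some j then unquant (c j) else 0.

End Quantizer.

Section Clip.
Context {R : realType}.
Implicit Types K x y : R.

Definition clip K x := Num.max (- K) (Num.min x K).

Lemma norm_clip K x : 0 <= K -> `|clip K x| <= K.
Proof.
move=> K0; rewrite /clip ler_norml le_max lexx/= ge_max.
by rewrite ge_min lexx orbT andbT; lra.
Qed.

Lemma norm_clip_le K x : 0 <= K -> `|clip K x| <= `|x|.
Proof.
move=> K0; rewrite /clip; have [xK|Kx] := leP x K; last first.
  rewrite max_r; last by lra.
  rewrite (ger0_norm K0) ltW//; apply: lt_le_trans Kx _; exact: ler_norm.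
have [Kx|xK'] := leP (- K) x; first by [].
by rewrite normrN (ger0_norm K0) ler0_norm; lra.
Qed.

Lemma clip_id K x : `|x| <= K -> clip K x = x.
Proof. by rewrite ler_norml /clip => /andP[h1 h2]; rewrite min_l// max_r. Qed.

Lemma clip_lipschitz K x y : 0 <= K -> `|clip K x - clip K y| <= `|x - y|.
Proof.
move=> K0.
have H z w : z <= w -> `|clip K z - clip K w| <= `|z - w|.
  move=> zw; rewrite distrC (distrC z) (ger0_norm (x := w - z)) ?subr_ge0//.
  have mzw : clip K z <= clip K w.
    by rewrite /clip le_max2// le_min2.
  rewrite ger0_norm ?subr_ge0// lerBlDl /clip ge_max; apply/andP; split.
    by apply: (@le_trans _ _ (Num.max (- K) (Num.min z K))); [rewrite le_max lexx|lra].
  apply: (@le_trans _ _ (Num.min z K + (w - z))).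
    by rewrite -lerBlDr le_min; apply/andP; split;
      rewrite lerBlDr ge_min; apply/orP; [left|right]; lra.
  by rewrite lerD2r le_max lexx orbT.
have [/H//|/ltW/H] := leP x y.
by rewrite distrC (distrC y).
Qed.

(** Clipping from above lowers the exponential and clipping from below raises it to at most
    [expR (- K)], so a total mass bound survives clipping up to a vanishing error. *)
Lemma expR_clip K x : 0 <= K -> expR (clip K x) <= expR x + expR (- K).
Proof.
move=> K0; rewrite /clip; have [h|h] := leP (- K) (Num.min x K).
  apply: (@le_trans _ _ (expR x)); last by rewrite lerDl expR_ge0.
  by rewrite ler_expR ge_min lexx.
by rewrite lerDr expR_ge0.
Qed.

Lemma measurable_clip {d} {T : measurableType d} K (f : T -> R) :
  measurable_fun setT f -> measurable_fun setT (fun t => clip K (f t)).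
Proof.
move=> mf; apply: measurable_maxr; first exact: measurable_cst.
by apply: measurable_minr => //; exact: measurable_cst.
Qed.

Lemma cvg_clip K (u : nat -> R) l : 0 <= K -> u @ \oo --> l ->
  (fun n => clip K (u n)) @ \oo --> clip K l.
Proof.
move=> K0 /cvgrPdist_le ul; apply/cvgrPdist_le => e e0.
near=> n; apply: le_trans (clip_lipschitz _ _ K0) _.
by near: n; exact: ul.
Unshelve. all: by end_near. Qed.

End Clip.

(** * Lower bound on mutual information from a continuous test function *)

Section MutualInformationLowerBound.
Context {d : measure_display} {T : measurableType d} {R : realType}.
Variable Pr : probability T R.

Lemma integral_probability_cst {d'} {T' : measurableType d'} (P : probability T' R) (k : \bar R) :
  (\int[P]_t k = k)%E.
Proof.
rewrite -[RHS]mule1 -[X in (_ * X)%E](@probability_setT _ _ _ P).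
exact: (integral_cst P measurableT k).
Qed.

Lemma cvg_integral_bounded {d'} {T' : measurableType d'} (P : probability T' R)
    (f_ : nat -> T' -> R) (f : T' -> R) (K : R) :
  (forall n, measurable_fun setT (f_ n)) -> measurable_fun setT f ->
  (forall t, f_ ^~ t @ \oo --> f t) -> (forall n t, `|f_ n t| <= K) ->
  (fun n => fine (\int[P]_t (f_ n t)%:E)) @ \oo --> fine (\int[P]_t (f t)%:E).
Proof.
move=> mf_ mf cf bf.
have [] := @dominated_convergence _ _ _ P setT measurableT (fun n t => (f_ n t)%:E)
  (fun t => (f t)%:E) (fun=> K%:E).
- by move=> n; exact/measurable_EFinP.
- exact/measurable_EFinP.
- by apply: aeW => t _; apply/fine_cvgP; split; [exact: nearW|exact: cf].
- exact: finite_measure_integrable_cst.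
- by apply: aeW => t n _; rewrite lee_fin.
move=> If _; rewrite -[X in _ --> X]fineK; last exact: integrable_fin_num.
by move/fine_cvgP => [].
Qed.

(** Evaluating [g] at grid points and clipping it at [K] gives a test function constant on cells, to
    which [mi_term_ge] applies. Continuity of [g] and dominated convergence remove the quantization
    for fixed [K]; then [K] tends to infinity. *)
Lemma mutual_info_ge s1 s2 (g : seqspace R -> seqspace R -> R) (e : R) :
  measurable_list s1 -> measurable_list s2 ->
  measurable_fun setT (fun p : seqspace R * seqspace R => g p.1 p.2) ->
  (forall (x_ y_ : nat -> seqspace R) (x y : seqspace R),
     (forall i, (fun m => x_ m i) @ \oo --> x i) ->
     (forall i, (fun m => y_ m i) @ \oo --> y i) ->
     (fun m => g (x_ m) (y_ m)) @ \oo --> g x y) ->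
  Pr.-integrable setT (fun t => (g (tup s1 t) (tup s2 t))%:E) ->
  (\int[Pr]_t (g (tup s1 t) (tup s2 t))%:E = e%:E)%E ->
  (\int[Pr]_t \int[Pr]_t' (expR (g (tup s1 t) (tup s2 t')))%:E <= 1)%E ->
  ((e / ln 2)%:E <= mutual_info Pr s1 s2)%E.
Proof.
move=> ms1 ms2 mg cg ig ie eg.
pose N m := (2 * m * m.+1).+1.
pose Q m : nat -> R -> 'I_(N m) := fun=> quant m.
have mQ m i : qmeasurable (Q m i) by exact: qmeasurable_quant.
pose k1 m t := cell_index s1 (Q m) t.
pose k2 m t := cell_index s2 (Q m) t.
pose ph m (c1 : {ffun 'I_(size s1) -> 'I_(N m)}) (c2 : {ffun 'I_(size s2) -> 'I_(N m)}) : R :=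
  g (reconstruct c1) (reconstruct c2).
have rc s (ms : measurable_list s) t i :
    (fun m => reconstruct (cell_index s (Q m) t) i) @ \oo --> tup s t i.
  rewrite /reconstruct; case: insubP => [j _ ij|].
    rewrite [X in X @ _ --> _](_ : _ = fun m => unquant (quant m (tup s t i))).
      exact: quantK_cvg.
    by apply/funext => m; rewrite /cell_index ffunE ij.
  rewrite -leqNgt => si; rewrite /tup nth_default//; exact: cvg_cst.
have gc t t' : (fun m => ph m (k1 m t) (k2 m t')) @ \oo --> g (tup s1 t) (tup s2 t').
  by apply: cg => i; exact: rc.
have ub m : ((disc_mi Pr s1 s2 (Q m) (Q m))%:E <= mutual_info Pr s1 s2)%E.
  by apply: ereal_sup_ubound; exists (N m), (Q m), (Q m).
case: (mutual_info Pr s1 s2) ub => [r ub|_|/(_ 0%N)]; last by rewrite leeNy_eq.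
- rewrite lee_fin ler_pdivrMr ?ln2_gt0//.
  have mk1 m c : measurable (k1 m @^-1` [set c]) by rewrite -cellE; exact: measurable_cell.
  have mk2 m c : measurable (k2 m @^-1` [set c]) by rewrite -cellE; exact: measurable_cell.
  pose I m := ({ffun 'I_(size s1) -> 'I_(N m)} * {ffun 'I_(size s2) -> 'I_(N m)})%type.
  pose kk m t : I m := (k1 m t, k2 m t).
  pose kq m (z : T * T) : I m := (k1 m z.1, k2 m z.2).
  have kkE m c : kk m @^-1` [set c] = cell (Q m) c.1 `&` cell (Q m) c.2.
    rewrite !cellE; apply/seteqP; case: c => c1 c2; split => t /=; first by move=> [<- <-].
    by move=> [<- <-].
  have kqE m c : kq m @^-1` [set c] = cell (Q m) c.1 `*` cell (Q m) c.2.
    rewrite !cellE; apply/seteqP; case: c => c1 c2; split => t /=; first by move=> [<- <-].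
    by move=> [<- <-].
  have mkk m c : measurable (kk m @^-1` [set c]).
    by rewrite kkE; apply: measurableI; exact: measurable_cell.
  have mkq m c : measurable (kq m @^-1` [set c]).
    by rewrite kqE; apply: measurableX; exact: measurable_cell.
  pose P2 : probability (T * T)%type R := (Pr \x Pr)%E.
  pose A K m := fine (\int[Pr]_t (clip K (ph m (kk m t).1 (kk m t).2))%:E).
  pose B K m := fine (\int[P2]_z (expR (clip K (ph m (kq m z).1 (kq m z).2)))%:E).
  (* The sum of [mi_term_ge] over all cells: [A] is the mean of the test function under the joint
     law, [B] that of its exponential under the product law. *)
  have key K m : 0 <= K -> A K m + 1 - B K m <= r * ln 2.
    move=> K0.
    have -> : A K m = \sum_(c : I m) clip K (ph m c.1 c.2) * fine (Pr (kk m @^-1` [set c])).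
      by rewrite /A (integral_finite_valued Pr (mkk m) (fun c => clip K (ph m c.1 c.2))).
    have -> : B K m = \sum_(c : I m) expR (clip K (ph m c.1 c.2)) * fine (P2 (kq m @^-1` [set c])).
      by rewrite /B (integral_finite_valued P2 (mkq m) (fun c => expR (clip K (ph m c.1 c.2)))).
    have E1 : 1 = \sum_(c : I m) fine (Pr (kk m @^-1` [set c])).
      have := integral_finite_valued Pr (mkk m) (fun=> 1).
      rewrite integral_probability_cst => -[E]; rewrite [LHS]E.
      by apply: eq_bigr => c _; rewrite mul1r.
    rewrite [X in _ + X - _]E1 -big_split/= -sumrB.
    apply: (@le_trans _ _ (disc_mi Pr s1 s2 (Q m) (Q m) * ln 2)); last first.
      by rewrite ler_pM2r ?ln2_gt0// -lee_fin; exact: ub.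
    rewrite /disc_mi pair_bigA/= mulr_suml; apply: ler_sum => c _.
    rewrite kkE kqE mulrC.
    have mc1 : measurable (cell (Q m) c.1) by exact: measurable_cell.
    have mc2 : measurable (cell (Q m) c.2) by exact: measurable_cell.
    have mI := measurableI _ _ mc1 mc2.
    have -> : fine (P2 (cell (Q m) c.1 `*` cell (Q m) c.2)) =
        fine (Pr (cell (Q m) c.1)) * fine (Pr (cell (Q m) c.2)).
      by rewrite -fineM ?fin_num_measure//; congr fine; exact: product_measure1E.
    rewrite [X in _ - X]mulrC; apply: mi_term_ge.
    - exact: fine_ge0.
    - apply: fine_le; [exact: fin_num_measure|exact: fin_num_measure|].
      by apply: le_measure; rewrite ?inE//; exact: subIsetl.
    - apply: fine_le; [exact: fin_num_measure|exact: fin_num_measure|].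
      by apply: le_measure; rewrite ?inE//; exact: subIsetr.
  pose G t := g (tup s1 t) (tup s2 t).
  pose H (z : T * T) := g (tup s1 z.1) (tup s2 z.2).
  have mG : measurable_fun setT G by apply/measurable_EFinP; exact: measurable_int ig.
  have mH : measurable_fun setT H.
    apply: (measurableT_comp mg (g := fun z : T * T => (tup s1 z.1, tup s2 z.2))).
    by apply: measurable_fun_pair; apply: measurableT_comp => //; exact: measurable_tup.
  pose a K := fine (\int[Pr]_t (clip K (G t))%:E).
  pose b K := fine (\int[P2]_z (expR (clip K (H z)))%:E).
  have limA K : 0 <= K -> A K @ \oo --> a K.
    move=> K0; apply: (@cvg_integral_bounded _ _ _ _ _ K).
    - by move=> m; exact: (measurable_finite_valued Pr (mkk m) (fun c => clip K (ph m c.1 c.2))).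
    - exact: measurable_clip.
    - by move=> t; apply: cvg_clip => //; exact: gc.
    - by move=> m t; exact: norm_clip.
  have limB K : 0 <= K -> B K @ \oo --> b K.
    move=> K0; apply: (@cvg_integral_bounded _ _ _ _ _ (expR K)).
    - by move=> m; exact: (measurable_finite_valued P2 (mkq m) (fun c => expR (clip K (ph m c.1 c.2)))).
    - by apply: measurableT_comp => //; exact: measurable_clip.
    - move=> z; apply: continuous_cvg; first exact: continuous_expR.
      by apply: cvg_clip => //; exact: gc.
    - move=> m z; rewrite ger0_norm ?expR_ge0// ler_expR.
      by apply: le_trans (ler_norm _) _; exact: norm_clip.
  have key2 K : 0 <= K -> a K + 1 - b K <= r * ln 2.
    move=> K0; apply: (@cvgr_to_le nat \oo _ R (fun m => A K m + 1 - B K m) (a K + 1 - b K)).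
      by apply: cvgB; [apply: cvgD; [exact: limA|exact: cvg_cst]|exact: limB].
    by near=> m; exact: key.
  have bK K : 0 <= K -> b K <= 1 + expR (- K).
    move=> K0; rewrite -lee_fin /b fineK; last first.
      apply: integrable_fin_num => //; apply: (@measurable_bounded_integrable _ _ _ P2).
      - exact: measurableT.
      - by rewrite -ge0_fin_numE// fin_num_measure.
      - by apply: measurableT_comp => //; exact: measurable_clip.
      - exists (expR K); split; first exact: num_real.
        move=> M KM z _ /=; apply: le_trans _ (ltW KM); rewrite ger0_norm ?expR_ge0// ler_expR.
        by apply: le_trans (ler_norm _) _; exact: norm_clip.
    have nH : nnfun setT (fun z => (expR (H z))%:E).
      apply: (nnfun_EFin (f := fun z => expR (H z))) => [|z]; last exact: expR_ge0.
      exact: measurableT_comp.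
    have nK : nnfun (T := (T * T)%type) setT (fun=> (expR (- K))%:E).
      by apply: nnfun_cst; rewrite lee_fin expR_ge0.
    apply: (@le_trans _ _ (\int[P2]_z ((expR (H z))%:E + (expR (- K))%:E))%E).
      apply: nnint_le => //.
      - apply: (nnfun_EFin (f := fun z => expR (clip K (H z)))) => [|z]; last exact: expR_ge0.
        by apply: measurableT_comp => //; exact: measurable_clip.
      - exact: nnfunD nH nK.
      - by move=> z _; rewrite -EFinD lee_fin expR_clip.
    rewrite (nnintD P2 measurableT nH nK).
    rewrite EFinD leeD//.
      by rewrite (fubini_tonelli1 (m1 := Pr) (m2 := Pr) _ nH.1 nH.2).
    by rewrite integral_probability_cst.
  have lima : (fun n : nat => a n%:R) @ \oo --> e.
    have [] := @dominated_convergence _ _ _ Pr setT measurableT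
      (fun n t => (clip n%:R (G t))%:E) (fun t => (G t)%:E) (fun t => (`|G t|)%:E).
    - by move=> n; apply/measurable_EFinP; exact: measurable_clip.
    - exact/measurable_EFinP.
    - apply: aeW => t _; apply/fine_cvgP; split; first exact: nearW.
      apply/cvgrPdist_le => eps eps0; near=> n.
      have Gn : `|G t| < n%:R by near: n; exact: nbhs_infty_gtr.
      by rewrite /= clip_id ?subrr ?normr0 ltW.
    - exact: (integrable_norm ig).
    - by apply: aeW => t n _; rewrite lee_fin norm_clip_le.
    by move=> _ _; rewrite ie => /fine_cvgP[].
  (* At [K = n] the error left by clipping is [expR (- n) <= 1 / (n + 1)], a term of the harmonic
     sequence. *)
  have -> : r * ln 2 = r * ln 2 + 0 by rewrite addr0.
  apply: (@ler_cvg_to _ \oo _ _ (fun n => a n%:R) (fun n => r * ln 2 + harmonic n)) => //.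
    by apply: cvgD; [exact: cvg_cst|exact: cvg_harmonic].
  apply: nearW => n; have n0 : (0 <= n%:R :> R) by [].
  have := key2 _ n0; have := bK _ n0.
  have : expR (- n%:R) <= harmonic n :> R.
    by rewrite expRN /harmonic/= lef_pV2 ?posrE ?expR_gt0 ?ltr0n// -natr1 addrC expR_ge1Dx.
  lra.
- by rewrite leey.
Unshelve. all: by end_near. Qed.

End MutualInformationLowerBound.

(** * Mutual information of Gaussian variables *)

Section GaussianConstruction.
Context {R : realType}.
Local Notation mu := (@lebesgue_measure R).
Local Open Scope ereal_scope.

Lemma integral_normal_prob (v : R) (f : R -> \bar R) : (0 < v)%R -> nnfun setT f ->
  \int[normal_prob 0%R (Num.sqrt v)]_x f x = \int[mu]_x (f x * (gpdf v x)%:E).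
Proof.
move=> v0 nf.
pose nu : probability _ R := normal_prob (0%R : R) (Num.sqrt v).
have dom : nu `<< mu by exact: normal_prob_dominates.
rewrite -(Radon_Nikodym_SigmaFinite.change_of_variables dom nf.2 measurableT nf.1).
have ae : ae_eq mu setT (Radon_Nikodym_SigmaFinite.f nu mu) (fun x => (gpdf v x)%:E).
  apply: integral_ae_eq => //.
  - exact: Radon_Nikodym_SigmaFinite.f_integrable.
  - exact: measurable_EFin_gpdf.
  - move=> E _ mE; rewrite -Radon_Nikodym_SigmaFinite.f_integral//.
    by apply: eq_integral => x _; rewrite gpdfE.
have mRN : measurable_fun setT (Radon_Nikodym_SigmaFinite.f nu mu).
  exact: measurable_int (Radon_Nikodym_SigmaFinite.f_integrable dom).
apply: ge0_ae_eq_integral => //.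
- by apply: emeasurable_funM => //; exact: nf.1.
- by apply: emeasurable_funM; [exact: nf.1|exact: measurable_EFin_gpdf].
- by move=> x _; apply: mule_ge0; [exact: nf.2|exact: Radon_Nikodym_SigmaFinite.f_ge0].
- by move=> x _; apply: mule_ge0; [exact: nf.2|rewrite lee_fin gpdf_ge0].
- by apply: filterS ae => x xE Tx; rewrite xE.
Qed.

Lemma normal_prob_gpdf (v : R) (B : set R) : (0 < v)%R -> measurable B ->
  normal_prob 0%R (Num.sqrt v) B = \int[mu]_x ((\1_B x)%:E * (gpdf v x)%:E).
Proof.
move=> v0 mB; rewrite -integral_normal_prob//; last exact: nnfun_indic.
by rewrite integral_indic// setIT.
Qed.

Context {d : measure_display} {T : measurableType d} (Pr : probability T R).

Lemma ge0_integral_mfrestr (D : set T) (mD : measurable D) (Doo : Pr D < +oo) (F : T -> \bar R) :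
  nnfun setT F -> \int[mfrestr mD Doo]_t F t = \int[Pr]_(t in D) F t.
Proof.
move=> [mF F0].
have D0 : mfrestr mD Doo (~` D) = 0 by rewrite /mfrestr /mrestr setICl measure0.
have mDC := measurableC mD.
rewrite (@ge0_negligible_integral _ _ _ (mfrestr mD Doo) setT (~` D))//.
rewrite setTD setCK; apply: eq_measure_integral => A mA AD.
by rewrite /= /mfrestr /mrestr setIidl.
Qed.

(** Factorization on rectangles identifies the law of [(U, W)] on [D] with a product measure, by
    uniqueness; Tonelli then produces [gint]. The first factor has mass [Pr D], not 1. *)
Lemma gauss_given_indep {dS} {S : measurableType dS} (D : set T) (U : T -> S) (W : T -> R)
    (v : R) : measurable D ->
  (0 < v)%R -> measurable_fun setT U -> measurable_fun setT W ->
  (forall (A : set S) (B : set R), measurable A -> measurable B ->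
     Pr (D `&` (U @^-1` A `&` W @^-1` B)) =
     Pr (D `&` U @^-1` A) * normal_prob 0%R (Num.sqrt v) B) ->
  gauss_given Pr D U v W.
Proof.
move=> mD v0 mU mW H; split=> //; [exact: measurable_funTS|exact: measurable_funTS|] => F nF.
pose SR := (S * measurableTypeR R)%type.
have nF' : nnfun (T := SR) setT F by exact: nF.
have mUW : measurable_fun setT (fun t => (U t, W t) : SR) by exact: measurable_fun_pair.
have nG := nnfun_gint v nF.
have Doo : Pr D < +oo by rewrite ltey_eq fin_num_measure.
pose rD := mfrestr mD Doo.
have U_oo : pushforward rD U setT < +oo.
  by rewrite /pushforward /rD /mfrestr /mrestr preimage_setT setTI.
pose m1 := mfrestr measurableT U_oo.
have E X : measurable X -> (m1 \x normal_prob 0%R (Num.sqrt v)) X =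
    pushforward rD (fun t => (U t, W t) : SR) X.
  move=> mX; apply: (product_measure_unique (m2 := normal_prob 0%R (Num.sqrt v))) mX => A B mA mB.
  rewrite /= /m1 /rD /mfrestr /mrestr /pushforward setIT setIC [X in _ = Pr X * _]setIC.
  by rewrite -(H A B mA mB).
transitivity (\int[rD]_t F (U t, W t)).
  by rewrite ge0_integral_mfrestr//; exact: (nnfun_comp (f := F) mUW).
transitivity (\int[pushforward rD (fun t => (U t, W t) : SR)]_z F z).
  rewrite (@ge0_integral_pushforward _ _ _ _ R _ mUW rD setT F) //; first exact: nF'.1.
  by move=> z _; exact: nF.2.
transitivity (\int[m1 \x normal_prob 0%R (Num.sqrt v)]_z F z).
  by apply: eq_measure_integral => A mA _; exact: esym (E A mA).
rewrite (fubini_tonelli1 (m1 := m1) (m2 := normal_prob 0%R (Num.sqrt v)) _ nF'.1 nF'.2).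
transitivity (\int[m1]_u gint v F u).
  apply: eq_integral => u _; rewrite /fubini_F integral_normal_prob//.
  exact: nnfun_section1.
transitivity (\int[pushforward rD U]_u gint v F u).
  by apply: eq_measure_integral => A mA _; rewrite /= /m1 /mfrestr /mrestr setIT.
rewrite (@ge0_integral_pushforward _ _ _ _ R _ mU rD setT (gint v F)) //; last 2 first.
- exact: nG.1.
- by move=> z _; exact: nG.2.
by rewrite preimage_setT ge0_integral_mfrestr//; exact: (nnfun_comp (f := gint v F) mU).
Qed.

End GaussianConstruction.

Lemma gauss_given_fst {R : realType} {d d'} {T : measurableType d} {T' : measurableType d'}
    (P : probability T R) (P' : probability T' R) {dS} {S : measurableType dS}
    (U : T -> S) (v : R) (W : T -> R) :
  gauss_given P setT U v W ->
  gauss_given (P \x P')%E setT (fun z : T * T' => U z.1) v (fun z => W z.1).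
Proof.
move=> [mU mW v0 H]; split=> //.
- exact: (measurableT_comp mU).
- exact: (measurableT_comp mW).
move=> F nF.
have lift (G : T -> \bar R) : nnfun setT G ->
    (\int[P \x P']_z G z.1 = \int[P]_t G t)%E.
  move=> nG; have nG' : nnfun setT (fun z : T * T' => G z.1).
    exact: (nnfun_comp measurable_fst nG).
  rewrite (fubini_tonelli1 (m1 := P) (m2 := P') _ nG'.1 nG'.2).
  by apply: eq_integral => t _; rewrite /fubini_F/= integral_probability_cst.
rewrite (lift (fun t => F (U t, W t))); last first.
  by apply: (nnfun_comp _ nF); exact: measurable_fun_pair.
rewrite (lift (fun t => gint v F (U t))); last by apply: (nnfun_comp mU); exact: nnfun_gint.
exact: H.
Qed.

Lemma measurable_past {R : realType} {d} {T : measurableType d} (D : set T)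
    (V : nat -> T -> R) i :
  (forall s, (s < i)%N -> measurable_fun D (V s)) -> measurable_fun D (past V i : T -> seqspace R).
Proof.
move=> mV; apply: measurable_to_seqspace => s; rewrite /past.
by case: (ltnP s i) => si; [exact: mV|exact: measurable_cst].
Qed.

(** Each variable is the coordinate of a new factor of the space carrying N(0, [vs N]), hence
    independent of all earlier ones. *)
Lemma exists_gauss_chain {R : realType} (vs : nat -> R) (N : nat) : (forall i, 0 < vs i) ->
  exists (d : measure_display) (T : measurableType d) (P : probability T R) (V : nat -> T -> R),
    (forall i, measurable_fun setT (V i)) /\
    forall i, (i < N)%N -> gauss_given P setT (past V i : T -> seqspace R) (vs i) (V i).
Proof.
move=> v0; elim: N => [|N [d [T [P [V [mV gV]]]]]].
  exists _, _, (normal_prob (0 : R) 1 : probability _ R), (fun _ _ => 0).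
  by split=> // i; exact: measurable_cst.
pose nu : probability _ R := normal_prob (0 : R) (Num.sqrt (vs N)).
pose V' i (z : T * measurableTypeR R) : R :=
  if (i < N)%N then V i z.1 else if i == N then z.2 else 0.
have pE i : (i <= N)%N -> past V' i = (fun z => past V i z.1).
  move=> iN; apply/funext => z; apply/funext => s; rewrite /past /V'.
  by case: ltnP => // si; rewrite (leq_trans si iN).
exists _, (T * measurableTypeR R)%type, (P \x nu)%E, V'; split=> [i|i].
  rewrite /V'; case: (i < N)%N; first exact: (measurableT_comp (mV i)).
  by case: (i == N); [exact: measurable_snd|exact: measurable_cst].
rewrite ltnS leq_eqVlt => /predU1P[->|iN].
  rewrite pE// (_ : V' N = snd); last by apply/funext => z; rewrite /V' ltnn eqxx.
  have mp : measurable_fun setT (past V N : T -> seqspace R) by apply: measurable_past => s _.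
  split=> //; first exact: (measurableT_comp mp).
  move=> F nF.
  have nF' : nnfun setT (fun z : T * measurableTypeR R => F (past V N z.1, z.2)).
    apply: (nnfun_comp _ nF); apply: measurable_fun_pair => //.
    exact: (measurableT_comp mp).
  have nG' : nnfun setT (fun z : T * measurableTypeR R => gint (vs N) F (past V N z.1)).
    exact: (nnfun_comp (measurableT_comp mp measurable_fst) (nnfun_gint (vs N) nF)).
  rewrite (fubini_tonelli1 (m1 := P) (m2 := nu) _ nF'.1 nF'.2).
  rewrite (fubini_tonelli1 (m1 := P) (m2 := nu) _ nG'.1 nG'.2).
  apply: eq_integral => t _; rewrite /fubini_F/= integral_probability_cst.
  exact: (integral_normal_prob (v0 N) (nnfun_section1 (past V N t : seqspace R) nF)).
rewrite pE 1?ltnW// (_ : V' i = fun z => V i z.1); last by apply/funext => z; rewrite /V' iN.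
exact: (gauss_given_fst nu (gV i iN)).
Qed.

Lemma cvg_sumr {R : realType} (n : nat) (u : nat -> nat -> R) (l : nat -> R) :
  (forall i, u i @ \oo --> l i) ->
  (fun m => \sum_(i < n) u i m) @ \oo --> \sum_(i < n) l i.
Proof.
move=> ul; elim: n => [|n IH].
  by rewrite big_ord0; under eq_fun do rewrite big_ord0; exact: cvg_cst.
by rewrite big_ord_recr/=; under eq_fun do rewrite big_ord_recr/=; exact: cvgD.
Qed.

Lemma measurable_sumr {R : realType} {d} {T : measurableType d} (D : set T) (n : nat)
    (f : nat -> T -> R) :
  (forall i, measurable_fun D (f i)) -> measurable_fun D (fun t => \sum_(i < n) f i t).
Proof.
move=> mf; elim: n => [|n IH].
  by under eq_fun do rewrite big_ord0; exact: measurable_cst.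
by under eq_fun do rewrite big_ord_recr/=; exact: measurable_funD.
Qed.

Section LinearForms.
Context {R : realType}.

Definition linform (n : nat) (co : nat -> R) (y : seqspace R) : R := \sum_(i < n) co i * y i.

Lemma measurable_linform n co : measurable_fun setT (linform n co).
Proof.
apply: (@measurable_sumr R _ (seqspace R) setT n (fun i y => co i * y i)) => i.
by apply: measurable_funM; [exact: measurable_cst|exact: measurable_coord].
Qed.

Lemma cvg_linform n co (x_ : nat -> seqspace R) (x : seqspace R) :
  (forall i, (fun m => x_ m i) @ \oo --> x i) ->
  (fun m => linform n co (x_ m)) @ \oo --> linform n co x.
Proof.
move=> xx; apply: (@cvg_sumr R n (fun i m => co i * x_ m i) (fun i => co i * x i)) => i.
by apply: cvgM; [exact: cvg_cst|exact: xx].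
Qed.

Definition lgpdf (v x : R) : R := - (ln (2 * pi * v) + x ^+ 2 / v) / 2.

Lemma gpdf_expR v x : gpdf v x = expR (lgpdf v x). Proof. by []. Qed.

Lemma measurable_lgpdf v : measurable_fun setT (lgpdf v).
Proof.
apply: measurable_funM => //; apply: measurable_funN.
by apply: measurable_funD => //; apply: measurable_funM => //; apply: measurable_funX.
Qed.

Lemma cvg_lgpdf v (u : nat -> R) l : u @ \oo --> l -> (fun m => lgpdf v (u m)) @ \oo --> lgpdf v l.
Proof.
move=> ul; apply: cvgM; last exact: cvg_cst.
apply: cvgN; apply: cvgD; first exact: cvg_cst.
by apply: cvgM; [under eq_fun do rewrite expr2; exact: cvgM|exact: cvg_cst].
Qed.

End LinearForms.

Section GaussianMutualInformation.
Context {R : realType} {d : measure_display} {T : measurableType d}.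
Variable Pr : probability T R.
Local Notation mu := (@lebesgue_measure R).
Local Notation gauss_law := (gauss_given Pr setT (fun=> tt)).

Lemma gauss_given_law {dS} {S : measurableType dS} (U : T -> S) v W :
  gauss_given Pr setT U v W -> gauss_law v W.
Proof. exact: (gauss_given_map (phi := fun=> tt)). Qed.

Lemma gauss_law_integral v W (F : R -> \bar R) : gauss_law v W -> nnfun setT F ->
  (\int[Pr]_t F (W t) = \int[mu]_w (F w * (gpdf v w)%:E))%E.
Proof.
move=> [_ _ _ H] nF; rewrite (H (fun p => F p.2)); last first.
  exact: (nnfun_comp measurable_snd nF).
exact: integral_probability_cst.
Qed.

Lemma gauss_law_sqr v W : gauss_law v W -> (\int[Pr]_t (W t ^+ 2)%:E = v%:E)%E.
Proof.
move=> gW; have [_ _ v0 _] := gW.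
rewrite (gauss_law_integral (F := fun w => (w ^+ 2)%:E) gW).
  by under eq_integral do rewrite -EFinM; exact: integral_sqr_gpdf.
by apply: (nnfun_EFin (f := fun w : R => w ^+ 2)) => [|w]; [exact: measurable_funX|exact: sqr_ge0].
Qed.

Lemma gauss_law_sqr_integrable v W : gauss_law v W -> Pr.-integrable setT (fun t => (W t ^+ 2)%:E).
Proof.
move=> gW; have [_ mW v0 _] := gW; apply/integrableP; split.
  by apply/measurable_EFinP; exact: measurable_funX.
under eq_integral do rewrite gee0_abs ?lee_fin ?sqr_ge0//.
by rewrite (gauss_law_sqr gW) ltry.
Qed.

Lemma lgpdf_integrable v w W : gauss_law v W -> Pr.-integrable setT (fun t => (lgpdf w (W t))%:E).
Proof.
move=> gW.
rewrite (_ : (fun t => _) = (fun t => (- ln (2 * pi * w) / 2)%:E + (- (2 * w)^-1)%:E * (W t ^+ 2)%:E)%E).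
  apply: integrableD => //; first exact: finite_measure_integrable_cst.
  by apply: integrableZl => //; exact: gauss_law_sqr_integrable gW.
by apply/funext => t; rewrite -EFinM -EFinD; congr EFin; rewrite /lgpdf invfM; ring.
Qed.

(** Minus the differential entropy of N(0, v), in nats. *)
Lemma integral_lgpdf v W : gauss_law v W ->
  (\int[Pr]_t (lgpdf v (W t))%:E = (- (ln (2 * pi * v) + 1) / 2)%:E)%E.
Proof.
move=> gW; have [_ _ v0 _] := gW.
transitivity (\int[Pr]_t ((- ln (2 * pi * v) / 2)%:E + (- (2 * v)^-1)%:E * (W t ^+ 2)%:E))%E.
  by apply: eq_integral => t _; rewrite -EFinM -EFinD; congr EFin; rewrite /lgpdf invfM; ring.
have iW := gauss_law_sqr_integrable gW.
rewrite integralD//; [|exact: finite_measure_integrable_cst|exact: integrableZl].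
rewrite integral_probability_cst integralZl// (gauss_law_sqr gW) -EFinM -EFinD.
by congr EFin; field; rewrite gt_eqF.
Qed.

Definition seq1 (y : R) : seqspace R := fun i => if i is 0 then y else 0.

Lemma measurable_seq1 : measurable_fun setT seq1.
Proof. by apply: measurable_to_seqspace => -[|i]; [exact: measurable_id|exact: measurable_cst]. Qed.

Lemma tup1 Y : tup [:: Y] = (fun t : T => seq1 (Y t)).
Proof. by apply/funext => t; apply/funext => -[|i]; rewrite /tup/= ?nth_nil. Qed.

Definition seq2 (y z : R) : seqspace R := fun i => if i is 0 then y else if i is 1 then z else 0.

Lemma tup2 Y Z : tup [:: Y; Z] = (fun t : T => seq2 (Y t) (Z t)).
Proof. by apply/funext => t; apply/funext => -[|[|i]]; rewrite /tup/= ?nth_nil. Qed.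

Lemma mutual_info_indep s1 s2 : measurable_list s1 -> measurable_list s2 ->
  (forall B1 B2 : set (seqspace R), measurable B1 -> measurable B2 ->
     (Pr (tup s1 @^-1` B1 `&` tup s2 @^-1` B2) <=
      Pr (tup s1 @^-1` B1) * Pr (tup s2 @^-1` B2))%E) ->
  (mutual_info Pr s1 s2 <= 0)%E.
Proof.
move=> ms1 ms2 H.
have := @mutual_info_le _ _ _ Pr s1 s2 (fun=> 0) 0 ms1 ms2.
rewrite mul0r; apply; first exact: finite_measure_integrable_cst.
  exact: integral_probability_cst.
move=> B1 B2 mB1 mB2; apply: le_trans (H _ _ mB1 mB2).
have mB : measurable (tup s1 @^-1` B1 `&` tup s2 @^-1` B2).
  by apply: measurableI; rewrite -[X in measurable X]setTI; apply: measurable_tup.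
under eq_integral do rewrite oppr0 expR0.
by rewrite (integral_cst _ mB) mul1e.
Qed.

Section SingleOutput.
Variables (c : seq (T -> R)) (n : nat) (co : nat -> R) (Y W : T -> R) (tau sig : R).
Hypothesis mc : measurable_list c.
Hypothesis YE : forall t, Y t = linform n co (tup c t) + W t.
Hypothesis gW : gauss_given Pr setT (tup c) tau W.
Hypothesis gY : gauss_law sig Y.

Let mY : measurable_fun setT Y. Proof. by case: gY. Qed.
Let mW : measurable_fun setT W. Proof. by case: gW. Qed.
Let tau0 : 0 < tau. Proof. by case: gW. Qed.
Let sig0 : 0 < sig. Proof. by case: gY. Qed.
Let mlY : measurable_list [:: Y].
Proof. by apply: measurable_list_cons => //; exact: measurable_list_nil. Qed.

(** The log-likelihood ratio of the law of [Y] given [c] to its marginal law, evaluated at [Y]. Its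
    mean is the mutual information in nats. *)
Let g t := lgpdf tau (W t) - lgpdf sig (Y t).

Let ig : Pr.-integrable setT (EFin \o g).
Proof.
have i1 := lgpdf_integrable tau (gauss_given_law gW); have i2 := lgpdf_integrable sig gY.
rewrite (_ : EFin \o g = (fun t => (lgpdf tau (W t))%:E - (lgpdf sig (Y t))%:E)%E) //.
exact: integrableB.
Qed.

Let Eg : (\int[Pr]_t (g t)%:E = ((ln (sig / tau)) / 2)%:E)%E.
Proof.
have i1 := lgpdf_integrable tau (gauss_given_law gW); have i2 := lgpdf_integrable sig gY.
under eq_integral do rewrite /g EFinB.
rewrite integralB// (integral_lgpdf (gauss_given_law gW)) (integral_lgpdf gY) -EFinB.
congr EFin; have pp : 0 < 2 * pi :> R by rewrite mulr_gt0// pi_gt0.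
by rewrite !lnM ?posrE ?invr_gt0 ?pi_gt0 ?mulr_gt0 ?pi_gt0// lnV ?posrE//; field.
Qed.

(** Multiplying by [expR (- g)] replaces the density of [Y] given [c] by its marginal density, which
    no longer depends on [c]; the rectangle condition holds with equality. *)
Lemma mutual_info_gauss_le : (mutual_info Pr c [:: Y] <= (ln (sig / tau) / 2 / ln 2)%:E)%E.
Proof.
apply: (@mutual_info_le _ _ _ _ _ _ g) => // B1 B2 mB1 mB2.
pose C2 := seq1 @^-1` B2.
have mC2 : measurable C2 by rewrite -[X in measurable X]setTI; exact: measurable_seq1.
have mU : measurable_fun setT (tup c) by exact: measurable_tup.
have mA1 : measurable (tup c @^-1` B1) by rewrite -[X in measurable X]setTI; exact: mU.
pose p := linform n co.
pose F (q : seqspace R * R) : \bar R := ((\1_B1 q.1)%:E *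
  ((\1_C2 (p q.1 + q.2)%R)%:E * (expR (lgpdf sig (p q.1 + q.2) - lgpdf tau q.2))%:E))%E.
have mpw : measurable_fun setT (fun q : seqspace R * R => p q.1 + q.2).
  by apply: measurable_funD => //; apply: (measurableT_comp (measurable_linform n co)).
have nF : nnfun setT F.
  apply: nnfunM; first exact: (nnfun_comp measurable_fst (nnfun_indic setT mB1)).
  apply: nnfunM; first exact: (nnfun_comp mpw (nnfun_indic setT mC2)).
  apply: (nnfun_EFin (f := fun q : seqspace R * R => expR (lgpdf sig (p q.1 + q.2) - lgpdf tau q.2))) => [|q]; last exact: expR_ge0.
  apply: measurableT_comp => //; apply: measurable_funB.
    exact: (measurableT_comp (measurable_lgpdf sig)).
  exact: (measurableT_comp (measurable_lgpdf tau)).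
have PY : (Pr (tup [:: Y] @^-1` B2) = \int[mu]_y ((\1_C2 y)%:E * (gpdf sig y)%:E))%E.
  rewrite -(gauss_law_integral gY (nnfun_indic setT mC2)).
  rewrite -(setIT (tup _ @^-1` _)) tup1 -integral_indic//.
  by rewrite -[X in measurable X]setTI; exact: (mY measurableT mC2).
rewrite PY integral_mkcond.
have gF u : gint tau F u = ((\int[mu]_y ((\1_C2 y)%:E * (gpdf sig y)%:E)) * (\1_B1 u)%:E)%E.
  pose f (y : R) := ((\1_C2 y)%:E * (gpdf sig y)%:E)%E.
  have nf : nnfun setT f by apply: nnfunM; [exact: nnfun_indic|exact: nnfun_gpdf].
  have nf' : nnfun setT (fun w : R => f (w + p u)%R).
    by apply: (nnfun_comp (U := fun w : R => w + p u)) nf; exact: measurable_funD.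
  have k0 : (0 <= (\1_B1 u)%:E :> \bar R)%E by rewrite lee_fin.
  rewrite muleC; apply: etrans (f_equal (fun z => _ * z)%E (ge0_integral_shift (p u) nf.1 nf.2)).
  rewrite -(nnintZ mu measurableT k0 nf').
  apply: eq_integral => w _; rewrite /F/= -muleA (addrC w) /f.
  apply: (f_equal (fun z => _ * z)%E); rewrite -muleA; apply: (f_equal (fun z => _ * z)%E).
  by rewrite -EFinM !gpdf_expR -expRD subrK.
rewrite (eq_integral (fun t => F (tup c t, W t))).
  have [_ _ _ ->//] := gW.
  under eq_integral do rewrite gF.
  rewrite nnintZ//; last 2 first.
  - by apply: nnint_ge0; apply: nnfunM; [exact: nnfun_indic|exact: nnfun_gpdf].
  - exact: (nnfun_comp mU (nnfun_indic setT mB1)).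
  rewrite muleC (_ : (\int[Pr]_x _)%E = Pr (tup c @^-1` B1)) //.
  by rewrite -(setIT (tup c @^-1` B1)) -integral_indic.
move=> t _; rewrite patchE /F/= -YE.
case: ifPn => [/set_mem[h1 h2]|].
  rewrite indicE mem_set// mul1e indicE mem_set; last by rewrite /C2/=; move: h2; rewrite tup1.
  by rewrite mul1e /g opprB.
rewrite notin_setE/= => /not_andP[h|h].
  by rewrite indicE memNset// mul0e.
by rewrite [X in (_ * (X%:E * _))%E]indicE memNset ?mul0e ?mule0//= /C2/=; move: h; rewrite tup1.
Qed.

(** For each fixed value of [c], the exponential of the test function is a ratio of densities, so
    its mean under the law of [Y] is 1. *)
Lemma mutual_info_gauss_ge : ((ln (sig / tau) / 2 / ln 2)%:E <= mutual_info Pr c [:: Y])%E.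
Proof.
pose G (x y : seqspace R) : R := lgpdf tau (y 0%N - linform n co x) - lgpdf sig (y 0%N).
have GE t : G (tup c t) (tup [:: Y] t) = g t.
  by rewrite /G tup1/= YE addrAC subrr add0r /g YE.
have mG : measurable_fun setT (fun p : seqspace R * seqspace R => G p.1 p.2).
  have m0 : measurable_fun setT (fun p : seqspace R * seqspace R => p.2 0%N).
    exact: (measurableT_comp (measurable_coord 0)).
  apply: measurable_funB; last exact: (measurableT_comp (measurable_lgpdf sig)).
  apply: (measurableT_comp (measurable_lgpdf tau)); apply: measurable_funB => //.
  exact: (measurableT_comp (measurable_linform n co)).
apply: (@mutual_info_ge _ _ _ _ _ _ G) => //.
- move=> x_ y_ x y hx hy; apply: cvgB; apply: cvg_lgpdf; last exact: hy.
  by apply: cvgB; [exact: hy|exact: cvg_linform].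
- by under eq_fun do rewrite GE; exact: ig.
- by under eq_integral do rewrite GE; exact: Eg.
have E t : (\int[Pr]_t' (expR (G (tup c t) (tup [:: Y] t')))%:E = 1)%E.
  pose f (y : R) := (expR (lgpdf tau (y - linform n co (tup c t)) - lgpdf sig y))%:E.
  have nf : nnfun setT f.
    apply: (nnfun_EFin (f := fun y : R => expR (lgpdf tau (y - linform n co (tup c t)) - lgpdf sig y))) => [|y]; last exact: expR_ge0.
    apply: measurableT_comp => //; apply: measurable_funB; last exact: measurable_lgpdf.
    by apply: (measurableT_comp (measurable_lgpdf tau)); apply: measurable_funB.
  rewrite tup1 (gauss_law_integral gY nf) -[RHS](integral_gpdf (linform n co (tup c t)) tau0).
  by apply: eq_integral => y _; rewrite /f -EFinM gpdf_expR -expRD subrK.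
by under eq_integral do rewrite E; rewrite integral_probability_cst.
Qed.

End SingleOutput.
End GaussianMutualInformation.

Section TwoOutputs.
Context {R : realType} {d : measure_display} {T : measurableType d}.
Variable Pr : probability T R.
Local Notation mu := (@lebesgue_measure R).
Local Notation gauss_law := (gauss_given Pr setT (fun=> tt)).

(** The joint density of the outputs is factored through the innovation [Y2 - kappa * Y1]. No
    matching upper bound is needed: in its application the subtracted mutual information is that of
    independent variables. *)
Lemma mutual_info_gauss2_ge (c : seq (T -> R)) n (co1 co2 : nat -> R) (Y1 Y2 Z1 Z2 : T -> R)
    (kappa sig1 sig2 : R) :
  measurable_list c ->
  (forall t, Y1 t = linform n co1 (tup c t) + Z1 t) ->
  (forall t, Y2 t = linform n co2 (tup c t) + Z2 t) ->
  gauss_law 1 Z1 -> gauss_law 1 Z2 -> gauss_law sig1 Y1 ->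
  gauss_given Pr setT Y1 sig2 (fun t => Y2 t - kappa * Y1 t) ->
  ((ln (sig1 * sig2) / 2 / ln 2)%:E <= mutual_info Pr c [:: Y1; Y2])%E.
Proof.
move=> mc Y1E Y2E gZ1 gZ2 gY1 gV; set V := (fun t => Y2 t - kappa * Y1 t) in gV.
have gV' := gauss_given_law gV.
have [_ mY1 s10 _] := gY1; have [_ mV s20 HV] := gV.
have mY2 : measurable_fun setT Y2.
  rewrite (_ : Y2 = (fun t => V t + kappa * Y1 t)); last by apply/funext => t; rewrite subrK.
  by apply: measurable_funD => //; exact: measurable_funM.
have mlY : measurable_list [:: Y1; Y2].
  by do 2 (apply: measurable_list_cons => //); exact: measurable_list_nil.
pose G (x y : seqspace R) : R :=
  (lgpdf 1 (y 0%N - linform n co1 x) + lgpdf 1 (y 1%N - linform n co2 x)) -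
  (lgpdf sig1 (y 0%N) + lgpdf sig2 (y 1%N - kappa * y 0%N)).
pose g t := (lgpdf 1 (Z1 t) + lgpdf 1 (Z2 t)) - (lgpdf sig1 (Y1 t) + lgpdf sig2 (V t)).
have GE t : G (tup c t) (tup [:: Y1; Y2] t) = g t.
  by rewrite /G /g /V tup2/= Y1E Y2E; congr (lgpdf _ _ + lgpdf _ _ - _); ring.
have i1 := lgpdf_integrable 1 gZ1; have i2 := lgpdf_integrable 1 gZ2.
have i3 := lgpdf_integrable sig1 gY1; have i4 := lgpdf_integrable sig2 gV'.
have mlin co : measurable_fun setT (fun p : seqspace R * seqspace R => linform n co p.1).
  exact: (measurableT_comp (measurable_linform n co)).
have mco i : measurable_fun setT (fun p : seqspace R * seqspace R => p.2 i).
  exact: (measurableT_comp (measurable_coord i)).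
apply: (@mutual_info_ge _ _ _ _ _ _ G) => //.
- apply: measurable_funB; apply: measurable_funD.
  + by apply: (measurableT_comp (measurable_lgpdf 1)); exact: measurable_funB.
  + by apply: (measurableT_comp (measurable_lgpdf 1)); exact: measurable_funB.
  + exact: (measurableT_comp (measurable_lgpdf sig1)).
  + apply: (measurableT_comp (measurable_lgpdf sig2)); apply: measurable_funB => //.
    exact: measurable_funM.
- move=> x_ y_ x y hx hy; apply: cvgB; apply: cvgD; apply: cvg_lgpdf; last 2 first.
  + exact: hy.
  + by apply: cvgB; [exact: hy|apply: cvgM; [exact: cvg_cst|exact: hy]].
  + by apply: cvgB; [exact: hy|exact: cvg_linform].
  + by apply: cvgB; [exact: hy|exact: cvg_linform].
- under eq_fun do rewrite GE /g EFinB !EFinD.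
  by apply: integrableB => //; exact: integrableD.
- under eq_integral do rewrite GE /g EFinB !EFinD.
  rewrite integralB//; [|exact: integrableD|exact: integrableD].
  rewrite !integralD// !(integral_lgpdf gZ1) (integral_lgpdf gZ2) (integral_lgpdf gY1).
  rewrite (integral_lgpdf gV') -!EFinD; congr EFin.
  by rewrite !lnM ?posrE ?pi_gt0 ?mulr_gt0 ?pi_gt0// ln1; field.
have E t : (\int[Pr]_t' (expR (G (tup c t) (tup [:: Y1; Y2] t')))%:E = 1)%E.
  set a := linform n co1 (tup c t); set b := linform n co2 (tup c t).
  pose ex (p : R * R) : R := expR ((lgpdf 1 (p.1 - a) + lgpdf 1 (p.2 + kappa * p.1 - b)) -
    (lgpdf sig1 p.1 + lgpdf sig2 p.2)).
  pose F (p : R * R) : \bar R := (ex p)%:E.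
  have nF : nnfun setT F.
    apply: (nnfun_EFin (f := ex)) => [|p]; last exact: expR_ge0.
    apply: measurableT_comp => //; apply: measurable_funB; apply: measurable_funD.
    + by apply: (measurableT_comp (measurable_lgpdf 1)); exact: measurable_funB.
    + apply: (measurableT_comp (measurable_lgpdf 1)); apply: measurable_funB => //.
      by apply: measurable_funD => //; exact: measurable_funM.
    + exact: (measurableT_comp (measurable_lgpdf sig1)).
    + exact: (measurableT_comp (measurable_lgpdf sig2)).
  transitivity (\int[Pr]_t' F (Y1 t', V t'))%E.
    apply: eq_integral => t' _; rewrite /F /ex /G tup2/= /V; congr ((expR _)%:E).
    by rewrite subrK.
  have gF y : gint sig2 F y = (expR (lgpdf 1 (y - a) - lgpdf sig1 y))%:E.
    have nf : nnfun setT (fun w : R => (gpdf 1 (w - (b - kappa * y)))%:E).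
      apply: (nnfun_EFin (f := fun w : R => gpdf 1 (w - (b - kappa * y)))) => [|w]; last exact: gpdf_ge0.
      by apply: (measurableT_comp (measurable_gpdf 1)); exact: measurable_funB.
    transitivity (\int[mu]_w ((expR (lgpdf 1 (y - a) - lgpdf sig1 y))%:E *
        (gpdf 1 (w - (b - kappa * y)))%:E))%E.
      apply: eq_integral => w _; rewrite /F /ex -!EFinM !gpdf_expR -!expRD /=; congr ((expR _)%:E).
      rewrite (_ : w + kappa * y - b = w - (b - kappa * y)); last by ring.
      by ring.
    rewrite (nnintZ mu measurableT _ nf) ?lee_fin ?expR_ge0//.
    by rewrite integral_gpdf// mule1.
  rewrite (HV _ nF).
  have nf : nnfun setT (fun y : R => (expR (lgpdf 1 (y - a) - lgpdf sig1 y))%:E).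
    apply: (nnfun_EFin (f := fun y : R => expR (lgpdf 1 (y - a) - lgpdf sig1 y))) => [|y]; last exact: expR_ge0.
    apply: measurableT_comp => //; apply: measurable_funB; last exact: measurable_lgpdf.
    by apply: (measurableT_comp (measurable_lgpdf 1)); exact: measurable_funB.
  under eq_integral do rewrite gF.
  rewrite (gauss_law_integral gY1 nf) -[RHS](integral_gpdf a (ltr01 : 0 < 1 :> R)).
  by apply: eq_integral => y _; rewrite -EFinM !gpdf_expR -expRD subrK.
by under eq_integral do rewrite E; rewrite integral_probability_cst.
Qed.

(** Three nested Gaussian integrals of the indicator of [H] give a constant [q] that does not see
    [U]; taking the whole space for [A] shows that [q] is the probability of [H]. *)
Lemma gauss_chain_indep {dS} {S : measurableType dS} (U : T -> S) (v1 v2 v3 : R)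
    (W1 W2 W3 : T -> R) (A : set S) (H : set (R * R * R)) :
  gauss_given Pr setT U v1 W1 ->
  gauss_given Pr setT (fun t => (U t, W1 t)) v2 W2 ->
  gauss_given Pr setT (fun t => (U t, W1 t, W2 t)) v3 W3 ->
  measurable A -> measurable H ->
  Pr (U @^-1` A `&` (fun t => (W1 t, W2 t, W3 t)) @^-1` H) =
  (Pr (U @^-1` A) * Pr ((fun t => (W1 t, W2 t, W3 t)) @^-1` H))%E.
Proof.
move=> [mU mW1 v10 H1] [_ mW2 v20 H2] [_ mW3 v30 H3] mA mH.
pose J (p : R * R * R) : \bar R := (\1_H p)%:E.
have nJ : nnfun setT J by exact: nnfun_indic.
pose q : \bar R := gint v1 (fun p : unit * R => gint v2 (fun p' : R * R => gint v3 J p') p.2) tt.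
have q0 : (0 <= q)%E.
  apply: (nnfun_gint v1 _).2; apply: (nnfun_comp measurable_snd).
  by apply: nnfun_gint; exact: nnfun_gint.
have mUA (B : set S) : measurable B -> measurable (U @^-1` B).
  by move=> mB; rewrite -[X in measurable X]setTI; exact: mU.
have mWH : measurable ((fun t => (W1 t, W2 t, W3 t)) @^-1` H).
  rewrite -[X in measurable X]setTI.
  have : measurable_fun setT (fun t => (W1 t, W2 t, W3 t)).
    by apply: measurable_fun_pair => //; exact: measurable_fun_pair.
  by apply.
have main (B : set S) : measurable B ->
    Pr (U @^-1` B `&` (fun t => (W1 t, W2 t, W3 t)) @^-1` H) = (Pr (U @^-1` B) * q)%E.
  move=> mB.
  pose F3 (p : S * R * R * R) : \bar R := ((\1_B p.1.1.1)%:E * J (p.1.1.2, p.1.2, p.2))%E.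
  have m1 : measurable_fun setT (fun p : S * R * R * R => p.1.1.1).
    exact: (measurableT_comp measurable_fst (measurableT_comp measurable_fst measurable_fst)).
  have m2 : measurable_fun setT (fun p : S * R * R * R => p.1.1.2).
    exact: (measurableT_comp measurable_snd (measurableT_comp measurable_fst measurable_fst)).
  have m3 : measurable_fun setT (fun p : S * R * R * R => p.1.2).
    exact: (measurableT_comp measurable_snd measurable_fst).
  have nF3 : nnfun setT F3.
    apply: nnfunM; first exact: (nnfun_comp m1 (nnfun_indic setT mB)).
    apply: (nnfun_comp (U := fun p : S * R * R * R => (p.1.1.2, p.1.2, p.2))) nJ.
    by apply: measurable_fun_pair => //; exact: measurable_fun_pair.
  rewrite -(setIT (_ `&` _)) -(integral_indic Pr measurableT); last first.
    by apply: measurableI => //; exact: mUA.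
  transitivity (\int[Pr]_t F3 (U t, W1 t, W2 t, W3 t))%E.
    apply: eq_integral => t _; rewrite /F3/= /J -EFinM; congr EFin.
    by rewrite indicI.
  rewrite (H3 _ nF3) (H2 _ (nnfun_gint v3 nF3)) (H1 _ (nnfun_gint v2 (nnfun_gint v3 nF3))).
  have nfc (f : R * R -> \bar R) w : nnfun setT f -> nnfun setT (fun x : R => f (w, x)).
    exact: nnfun_section1.
  transitivity (\int[Pr]_t ((\1_B (U t))%:E * q))%E.
    apply: eq_integral => t _; set b := (\1_B (U t))%:E.
    have b0 : (0 <= b :> \bar R)%E by rewrite lee_fin.
    have n3 p' := nnfun_gint_body v3 p' nJ.
    have E3 x y : gint v3 F3 (U t, x, y) = (b * gint v3 J (x, y))%E.
      rewrite /gint -(nnintZ mu measurableT b0 (n3 _)).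
      by apply: eq_integral => w _; rewrite /F3/= muleA.
    have E2 x : gint v2 (gint v3 F3) (U t, x) = (b * gint v2 (gint v3 J) x)%E.
      rewrite /gint -(nnintZ mu measurableT b0 (nnfun_gint_body v2 x (nnfun_gint v3 nJ))).
      by apply: eq_integral => w _; rewrite -[X in (X * _)%E]/(gint v3 F3 (U t, x, w)) E3 muleA.
    have nq : nnfun setT (fun p : unit * R => gint v2 (fun p' : R * R => gint v3 J p') p.2).
      by apply: (nnfun_comp measurable_snd); apply: nnfun_gint; exact: nnfun_gint.
    rewrite /q /gint -(nnintZ mu measurableT b0 (nnfun_gint_body v1 tt nq)).
    apply: eq_integral => w _.
    by rewrite -[X in (X * _)%E]/(gint v2 (gint v3 F3) (U t, w)) E2 muleA.
  under eq_integral do rewrite muleC.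
  rewrite nnintZ//; last exact: (nnfun_comp mU (nnfun_indic setT mB)).
  rewrite muleC; congr (_ * _)%E.
  by rewrite -(setIT (U @^-1` B)) -(integral_indic Pr measurableT)//; exact: mUA.
rewrite (main A mA); congr (_ * _)%E.
have := main setT measurableT.
by rewrite preimage_setT setTI probability_setT mul1e.
Qed.

End TwoOutputs.

(** * Gaussian inputs *)

Ltac meas :=
  lazymatch goal with
  | |- measurable_fun _ (fun p => p) => exact: measurable_id
  | |- measurable_fun _ (fun p => (@?f p, @?g p)) =>
      apply: (measurable_fun_pair (f := f) (g := g)); meas
  | |- measurable_fun _ (fun p => fst (@?f p)) =>
      apply: (measurableT_comp measurable_fst (g := f)); meas
  | |- measurable_fun _ (fun p => snd (@?f p)) =>
      apply: (measurableT_comp measurable_snd (g := f)); meas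
  | |- measurable_fun _ (fun p => (@?f p) + - (@?g p)) =>
      apply: (measurable_funB (f := f) (g := g)); meas
  | |- measurable_fun _ (fun p => (@?f p) + (@?g p)) =>
      apply: (measurable_funD (f := f) (g := g)); meas
  | |- measurable_fun _ (fun p => (@?f p) * (@?g p)) =>
      apply: (measurable_funM (f := f) (g := g)); meas
  | |- _ => first [exact: measurable_cst | exact: measurable_coord
      | exact: measurable_fst | exact: measurable_snd | idtac]
  end.

Lemma sum_ord3 {R : realType} (F : 'I_3 -> R) (j k l : 'I_3) :
  j != k -> j != l -> k != l -> \sum_(i < 3) F i = F j + F k + F l.
Proof.
move=> jk jl kl; rewrite (bigD1 j)//= (bigD1 k)/= 1?eq_sym// (bigD1 l)/=; last first.
  by rewrite (eq_sym l j) (eq_sym l k) jl kl.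
rewrite big1 ?addr0 ?addrA// => i; move: jk jl kl.
by case: i => [[|[|[|//]]] ?]; case: j => [[|[|[|//]]] ?]; case: k => [[|[|[|//]]] ?];
  case: l => [[|[|[|//]]] ?].
Qed.

Section GaussianInput.
Context {R : realType} {d : measure_display} {T : measurableType d}.
Variables (Pr : probability T R) (h : 'I_3 -> R) (P rho : R).
Variables (X : 'I_3 -> T -> R) (Xr : T -> R) (Z : 'I_3 -> T -> R) (Zr : T -> R).
Hypotheses (P0 : 0 < P) (rho1 : rho ^+ 2 < 1).

Local Notation given := (gauss_given Pr setT).

Definition extend (x : 'I_3 -> R) : seqspace R := fun i => if insub i is Some j then x j else 0.

Lemma extendE x (j : 'I_3) : extend x j = x j.
Proof. by rewrite /extend valK. Qed.

Lemma measurable_extend {dS} {S : measurableType dS} (f : S -> 'I_3 -> R) :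
  (forall j, measurable_fun setT (f^~ j)) -> measurable_fun setT (fun s => extend (f s)).
Proof.
move=> mf; apply: measurable_to_seqspace => i; rewrite /extend.
by case: insub => [j|]; [exact: mf|exact: measurable_cst].
Qed.

Definition Xs (t : T) : seqspace R := extend (fun j => X j t).

(** The jointly Gaussian law of the inputs, given as a chain of independent innovations: the
    conditional laws needed later follow from it by adding and reordering. *)
Definition input_chain (L A B : 'I_3) :=
  [/\ given (fun=> tt) P Xr, given Xr P (X L), given (fun t => (Xr t, X L t)) P (X A) &
   given (fun t => (Xr t, X L t, X A t)) (P * (1 - rho ^+ 2)) (fun t => X B t - rho * X A t)].

(** Since [X B] also has variance [P], the estimate of [X A] from [X B] has the same coefficient
    [rho] and the same error variance. Bounds for [A] thus follow from those for [B]. *)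
Lemma input_chain_sym L A B : input_chain L A B -> input_chain L B A.
Proof.
move=> [G1 G2 G3 G4].
have uE : P * (1 - rho ^+ 2) + rho ^+ 2 * P = P by ring.
have E1 := gauss_given_add rho G3 G4; have E2 := gauss_given_bayes measurableT rho G3 G4.
rewrite /= uE in E1 E2.
split; [exact: G1|exact: G2| |].
  by apply: gauss_given_ext E1 => // t; ring.
refine (gauss_given_ext _ _ _ E2) => [t||t].
- by congr (_, _); ring.
- by rewrite mulrAC divff ?mul1r ?gt_eqF.
- by rewrite mulfK ?gt_eqF//; ring.
Qed.

Lemma input_chain_swap L A B : input_chain L A B ->
  given (fun t => (Xr t, X A t)) P (X L) /\
  given (fun t => (Xr t, X A t, X B t - rho * X A t)) P (X L).
Proof.
move=> [G1 G2 G3 G4]; have [G3' G2'] := gauss_given_swap measurableT G2 G3; split; first exact: G2'.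
have G4' : given (fun t => (Xr t, X A t, X L t)) (P * (1 - rho ^+ 2)) (fun t => X B t - rho * X A t).
  by apply: (gauss_given_map (phi := fun p : R * R * R => (p.1.1, p.2, p.1.2))) G4; meas.
by have [_] := gauss_given_swap measurableT G2' G4'.
Qed.

(** [Xr] is first in the chain; successive swaps move it past the three user inputs. *)
Lemma input_chain_relay L A B : L != A -> L != B -> A != B ->
  input_chain L A B -> given Xs P Xr.
Proof.
move=> LA LB AB [G1 G2 G3 G4].
have H2 : given (fun t => (tt, Xr t)) P (X L).
  by apply: (gauss_given_map (phi := fun x : R => (tt, x))) G2; meas.
have [_ K1] := gauss_given_swap measurableT G1 H2.
have H3 : given (fun t => (tt, X L t, Xr t)) P (X A).
  by apply: (gauss_given_map (phi := fun p : R * R => (tt, p.2, p.1))) G3; meas.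
have [_ K2] := gauss_given_swap measurableT K1 H3.
have H4 : given (fun t => (tt, X L t, X A t, Xr t)) (P * (1 - rho ^+ 2)) (fun t => X B t - rho * X A t).
  by apply: (gauss_given_map (phi := fun p : R * R * R => (tt, p.1.2, p.2, p.1.1))) G4; meas.
have [_ K3] := gauss_given_swap measurableT K2 H4.
pose phi (p : unit * R * R * R) : seqspace R :=
  extend (fun j => if j == L then p.1.1.2 else if j == A then p.1.2 else p.2 + rho * p.1.2).
have mphi : measurable_fun setT phi.
  by apply: measurable_extend => j; case: (j == L); [|case: (j == A)]; meas.
apply: gauss_given_ext (gauss_given_map mphi K3) => // t.
rewrite /phi /Xs /=; congr extend; apply/funext => j.
case: eqVneq => [->//|jL]; case: eqVneq => [->//|jA].
rewrite subrK (_ : j = B) //.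
move: LA LB AB jL jA; clear; case: L => [[|[|[|//]]] ?]; case: A => [[|[|[|//]]] ?];
  case: B => [[|[|[|//]]] ?]; case: j => [[|[|[|//]]] ?] //= *; exact: val_inj.
Qed.

End GaussianInput.

Lemma half_log_le {R : realType} (a b : R) :
  0 < a -> a <= b -> ln a / 2 / ln 2 <= ln b / 2 / ln 2.
Proof.
move=> a0 ab; rewrite ler_pM2r ?invr_gt0 ?ln2_gt0// ler_pM2r ?invr_gt0//.
by rewrite ler_ln ?posrE//; exact: lt_le_trans ab.
Qed.

(** * Uplink mutual informations of the Gaussian inputs *)

Section GaussianRegion.
Context {R : realType} {d : measure_display} {T : measurableType d}.
Variables (Pr : probability T R) (h : 'I_3 -> R) (P rho : R).
Variables (X : 'I_3 -> T -> R) (Xr : T -> R) (Z : 'I_3 -> T -> R) (Zr : T -> R).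
Hypotheses (P0 : 0 < P) (rho1 : rho ^+ 2 < 1).

Local Notation given := (gauss_given Pr setT).
Local Notation law := (gauss_given Pr setT (fun=> tt)).
Local Notation chain := (input_chain Pr P rho X Xr).

(** Both mutual informations involve the output variance [sig], which cancels in the difference.
    What remains compares the variance [tau] of the output given [c] with the noise variance 1. *)
Lemma cond_mutual_info_gauss_ge {dS} {S : measurableType dS} (U : T -> S) (fs : seq (S -> R))
    (c0 c : seq (T -> R)) n co n0 co0 (tau sig : R) (Y W N : T -> R) :
  measurable_list (c0 ++ c) -> measurable_list c -> measurable_list fs ->
  (forall t, tup c t = tup fs (U t)) -> given U tau W ->
  (forall t, Y t = linform n co (tup c t) + W t) ->
  given (tup (c0 ++ c)) 1 N ->
  (forall t, Y t = linform n0 co0 (tup (c0 ++ c) t) + N t) -> law sig Y ->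
  ((ln tau / 2 / ln 2)%:E <= cond_mutual_info Pr c0 c [:: Y])%E.
Proof.
move=> mc0c mc mfs cU gW YW gN YN gY.
have gW' : given (tup c) tau W.
  by apply: gauss_given_ext (gauss_given_map (measurable_tup mfs) gW) => // t; rewrite -[RHS]cU.
have [_ _ tau0 _] := gW; have [_ _ sig0 _] := gY.
have lo := mutual_info_gauss_ge mc0c YN gN gY.
have up := mutual_info_gauss_le mc YW gW' gY.
apply: (@le_trans _ _ ((ln (sig / 1) / 2 / ln 2)%:E - (ln (sig / tau) / 2 / ln 2)%:E)%E).
  rewrite -EFinB lee_fin le_eqVlt; apply/orP; left; apply/eqP.
  rewrite divr1 lnM ?posrE ?invr_gt0// lnV ?posrE//.
  by field; rewrite gt_eqF ?ln2_gt0.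
exact: leeB.
Qed.

Let Yr t := \sum_(j < 3) h j * X j t + Zr t.

Hypothesis gZr : given (fun t => (Xs X t, Xr t)) 1 Zr.

Lemma input_chain_measurable L A B : L != A -> L != B -> A != B -> chain L A B ->
  (forall j, measurable_fun setT (X j)) /\ measurable_fun setT Xr.
Proof.
move=> LA LB AB C; have [[_ mXr _ _] [_ mL _ _] [_ mA _ _] _] := C.
have [_ _ [_ mB _ _] _] := input_chain_sym P0 C.
split=> // j; have : [|| j == L, j == A | j == B].
  move: LA LB AB; case: L {C mL} => [[|[|[|//]]] ?]; case: A {mA} => [[|[|[|//]]] ?];
    by case: B {mB} => [[|[|[|//]]] ?]; case: j => [[|[|[|//]]] ?].
by case/or3P => /eqP ->.
Qed.

Lemma noise_after_inputs L A B : chain L A B ->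
  given (fun t => (Xr t, X L t, X A t, X B t - rho * X A t)) 1 Zr.
Proof.
move=> C.
have := gauss_given_map (phi := fun p : seqspace R * R =>
  (p.2, p.1 L, p.1 A, p.1 B - rho * p.1 A)) _ gZr.
have mp (j : 'I_3) : measurable_fun setT (fun p : seqspace R * R => p.1 j).
  exact: (measurableT_comp (measurable_coord j)).
have mphi : measurable_fun setT (fun p : seqspace R * R =>
  (p.2, p.1 L, p.1 A, p.1 B - rho * p.1 A)).
  repeat apply: measurable_fun_pair => //.
  by apply: measurable_funB => //; exact: measurable_funM.
move=> /(_ mphi); apply: gauss_given_ext => // t.
by rewrite /Xs/= !extendE.
Qed.

Lemma given_one L A B : chain L A B ->
  given (fun t => (Xr t, X L t, X A t)) (1 + h B ^+ 2 * (P * (1 - rho ^+ 2)))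
    (fun t => h B * (X B t - rho * X A t) + Zr t).
Proof.
by move=> C; have [_ _ _ G4] := C; exact: (gauss_given_add (h B) G4 (noise_after_inputs C)).
Qed.

Lemma given_two L A B : chain L A B ->
  given (fun t => (Xr t, X L t)) (1 + P * (h A ^+ 2 + h B ^+ 2 + 2 * rho * h A * h B))
    (fun t => h A * X A t + h B * X B t + Zr t).
Proof.
move=> C; have [_ _ G3 _] := C.
apply: gauss_given_ext (gauss_given_add (h A + rho * h B) G3 (given_one C)) => // [|t]; ring.
Qed.

Lemma law_output L A B : L != A -> L != B -> A != B -> chain L A B ->
  law (1 + P * (h A ^+ 2 + h B ^+ 2 + 2 * rho * h A * h B) + h L ^+ 2 * P) Yr.
Proof.
move=> LA LB AB C; have [_ G2 _ _] := C.
apply: gauss_given_ext (gauss_given_law (gauss_given_add (h L) G2 (given_two C))) => // t.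
by rewrite /Yr (sum_ord3 _ LA LB AB); ring.
Qed.

Lemma given_largest L A B : chain L A B ->
  given (fun t => (Xr t, X A t, X B t - rho * X A t)) (1 + h L ^+ 2 * P)
    (fun t => h L * X L t + Zr t).
Proof.
move=> C; have [_ H] := input_chain_swap C.
apply: gauss_given_add H _.
apply: (gauss_given_map (phi := fun p : R * R * R * R => (p.1.1.1, p.1.2, p.2, p.1.1.2)))
  (noise_after_inputs C).
by meas.
Qed.

Lemma given_mixed L A B : chain L A B ->
  given (fun t => (Xr t, X A t)) (1 + h B ^+ 2 * (P * (1 - rho ^+ 2)) + h L ^+ 2 * P)
    (fun t => h L * X L t + (h B * (X B t - rho * X A t) + Zr t)).
Proof.
move=> C; have [H _] := input_chain_swap C.
apply: gauss_given_add H _.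
by apply: (gauss_given_map (phi := fun p : R * R * R => (p.1.1, p.2, p.1.2))) (given_one C); meas.
Qed.

Lemma given_all_inputs (j k l : 'I_3) :
  given (tup [:: X j; X k; X l; Xr]) 1 Zr.
Proof.
pose fs : seq (seqspace R * R -> R) := [:: fun p : seqspace R * R => p.1 j; fun p : seqspace R * R => p.1 k;
  fun p : seqspace R * R => p.1 l; snd].
have mfs : measurable_list fs.
  do 3 (apply: measurable_list_cons; first exact: (measurableT_comp (measurable_coord _))).
  by apply: measurable_list_cons => //; exact: measurable_list_nil.
apply: gauss_given_ext (gauss_given_map (measurable_tup mfs) gZr) => // t.
by apply/funext => -[|[|[|[|i]]]]; rewrite /tup /Xs/= ?extendE// !nth_nil.
Qed.

Lemma output_all_inputs (j k l : 'I_3) : j != k -> j != l -> k != l -> forall t,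
  Yr t = linform 4 (nth 0 [:: h j; h k; h l; 0]) (tup [:: X j; X k; X l; Xr] t) + Zr t.
Proof.
move=> jk jl kl t; rewrite /Yr (sum_ord3 _ jk jl kl); congr (_ + _).
by rewrite /linform !big_ord_recl big_ord0 /tup/=; ring.
Qed.

Section UplinkBounds.
Variables L A B : 'I_3.
Hypotheses (LA : L != A) (LB : L != B) (AB : A != B) (C : chain L A B).

Let mX j : measurable_fun setT (X j).
Proof. by have [] := input_chain_measurable LA LB AB C. Qed.

Let mXr : measurable_fun setT Xr.
Proof. by have [] := input_chain_measurable LA LB AB C. Qed.

Let mlist4 j k l : measurable_list [:: X j; X k; X l; Xr].
Proof. by do 4 (apply: measurable_list_cons => //); exact: measurable_list_nil. Qed.

Let mlist3 k l : measurable_list [:: X k; X l; Xr].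
Proof. by do 3 (apply: measurable_list_cons => //); exact: measurable_list_nil. Qed.

Lemma uplink_one_ge (k l : 'I_3) : (k = A /\ l = L) \/ (k = L /\ l = A) ->
  ((ln (1 + h B ^+ 2 * (P * (1 - rho ^+ 2))) / 2 / ln 2)%:E <=
   cond_mutual_info Pr [:: X B] [:: X k; X l; Xr] [:: Yr])%E.
Proof.
move=> kl; pose sel (k : 'I_3) (p : R * R * R) := if k == L then p.1.2 else p.2.
(* The part [rho * X A] of [X B] is known given [X A], and its contribution joins the coefficient of
   [X A]. *)
pose ck (k : 'I_3) := if k == L then h L else h A + rho * h B.
have msel i : measurable_fun setT (sel i).
  by rewrite /sel; case: (i == L); meas.
have mfs : measurable_list [:: sel k; sel l; (fun p : R * R * R => p.1.1)].
  do 3 (apply: measurable_list_cons; first by [|meas]); exact: measurable_list_nil.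
have LAf : (A == L) = false by rewrite eq_sym (negbTE LA).
have [Bk Bl klne] : [/\ B != k, B != l & k != l].
  by case: kl => -[-> ->]; rewrite ?(eq_sym B) ?(eq_sym A L) ?LA ?LB ?AB.
apply: (cond_mutual_info_gauss_ge (n := 3) (co := nth 0 [:: ck k; ck l; 0]) (c0 := [:: X B])
  (mlist4 B k l) (mlist3 k l) mfs _ (given_one C) _ (given_all_inputs B k l)
  (output_all_inputs Bk Bl klne) (law_output LA LB AB C)) => t.
  apply/funext => -[|[|[|i]]]; rewrite /tup/= ?nth_nil// /sel;
    by case: kl => -[kE lE]; rewrite ?kE ?lE ?eqxx ?LAf.
rewrite /Yr (sum_ord3 _ LA LB AB) /linform !big_ord_recl big_ord0 /tup /ck/=.
by case: kl => -[kE lE]; rewrite ?kE ?lE ?eqxx ?LAf /=; ring.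
Qed.

Lemma uplink_largest_ge (k l : 'I_3) : (k = A /\ l = B) \/ (k = B /\ l = A) ->
  ((ln (1 + h L ^+ 2 * P) / 2 / ln 2)%:E <=
   cond_mutual_info Pr [:: X L] [:: X k; X l; Xr] [:: Yr])%E.
Proof.
move=> kl; pose sel (k : 'I_3) (p : R * R * R) := if k == A then p.1.2 else p.2 + rho * p.1.2.
have msel i : measurable_fun setT (sel i).
  by rewrite /sel; case: (i == A); meas.
have mfs : measurable_list [:: sel k; sel l; (fun p : R * R * R => p.1.1)].
  do 3 (apply: measurable_list_cons; first by [|meas]); exact: measurable_list_nil.
have BAf : (B == A) = false by rewrite eq_sym (negbTE AB).
have [Lk Ll klne] : [/\ L != k, L != l & k != l].
  by case: kl => -[-> ->]; rewrite ?(eq_sym B A) ?LA ?LB ?AB.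
apply: (cond_mutual_info_gauss_ge (n := 3) (co := nth 0 [:: h k; h l; 0]) (c0 := [:: X L])
  (mlist4 L k l) (mlist3 k l) mfs _ (given_largest C) _ (given_all_inputs L k l)
  (output_all_inputs Lk Ll klne) (law_output LA LB AB C)) => t.
  apply/funext => -[|[|[|i]]]; rewrite /tup/= ?nth_nil// /sel;
    by case: kl => -[kE lE]; rewrite ?kE ?lE ?eqxx ?BAf ?subrK.
rewrite /Yr (sum_ord3 _ LA LB AB) /linform !big_ord_recl big_ord0 /tup/=.
by case: kl => -[kE lE]; rewrite ?kE ?lE /=; ring.
Qed.

Let mlist2 l : measurable_list [:: X l; Xr].
Proof. by do 2 (apply: measurable_list_cons => //); exact: measurable_list_nil. Qed.

Lemma uplink_pair_ge (j k : 'I_3) : (j = A /\ k = B) \/ (j = B /\ k = A) ->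
  ((ln (1 + P * (h A ^+ 2 + h B ^+ 2 + 2 * rho * h A * h B)) / 2 / ln 2)%:E <=
   cond_mutual_info Pr [:: X j; X k] [:: X L; Xr] [:: Yr])%E.
Proof.
move=> jk.
have mfs : measurable_list [:: snd; (fst : R * R -> R)].
  do 2 (apply: measurable_list_cons; first by meas); exact: measurable_list_nil.
have [jkne jL kL] : [/\ j != k, j != L & k != L].
  by case: jk => -[-> ->]; rewrite !(eq_sym _ L) ?(eq_sym B A) LA LB AB.
apply: (cond_mutual_info_gauss_ge (n := 2) (co := nth 0 [:: h L; 0]) (c0 := [:: X j; X k])
  (mlist4 j k L) (mlist2 L) mfs _ (given_two C) _ (given_all_inputs j k L)
  (output_all_inputs jkne jL kL) (law_output LA LB AB C)) => t.
  by apply/funext => -[|[|i]]; rewrite /tup/= ?nth_nil.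
by rewrite /Yr (sum_ord3 _ LA LB AB) /linform !big_ord_recl big_ord0 /tup/=; ring.
Qed.

(** The residual of [X B] only adds variance and is dropped: the term in [X L] already exceeds what
    the downlink allows towards [A]. *)
Lemma uplink_mixed_ge (j k : 'I_3) : (j = L /\ k = B) \/ (j = B /\ k = L) ->
  ((ln (1 + h L ^+ 2 * P) / 2 / ln 2)%:E <=
   cond_mutual_info Pr [:: X j; X k] [:: X A; Xr] [:: Yr])%E.
Proof.
move=> jk; have v0 : 0 <= h B ^+ 2 * (P * (1 - rho ^+ 2)).
  apply: mulr_ge0; first exact: sqr_ge0.
  by apply: mulr_ge0; [exact: ltW|rewrite subr_ge0 ltW].
have w0 : 0 <= h L ^+ 2 * P by apply: mulr_ge0; [exact: sqr_ge0|exact: ltW].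
apply: (@le_trans _ _ ((ln (1 + h B ^+ 2 * (P * (1 - rho ^+ 2)) + h L ^+ 2 * P) / 2 / ln 2)%:E)).
  by rewrite lee_fin half_log_le//; lra.
have mfs : measurable_list [:: snd; (fst : R * R -> R)].
  do 2 (apply: measurable_list_cons; first by meas); exact: measurable_list_nil.
have [jkne jA kA] : [/\ j != k, j != A & k != A].
  by case: jk => -[-> ->]; rewrite ?(eq_sym B) ?LA ?LB ?AB.
apply: (cond_mutual_info_gauss_ge (n := 2) (co := nth 0 [:: h A + rho * h B; 0]) (c0 := [:: X j; X k])
  (mlist4 j k A) (mlist2 A) mfs _ (given_mixed C) _ (given_all_inputs j k A)
  (output_all_inputs jkne jA kA) (law_output LA LB AB C)) => t.
  by apply/funext => -[|[|i]]; rewrite /tup/= ?nth_nil.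
by rewrite /Yr (sum_ord3 _ LA LB AB) /linform !big_ord_recl big_ord0 /tup/=; ring.
Qed.

End UplinkBounds.
End GaussianRegion.

(** * Downlink mutual informations of the Gaussian inputs *)

Section Downlink.
Context {R : realType} {d : measure_display} {T : measurableType d}.
Variables (Pr : probability T R) (h : 'I_3 -> R) (P : R).
Variables (X : 'I_3 -> T -> R) (Xr : T -> R) (Z : 'I_3 -> T -> R).
Local Notation given := (gauss_given Pr setT).
Local Notation law := (gauss_given Pr setT (fun=> tt)).

Hypothesis mX : forall j, measurable_fun setT (X j).
Hypothesis gXr : given (Xs X) P Xr.
Hypothesis gZ1 : forall k, given (fun t => (Xs X t, Xr t)) 1 (Z k).
Hypothesis gZ2 : forall k l, k != l -> given (fun t => (Xs X t, Xr t, Z k t)) 1 (Z l).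

Let Y j t := h j * Xr t + Z j t.

Let mXr : measurable_fun setT Xr. Proof. by case: gXr. Qed.
Let mZ j : measurable_fun setT (Z j). Proof. by case: (gZ1 j). Qed.
Let mY j : measurable_fun setT (Y j).
Proof. by apply: measurable_funD => //; exact: measurable_funM. Qed.

Lemma measurable_list_seq s : (forall W : T -> R, List.In W s -> measurable_fun setT W) -> measurable_list s.
Proof.
elim: s => [|W s IH] H; first exact: measurable_list_nil.
by apply: measurable_list_cons; [apply: H; left|apply: IH => V sV; apply: H; right].
Qed.

Let output_law l : law (1 + h l ^+ 2 * P) (Y l).
Proof. exact: gauss_given_law (gauss_given_add (h l) gXr (gZ1 l)). Qed.

(** User inputs are independent of the relay input and of the user noises, so the subtracted term of
    the conditional mutual information is at most 0. *)
Let outputs_indep (s1 s2 : seq (T -> R)) (f1 : seq (seqspace R -> R)) (f2 : seq (R * R * R -> R)) k l :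
  k != l -> measurable_list f1 -> measurable_list f2 ->
  (forall t, tup s1 t = tup f1 (Xs X t)) -> (forall t, tup s2 t = tup f2 (Xr t, Z k t, Z l t)) ->
  measurable_list s1 -> measurable_list s2 -> (mutual_info Pr s1 s2 <= 0)%E.
Proof.
move=> kl mf1 mf2 /funext s1E /funext s2E ms1 ms2; apply: mutual_info_indep => // B1 B2 mB1 mB2.
rewrite s1E s2E.
have mA1 : measurable (tup f1 @^-1` B1).
  by rewrite -[X in measurable X]setTI; apply: measurable_tup.
have mA2 : measurable (tup f2 @^-1` B2).
  by rewrite -[X in measurable X]setTI; apply: measurable_tup.
by have := gauss_chain_indep gXr (gZ1 k) (gZ2 kl) mA1 mA2; move=> ->.
Qed.

Lemma downlink_one_ge l :
  ((ln (1 + h l ^+ 2 * P) / 2 / ln 2)%:E <= cond_mutual_info Pr [:: Xr] [:: X l] [:: Y l])%E.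
Proof.
(* Any second user will do: its noise only fills the third place in [outputs_indep]. *)
have [k kl] : exists k : 'I_3, l != k.
  by case: l => [[|m] lm]; [exists (@Ordinal 3 1 isT)|exists ord0].
have m2 : measurable_list [:: Xr; X l] by apply: measurable_list_seq => W /= [<-|[<-|//]].
have m1 : measurable_list [:: X l] by apply: measurable_list_seq => W /= [<-|//].
have mY1 : measurable_list [:: Y l] by apply: measurable_list_seq => W /= [<-|//].
have up : (mutual_info Pr [:: X l] [:: Y l] <= 0)%E.
  apply: (@outputs_indep _ _ [:: fun y : seqspace R => y l]
    [:: fun p : R * R * R => h l * p.1.1 + p.1.2] l k) => //.
  - by apply: measurable_list_cons; [exact: measurable_coord|exact: measurable_list_nil].
  - by apply: measurable_list_cons; [meas|exact: measurable_list_nil].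
  - by move=> t; apply/funext => -[|i]; rewrite /tup/= ?nth_nil// /Xs extendE.
  - by move=> t; apply/funext => -[|i]; rewrite /tup/= ?nth_nil.
have gN : given (tup [:: Xr; X l]) 1 (Z l).
  have mf : measurable_list [:: snd; fun p : seqspace R * R => p.1 l].
    apply: measurable_list_cons; first by meas.
    apply: measurable_list_cons; first exact: (measurableT_comp (measurable_coord l)).
    exact: measurable_list_nil.
  apply: gauss_given_ext (gauss_given_map (measurable_tup mf) (gZ1 l)) => // t.
  by apply/funext => -[|[|i]]; rewrite /tup/= ?nth_nil// /Xs extendE.
have YE t : Y l t = linform 2 (nth 0 [:: h l; 0]) (tup [:: Xr; X l] t) + Z l t.
  by rewrite /linform !big_ord_recl big_ord0 /tup/= /Y; ring.
have lo := mutual_info_gauss_ge m2 YE gN (output_law l).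
rewrite divr1 in lo; rewrite -[leLHS]sube0; exact: leeB.
Qed.

(** Given [Y k], the error in estimating [Xr] has variance [P / s1], so the innovation of [Y l] has
    variance [1 + h l ^+ 2 * P / s1]. Its product with [s1] is [1 + (h k ^+ 2 + h l ^+ 2) * P]. *)
Lemma downlink_pair_ge k l : k != l ->
  ((ln (1 + (h k ^+ 2 + h l ^+ 2) * P) / 2 / ln 2)%:E <=
   cond_mutual_info Pr [:: Xr] [:: X k; X l] [:: Y k; Y l])%E.
Proof.
move=> kl; have [_ _ P0 _] := gXr.
have m3 : measurable_list [:: Xr; X k; X l].
  by apply: measurable_list_seq => W /= [<-|[<-|[<-|//]]].
have m2 : measurable_list [:: X k; X l] by apply: measurable_list_seq => W /= [<-|[<-|//]].
have mY2 : measurable_list [:: Y k; Y l] by apply: measurable_list_seq => W /= [<-|[<-|//]].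
have up : (mutual_info Pr [:: X k; X l] [:: Y k; Y l] <= 0)%E.
  apply: (@outputs_indep _ _ [:: fun y : seqspace R => y k; fun y : seqspace R => y l]
    [:: fun p : R * R * R => h k * p.1.1 + p.1.2; fun p : R * R * R => h l * p.1.1 + p.2] k l) => //.
  - do 2 (apply: measurable_list_cons; first exact: measurable_coord).
    exact: measurable_list_nil.
  - by do 2 (apply: measurable_list_cons; first by meas); exact: measurable_list_nil.
  - by move=> t; apply/funext => -[|[|i]]; rewrite /tup/= ?nth_nil// /Xs extendE.
  - by move=> t; apply/funext => -[|[|i]]; rewrite /tup/= ?nth_nil.
set s1 := 1 + h k ^+ 2 * P.
have s10 : 0 < s1 by have [] := output_law k.
have gX0 : law P Xr by exact: gauss_given_law gXr.
have gk : given (fun t => (tt, Xr t)) 1 (Z k).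
  by apply: (gauss_given_map (phi := fun p : seqspace R * R => (tt, p.2))) (gZ1 k); meas.
have gV := gauss_given_bayes measurableT (h k) gX0 gk; rewrite /= -/s1 in gV.
set V := (fun t => Xr t - h k * P / s1 * (h k * Xr t + Z k t)) in gV.
have gl : given (fun t => (tt, h k * Xr t + Z k t, V t)) 1 (Z l).
  apply: gauss_given_ext (gauss_given_map (phi := fun p : seqspace R * R * R =>
    (tt, h k * p.1.2 + p.2, p.1.2 - h k * P / s1 * (h k * p.1.2 + p.2))) _ (gZ2 kl)) => //.
  by meas.
have gW := gauss_given_add (h l) gV gl.
pose kappa := h l * (h k * P / s1).
have gW' : given (Y k) (1 + h l ^+ 2 * (P * 1 / s1)) (fun t => Y l t - kappa * Y k t).
  have := gauss_given_map (phi := snd) measurable_snd gW.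
  apply: gauss_given_ext => // t.
  by rewrite /V /kappa /Y; ring.
have mf : measurable_list [:: snd; (fun p : seqspace R * R => p.1 k); (fun p : seqspace R * R => p.1 l)].
  apply: measurable_list_cons; first by meas.
  do 2 (apply: measurable_list_cons; first exact: (measurableT_comp (measurable_coord _))).
  exact: measurable_list_nil.
have YE j t : Y j t = linform 1 (fun=> h j) (tup [:: Xr; X k; X l] t) + Z j t.
  by rewrite /linform !big_ord_recl big_ord0 /tup/= /Y; ring.
have lo := mutual_info_gauss2_ge m3 (YE k) (YE l) (gauss_given_law (gZ1 k))
  (gauss_given_law (gZ1 l)) (output_law k) gW'.
rewrite -[leLHS]sube0; apply: leeB => //; apply: le_trans lo.
rewrite lee_fin le_eqVlt; apply/orP; left; apply/eqP; congr (ln _ / _ / _).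
by rewrite -/s1 /s1; field; rewrite -/s1 gt_eqF.
Qed.

End Downlink.

Lemma ord3_cases (L A B j : 'I_3) : L != A -> L != B -> A != B -> [\/ j = L, j = A | j = B].
Proof.
move=> LA LB AB; have : [|| j == L, j == A | j == B].
  move: LA LB AB; case: L => [[|[|[|//]]] ?]; case: A => [[|[|[|//]]] ?];
    by case: B => [[|[|[|//]]] ?]; case: j => [[|[|[|//]]] ?].
by case/or3P => /eqP ->; [constructor 1|constructor 2|constructor 3].
Qed.

Lemma gauss_given_peel {R : realType} {d} {T : measurableType d} (Pr : probability T R)
    {dS} {S : measurableType dS} (U : T -> S) (W : T -> R) (A : set S) (B : set R) :
  gauss_given Pr setT U 1 W -> measurable A -> measurable B ->
  Pr (U @^-1` A `&` W @^-1` B) = (Pr (U @^-1` A) * gauss B)%E.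
Proof.
move=> [mU mW v0 H] mA mB.
have mUA : measurable (U @^-1` A) by rewrite -[X in measurable X]setTI; exact: mU.
have mWB : measurable (W @^-1` B) by rewrite -[X in measurable X]setTI; exact: mW.
pose F (p : S * R) : \bar R := ((\1_A p.1)%:E * (\1_B p.2)%:E)%E.
have nF : nnfun setT F.
  apply: nnfunM; first exact: (nnfun_comp measurable_fst (nnfun_indic setT mA)).
  exact: (nnfun_comp measurable_snd (nnfun_indic setT mB)).
rewrite -(setIT (_ `&` _)) -(integral_indic Pr measurableT); last exact: measurableI.
transitivity (\int[Pr]_t F (U t, W t))%E.
  by apply: eq_integral => t _; rewrite /F/= -EFinM indicI.
rewrite (H _ nF).
have nB : nnfun setT (fun w : R => (\1_B w)%:E * (gpdf 1 w)%:E)%E.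
  by apply: nnfunM; [exact: nnfun_indic|exact: nnfun_gpdf].
have -> : gauss B = (\int[@lebesgue_measure R]_w ((\1_B w)%:E * (gpdf 1 w)%:E))%E.
  by rewrite /gauss -(normal_prob_gpdf ltr01 mB) sqrtr1.
transitivity (\int[Pr]_t ((\int[@lebesgue_measure R]_w ((\1_B w)%:E * (gpdf 1 w)%:E)) * (\1_A (U t))%:E))%E.
  apply: eq_integral => t _; rewrite muleC /gint -nnintZ// ?lee_fin//.
  by apply: eq_integral => w _; rewrite /F/= muleA.
rewrite nnintZ//; last 2 first.
- exact: nnint_ge0.
- exact: (nnfun_comp mU (nnfun_indic setT mA)).
rewrite muleC; congr (_ * _)%E.
by rewrite -(setIT (U @^-1` A)) -(integral_indic Pr measurableT).
Qed.

(** A chain fixes one order of the three noises; swapping neighbours gives every ordered pair. *)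
Lemma gauss_given_pairwise {R : realType} {d} {T : measurableType d} (Pr : probability T R)
    {dS} {S : measurableType dS} (U : T -> S) (Z : 'I_3 -> T -> R) (i0 i1 i2 : 'I_3) :
  i0 != i1 -> i0 != i2 -> i1 != i2 ->
  gauss_given Pr setT U 1 (Z i0) ->
  gauss_given Pr setT (fun t => (U t, Z i0 t)) 1 (Z i1) ->
  gauss_given Pr setT (fun t => (U t, Z i0 t, Z i1 t)) 1 (Z i2) ->
  (forall k, gauss_given Pr setT U 1 (Z k)) /\
  (forall k l, k != l -> gauss_given Pr setT (fun t => (U t, Z k t)) 1 (Z l)).
Proof.
move=> n01 n02 n12 H0 H1 H2.
have [H1' H10] := gauss_given_swap measurableT H0 H1.
have [H02 _] := gauss_given_swap measurableT H1 H2.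
have [H2' H20] := gauss_given_swap measurableT H0 H02.
have H2s : gauss_given Pr setT (fun t => (U t, Z i1 t, Z i0 t)) 1 (Z i2).
  by apply: (gauss_given_map (phi := fun p : S * R * R => (p.1.1, p.2, p.1.2))) H2; meas.
have [H12 _] := gauss_given_swap measurableT H10 H2s.
have [_ H21] := gauss_given_swap measurableT H1' H12.
split=> [k|k l].
  by case: (ord3_cases k n01 n02 n12) => ->; [exact: H0|exact: H1'|exact: H2'].
case: (ord3_cases k n01 n02 n12) => ->; case: (ord3_cases l n01 n02 n12) => -> kl.
- by exfalso; move: kl; rewrite eqxx.
- exact: H1.
- exact: H02.
- exact: H10.
- by exfalso; move: kl; rewrite eqxx.
- exact: H12.
- exact: H20.
- exact: H21.
- by exfalso; move: kl; rewrite eqxx.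
Qed.

(** * Construction of the Gaussian inputs and noises *)

Section ExistsGaussianInput.
Context {R : realType}.

Lemma exists_gaussian_input (h : 'I_3 -> R) (P rho : R) (L A B : 'I_3) :
  0 < P -> rho ^+ 2 < 1 -> L != A -> L != B -> A != B ->
  exists (d : measure_display) (T : measurableType d) (Pr : probability T R)
    (X : 'I_3 -> T -> R) (Xr : T -> R) (Z : 'I_3 -> T -> R) (Zr : T -> R),
    [/\ single_letter Pr P X Xr Z Zr, input_chain Pr P rho X Xr L A B,
      gauss_given Pr setT (fun t => (Xs X t, Xr t)) 1 Zr,
      (forall k, gauss_given Pr setT (fun t => (Xs X t, Xr t)) 1 (Z k)) &
      forall k l, k != l -> gauss_given Pr setT (fun t => (Xs X t, Xr t, Z k t)) 1 (Z l)].
Proof.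
move=> P0 rho1 LA LB AB.
have v0 : 0 < P * (1 - rho ^+ 2) by rewrite mulr_gt0// subr_gt0.
(* Coordinates 0 to 3 are the relay input, [X L], [X A] and the residual of [X B]; 4 is the relay
   noise, and 5 to 7 are the user noises. *)
pose vs (i : nat) : R := if (i < 3)%N then P else if i == 3%N then P * (1 - rho ^+ 2) else 1.
have vs0 i : 0 < vs i by rewrite /vs; case: (i < 3)%N => //; case: (i == 3%N).
have [d [T [Pr [V [mV gV]]]]] := exists_gauss_chain 8 vs0.
pose X (j : 'I_3) (t : T) := if j == L then V 1%N t else if j == A then V 2%N t
  else V 3%N t + rho * V 2%N t.
pose Z (j : 'I_3) := V (5 + j)%N.
have AL : (A == L) = false by rewrite eq_sym (negbTE LA).
have BL : (B == L) = false by rewrite eq_sym (negbTE LB).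
have BA : (B == A) = false by rewrite eq_sym (negbTE AB).
have mc (i : nat) : measurable_fun setT (fun y : seqspace R => y i) by exact: measurable_coord.
pose xj (j : 'I_3) (y : seqspace R) : R := if j == L then y 1%N else if j == A then y 2%N
  else y 3%N + rho * y 2%N.
have mxj j : measurable_fun setT (xj j).
  by rewrite /xj; case: (j == L); [|case: (j == A)]; meas.
pose xs (y : seqspace R) : seqspace R := extend (fun j => xj j y).
have mxs : measurable_fun setT xs by exact: measurable_extend.
have C : input_chain Pr P rho X (V 0%N) L A B.
  split.
  - exact: (gauss_given_law (gV 0%N isT)).
  - apply: gauss_given_ext (gauss_given_map (mc 0%N) (gV 1%N isT)) => // t.
    by rewrite /X eqxx.
  - have mphi : measurable_fun setT (fun y : seqspace R => (y 0%N, y 1%N)) by meas.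
    apply: gauss_given_ext (gauss_given_map mphi (gV 2%N isT)) => // t.
      by rewrite /X /= eqxx.
    by rewrite /X AL eqxx.
  - have mphi : measurable_fun setT (fun y : seqspace R => (y 0%N, y 1%N, y 2%N)) by meas.
    apply: gauss_given_ext (gauss_given_map mphi (gV 3%N isT)) => // t.
      by rewrite /X /= !eqxx AL.
    by rewrite /X BL BA AL eqxx addrK.
have N0 : gauss_given Pr setT (fun t => (Xs X t, V 0%N t)) 1 (V 4%N).
  have mphi : measurable_fun setT (fun y : seqspace R => (xs y, y 0%N)) by meas.
  by apply: gauss_given_ext (gauss_given_map mphi (gV 4%N isT)).
have N1 : gauss_given Pr setT (fun t => (Xs X t, V 0%N t, V 4%N t)) 1 (Z (@Ordinal 3 0 isT)).
  have mphi : measurable_fun setT (fun y : seqspace R => (xs y, y 0%N, y 4%N)) by meas.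
  by apply: gauss_given_ext (gauss_given_map mphi (gV 5%N isT)).
have N2 : gauss_given Pr setT (fun t => (Xs X t, V 0%N t, V 4%N t, Z (@Ordinal 3 0 isT) t)) 1
    (Z (@Ordinal 3 1 isT)).
  have mphi : measurable_fun setT (fun y : seqspace R => (xs y, y 0%N, y 4%N, y 5%N)) by meas.
  by apply: gauss_given_ext (gauss_given_map mphi (gV 6%N isT)).
have N3 : gauss_given Pr setT (fun t => (Xs X t, V 0%N t, V 4%N t, Z (@Ordinal 3 0 isT) t,
    Z (@Ordinal 3 1 isT) t)) 1 (Z (@Ordinal 3 2 isT)).
  have mphi : measurable_fun setT (fun y : seqspace R => (xs y, y 0%N, y 4%N, y 5%N, y 6%N)) by meas.
  by apply: gauss_given_ext (gauss_given_map mphi (gV 7%N isT)).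
have [Z1 Z2] : (forall k, gauss_given Pr setT (fun t => (Xs X t, V 0%N t)) 1 (Z k)) /\
    (forall k l, k != l -> gauss_given Pr setT (fun t => (Xs X t, V 0%N t, Z k t)) 1 (Z l)).
  apply: (@gauss_given_pairwise _ _ _ _ _ _ _ _ (@Ordinal 3 0 isT) (@Ordinal 3 1 isT) (@Ordinal 3 2 isT)).
  - by [].
  - by [].
  - by [].
  - by apply: (gauss_given_map (phi := fst)) N1; meas.
  - apply: (gauss_given_map (phi := fun p : seqspace R * R * R * R => (p.1.1, p.2))) N2; meas.
  - apply: (gauss_given_map (phi := fun p : seqspace R * R * R * R * R => (p.1.1.1, p.1.2, p.2))) N3; meas.
exists d, T, Pr, X, (V 0%N), Z, (V 4%N); split.
- have [mX mXr] := input_chain_measurable P0 LA LB AB C.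
  have [G1 G2 G3 _] := C; have [_ _ G3' _] := input_chain_sym P0 C.
  have lawX j : gauss_given Pr setT (fun=> tt) P (X j).
    case: (ord3_cases j LA LB AB) => ->; [exact: gauss_given_law G2|exact: gauss_given_law G3|].
    exact: gauss_given_law G3'.
  split; first exact: mX. split; first exact: mXr. split; first by move=> j; exact: mV.
  split; first exact: mV. split; last first.
    by split=> [j|]; rewrite (gauss_law_sqr (lawX _), gauss_law_sqr G1).
  move=> BX BXr BZ BZr mBX mBXr mBZ mBZr.
  pose A0 : set (seqspace R * R) := [set y : seqspace R | forall j : 'I_3, BX j (y j)] `*` BXr.
  have mA0 : measurable A0.
    apply: measurableX => //.
    rewrite (_ : [set y | _] = \bigcap_(j in [set: 'I_3]) ((fun y : seqspace R => y j) @^-1` BX j)).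
      apply: fin_bigcap_measurable => // j _.
      by rewrite -[X in measurable X]setTI; apply: measurable_coord.
    by apply/seteqP; split => y /= H j; [move=> _; exact: H|exact: H].
  have gaussE D : measurable D -> gauss D = (fine (gauss D))%:E.
    by move=> mD; rewrite fineK// /gauss fin_num_measure.
  pose U0 t := (Xs X t, V 0%N t).
  have E0 : U0 @^-1` A0 = [set t | (forall j, BX j (X j t)) /\ BXr (V 0%N t)].
    apply/seteqP; split => t; rewrite /U0 /A0 /Xs /=.
      by move=> [H1 H2]; split=> // j; have := H1 j; rewrite extendE.
    by move=> [H1 H2]; split=> // j; rewrite extendE; exact: H1.
  have P1 := gauss_given_peel N0 mA0 mBZr.
  have P2 := gauss_given_peel N1 (measurableX mA0 mBZr) (mBZ (@Ordinal 3 0 isT)).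
  have P3 := gauss_given_peel N2 (measurableX (measurableX mA0 mBZr) (mBZ (@Ordinal 3 0 isT)))
    (mBZ (@Ordinal 3 1 isT)).
  have P4 := gauss_given_peel N3 (measurableX (measurableX (measurableX mA0 mBZr)
    (mBZ (@Ordinal 3 0 isT))) (mBZ (@Ordinal 3 1 isT))) (mBZ (@Ordinal 3 2 isT)).
  set rhs := RHS.
  transitivity (Pr (U0 @^-1` A0) * gauss BZr * gauss (BZ (@Ordinal 3 0 isT)) *
    gauss (BZ (@Ordinal 3 1 isT)) * gauss (BZ (@Ordinal 3 2 isT)))%E; last first.
    rewrite /rhs E0 !big_ord_recl big_ord0 mulr1 /=.
    rewrite (_ : lift ord0 ord0 = @Ordinal 3 1 isT); last exact: val_inj.
    rewrite (_ : lift ord0 (lift ord0 ord0) = @Ordinal 3 2 isT); last exact: val_inj.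
    rewrite (_ : ord0 = @Ordinal 3 0 isT); last exact: val_inj.
    rewrite !EFinM -!gaussE// -E0 fineK; first by rewrite !muleA.
    apply: fin_num_measure; rewrite -[X in measurable X]setTI.
    by have [m0 _ _ _] := N0; exact: m0.
  apply: etrans (etrans P4 _).
    congr (Pr _); apply/seteqP; split => t.
      move=> [H1 [H2 [H3 H4]]].
      have [K1 K2] : (U0 @^-1` A0) t by rewrite E0.
      exact: (conj (conj (conj (conj (conj K1 K2) H4) (H3 _)) (H3 _)) (H3 _)).
    move=> [[[[[K1 K2] H4] H5] H6] H7].
    have : (U0 @^-1` A0) t by split.
    rewrite E0 => -[H1 H2]; split=> //; split=> //; split=> // j.
    by case: (@ord3_cases (@Ordinal 3 0 isT) (@Ordinal 3 1 isT) (@Ordinal 3 2 isT) j) => // ->.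
  apply: (f_equal (fun z => z * _)%E); apply: (etrans P3); apply: (f_equal (fun z => z * _)%E).
  by apply: (etrans P2); apply: (f_equal (fun z => z * _)%E); exact: P1.
- exact: C.
- exact: N0.
- exact: Z1.
- exact: Z2.
Qed.

End ExistsGaussianInput.

Definition in_single_letter_region (R : realType) (h : 'I_3 -> R) (Pw : R) (Rt : 'I_3 -> 'I_3 -> R) :=
  exists (d : measure_display) (T : measurableType d) (Pr : probability T R)
         (X : 'I_3 -> T -> R) (Xr : T -> R) (Z : 'I_3 -> T -> R) (Zr : T -> R),
    single_letter Pr Pw X Xr Z Zr /\
    let Yr : T -> R := fun t => \sum_(j < 3) h j * X j t + Zr t in
    let Y : 'I_3 -> T -> R := fun j t => h j * Xr t + Z j t in
    forall j k l : 'I_3, j != k -> j != l -> k != l ->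
      ((Rt j k + Rt j l)%:E <= cond_mutual_info Pr [:: X j] [:: X k; X l; Xr] [:: Yr])%E /\
      ((Rt j k + Rt j l)%:E <= cond_mutual_info Pr [:: Xr] [:: X k; X l] [:: Y k; Y l])%E /\
      ((Rt j l + Rt k l)%:E <= cond_mutual_info Pr [:: X j; X k] [:: X l; Xr] [:: Yr])%E /\
      ((Rt j l + Rt k l)%:E <= cond_mutual_info Pr [:: Xr] [:: X l] [:: Y l])%E.

Definition capacity {R : realType} (snr : R) : R := ln (1 + snr) / 2 / ln 2.

(** The maximality of [h L ^+ 2] enters twice. The downlink pair cuts away from [A] and from [B]
    have [L] among their receivers, so they follow from the individual uplink cuts; the uplink pair
    cuts towards [A] and [B] follow from the downlink ones. *)
Lemma gaussian_region {R : realType} (h : 'I_3 -> R) (P rho : R) (Rt : 'I_3 -> 'I_3 -> R)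
    (L A B : 'I_3) :
  0 < P -> rho ^+ 2 < 1 -> L != A -> L != B -> A != B ->
  h A ^+ 2 <= h L ^+ 2 -> h B ^+ 2 <= h L ^+ 2 ->
  Rt A B + Rt A L <= capacity (h A ^+ 2 * (P * (1 - rho ^+ 2))) ->
  Rt B A + Rt B L <= capacity (h B ^+ 2 * (P * (1 - rho ^+ 2))) ->
  Rt L A + Rt L B <= capacity (h L ^+ 2 * P) ->
  Rt A L + Rt B L <= capacity (P * (h A ^+ 2 + h B ^+ 2 + 2 * rho * h A * h B)) ->
  Rt L A + Rt L B <= capacity ((h A ^+ 2 + h B ^+ 2) * P) ->
  (forall j k l : 'I_3, j != k -> j != l -> k != l -> Rt j l + Rt k l <= capacity (h l ^+ 2 * P)) ->
  in_single_letter_region h P Rt.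
Proof.
move=> P0 rho1 LA LB AB hA hB RA RB RL RAB RD RE.
have [d [T [Pr [X [Xr [Z [Zr [SL C N0 NZ NZZ]]]]]]]] := exists_gaussian_input h P0 rho1 LA LB AB.
exists d, T, Pr, X, Xr, Z, Zr; split=> //= j k l jk jl kl.
have [mX mXr] := input_chain_measurable P0 LA LB AB C.
have C' := input_chain_sym P0 C.
have gXr := input_chain_relay LA LB AB C.
have BA : B != A by rewrite eq_sym.
have capm a b : 0 <= a -> a <= b -> capacity a <= capacity b.
  by move=> a0 ab; apply: half_log_le; lra.
have hP i i' : h i ^+ 2 <= h i' ^+ 2 -> h i ^+ 2 * P <= h i' ^+ 2 * P.
  by move=> hh; rewrite ler_pM2r.
have hP0 i : 0 <= h i ^+ 2 * P by apply: mulr_ge0; [exact: sqr_ge0|exact: ltW].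
have r1 : 0 < 1 - rho ^+ 2 by rewrite subr_gt0.
have vle i : h i ^+ 2 * (P * (1 - rho ^+ 2)) <= h i ^+ 2 * P.
  apply: ler_wpM2l; first exact: sqr_ge0.
  by rewrite mulrBr mulr1 gerBl mulr_ge0 ?sqr_ge0// ltW.
have v0 i : 0 <= h i ^+ 2 * (P * (1 - rho ^+ 2)).
  by apply: mulr_ge0; [exact: sqr_ge0|apply: mulr_ge0; exact: ltW].
have jE := ord3_cases j LA LB AB; have kE := ord3_cases k LA LB AB.
have lE := ord3_cases l LA LB AB.
split; [|split; [|split]].
- case: jE => jE; rewrite jE in jk jl *.
  + apply: (@le_trans _ _ (capacity (h L ^+ 2 * P))%:E); last first.
      apply: (uplink_largest_ge h P0 N0 LA LB AB C).
      case: kE kl jk => -> ; case: lE jl => ->; rewrite ?eqxx//; by [left|right].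
    rewrite lee_fin; case: kE kl jk => ->; case: lE jl => ->; rewrite ?eqxx// => _ _ _.
    by rewrite addrC.
  + apply: (@le_trans _ _ (capacity (h A ^+ 2 * (P * (1 - rho ^+ 2))))%:E); last first.
      apply: (uplink_one_ge h P0 N0 LB LA BA C').
      case: kE kl jk => -> ; case: lE jl => ->; rewrite ?eqxx//; by [left|right].
    rewrite lee_fin; case: kE kl jk => ->; case: lE jl => ->; rewrite ?eqxx// => _ _ _.
    by rewrite addrC.
  + apply: (@le_trans _ _ (capacity (h B ^+ 2 * (P * (1 - rho ^+ 2))))%:E); last first.
      apply: (uplink_one_ge h P0 N0 LA LB AB C).
      case: kE kl jk => -> ; case: lE jl => ->; rewrite ?eqxx//; by [left|right].
    rewrite lee_fin; case: kE kl jk => ->; case: lE jl => ->; rewrite ?eqxx// => _ _ _.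
    by rewrite addrC.
- apply: le_trans (downlink_pair_ge h mX gXr NZ NZZ kl).
  rewrite lee_fin -/(capacity _).
  have hk0 := hP0 k; have hl0 := hP0 l.
  case: jE => jE; rewrite jE in jk jl *.
  + case: kE kl jk => ->; case: lE jl => ->; rewrite ?eqxx// => _ _ _.
    by rewrite addrC [X in capacity (X * _)]addrC.
  + have -> : Rt A k + Rt A l = Rt A B + Rt A L.
      case: kE kl jk => ->; case: lE jl => ->; rewrite ?eqxx// => _ _ _; exact: addrC.
    apply: (le_trans RA); apply: capm => //; apply: (le_trans (vle A)).
    apply: (le_trans (hP _ _ hA)); rewrite mulrDl.
    by case: kE kl jk hk0 hl0 => ->; case: lE jl => ->; rewrite ?eqxx// => *; lra.
  + have -> : Rt B k + Rt B l = Rt B A + Rt B L.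
      case: kE kl jk => ->; case: lE jl => ->; rewrite ?eqxx// => _ _ _; exact: addrC.
    apply: (le_trans RB); apply: capm => //; apply: (le_trans (vle B)).
    apply: (le_trans (hP _ _ hB)); rewrite mulrDl.
    by case: kE kl jk hk0 hl0 => ->; case: lE jl => ->; rewrite ?eqxx// => *; lra.
- case: lE => lE; rewrite lE in jl kl *.
  + apply: (@le_trans _ _ (capacity (P * (h A ^+ 2 + h B ^+ 2 + 2 * rho * h A * h B)))%:E); last first.
      apply: (uplink_pair_ge h P0 N0 LA LB AB C).
      case: kE kl jk => -> ; case: jE jl => ->; rewrite ?eqxx//; by [left|right].
    rewrite lee_fin; case: kE kl jk => ->; case: jE jl => ->; rewrite ?eqxx// => _ _ _.
    by rewrite addrC.
  + apply: (@le_trans _ _ (capacity (h L ^+ 2 * P))%:E); last first.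
      apply: (uplink_mixed_ge h P0 rho1 N0 LA LB AB C).
      case: kE kl jk => -> ; case: jE jl => ->; rewrite ?eqxx//; by [left|right].
    by rewrite lee_fin; apply: (le_trans (RE _ _ _ jk jl kl)); apply: capm => //; exact: hP.
  + apply: (@le_trans _ _ (capacity (h L ^+ 2 * P))%:E); last first.
      apply: (uplink_mixed_ge h P0 rho1 N0 LB LA BA C').
      case: kE kl jk => -> ; case: jE jl => ->; rewrite ?eqxx//; by [left|right].
    by rewrite lee_fin; apply: (le_trans (RE _ _ _ jk jl kl)); apply: capm => //; exact: hP.
- apply: (@le_trans _ _ (capacity (h l ^+ 2 * P))%:E); last exact: (downlink_one_ge h mX gXr NZ NZZ).
  by rewrite lee_fin; exact: RE.
Qed.

(** * Change of measure *)

Section AutoregressiveKernels.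
Context {R : realType}.
Local Notation mu := (@lebesgue_measure R).

Definition upd (y : seqspace R) (s : nat) (u : R) : seqspace R :=
  fun i => if i == s then u else y i.

Lemma measurable_upd {d} {T : measurableType d} (f : T -> seqspace R) (g : T -> R) s :
  measurable_fun setT f -> measurable_fun setT g -> measurable_fun setT (fun t => upd (f t) s (g t)).
Proof.
move=> mf mg; apply: measurable_to_seqspace => i; rewrite /upd.
by case: (i == s) => //; exact: (measurableT_comp (measurable_coord i) mf).
Qed.

Variables (w : nat -> R) (beta : nat -> seqspace R -> R).
Hypothesis w0 : forall s, 0 < w s.
Hypothesis mbeta : forall s, measurable_fun setT (beta s).

(** The Markov kernel that redraws coordinate [s] from N([beta s y], [w s]), acting on functions. *)
Definition Kop (s : nat) (G : seqspace R -> \bar R) (y : seqspace R) : \bar R :=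
  (\int[mu]_u (G (upd y s u) * (gpdf (w s) (u - beta s y))%:E))%E.

Let nnbody2 s G : nnfun setT G ->
  nnfun setT (fun p : seqspace R * R => (G (upd p.1 s p.2) * (gpdf (w s) (p.2 - beta s p.1))%:E)%E).
Proof.
move=> nG; apply: nnfunM.
  by apply: (nnfun_comp (U := fun p : seqspace R * R => upd p.1 s p.2)) nG; exact: measurable_upd.
apply: (nnfun_EFin (f := fun p : seqspace R * R => gpdf (w s) (p.2 - beta s p.1))).
  apply: (measurableT_comp (measurable_gpdf _)); apply: measurable_funB => //.
  exact: (measurableT_comp (mbeta s)).
by move=> p; exact: gpdf_ge0.
Qed.

Lemma nnfun_Kop_body s G y : nnfun setT G ->
  nnfun setT (fun u : R => (G (upd y s u) * (gpdf (w s) (u - beta s y))%:E)%E).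
Proof. by move=> nG; exact: (nnfun_section1 y (nnbody2 s nG)). Qed.

Lemma nnfun_Kop s G : nnfun setT G -> nnfun setT (Kop s G).
Proof.
move=> nG; split; last by move=> y; apply: nnint_ge0; exact: nnfun_Kop_body.
have nB := nnbody2 s nG.
exact: (measurable_fun_fubini_tonelli_F (m2 := mu) _ nB.1 nB.2).
Qed.

(** The expectation of [G] under the comparison law Q, whose coordinates are drawn one after the
    other starting from the zero sequence; as operators on functions, the last kernel acts first. *)
Fixpoint iterK (N : nat) (G : seqspace R -> \bar R) : \bar R :=
  if N is N'.+1 then iterK N' (Kop N' G) else G (fun=> 0).

Lemma iterK_ge0 N G : nnfun setT G -> (0 <= iterK N G)%E.
Proof. by elim: N G => [|N IH] G nG /=; [exact: nG.2|apply: IH; exact: nnfun_Kop]. Qed.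

Lemma le_iterK N G H : nnfun setT G -> nnfun setT H -> (forall y, G y <= H y)%E ->
  (iterK N G <= iterK N H)%E.
Proof.
elim: N G H => [|N IH] G H nG nH GH //=; apply: IH; [exact: nnfun_Kop|exact: nnfun_Kop|] => y.
apply: nnint_le => //; [exact: nnfun_Kop_body|exact: nnfun_Kop_body|] => u _.
by apply: lee_wpmul2r => //; rewrite lee_fin gpdf_ge0.
Qed.

Lemma iterK1 N : iterK N (fun=> 1%E) = 1%E.
Proof.
elim: N => [|N IH] //=; rewrite -[RHS]IH; congr iterK; apply/funext => y.
by rewrite /Kop; under eq_integral do rewrite mul1e; rewrite integral_gpdf.
Qed.

Lemma iterK_sum N (I : Type) (r : seq I) (G : I -> seqspace R -> \bar R) :
  (forall i, nnfun setT (G i)) ->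
  (iterK N (fun y => \sum_(i <- r) G i y) = \sum_(i <- r) iterK N (G i))%E.
Proof.
elim: N G => [|N IH] G nG //=.
rewrite -IH; last by move=> i; exact: nnfun_Kop.
congr iterK; apply/funext => y; rewrite /Kop.
under eq_integral.
  move=> u _; rewrite ge0_sume_distrl; last by move=> i _; exact: (nG i).2.
  over.
by rewrite nnint_sum// => i; exact: nnfun_Kop_body.
Qed.

Lemma upd_past {d} {T : measurableType d} (eta : nat -> T -> R) s t :
  past eta s.+1 t = upd (past eta s t) s (eta s t).
Proof.
apply/funext => i; rewrite /past /upd ltnS leq_eqVlt.
by case: eqVneq => [->|].
Qed.

Variable alpha : nat -> seqspace R -> R.
Hypothesis malpha : forall s, measurable_fun setT (alpha s).

Definition trunc (s : nat) (y : seqspace R) : seqspace R := fun i => if (i < s)%N then y i else 0.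

Lemma measurable_trunc s : measurable_fun setT (trunc s).
Proof.
apply: measurable_to_seqspace => i; rewrite /trunc.
by case: (i < s)%N; [exact: measurable_coord|exact: measurable_cst].
Qed.

(* The Radon-Nikodym derivative, in terms of the observed sequence, of the law with
   [y s ~ N(beta s, w s)] with respect to the law with [y s ~ N(alpha s, 1)]. *)
Definition lratio (N : nat) (y : seqspace R) : R :=
  \prod_(s < N) (gpdf (w s) (y s - beta s (trunc s y)) / gpdf 1 (y s - alpha s (trunc s y))).

Lemma lratio_ge0 N y : 0 <= lratio N y.
Proof. by apply: prodr_ge0 => s _; rewrite divr_ge0 ?gpdf_ge0. Qed.

Let mfac s (c : nat -> seqspace R -> R) v : (forall s, measurable_fun setT (c s)) ->
  measurable_fun setT (fun y : seqspace R => gpdf v (y s - c s (trunc s y))).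
Proof.
move=> mc; apply: (measurableT_comp (measurable_gpdf v)); apply: measurable_funB.
  exact: measurable_coord.
exact: (measurableT_comp (mc s) (measurable_trunc s)).
Qed.

Lemma inv_gpdf v x : (gpdf v x)^-1 = expR (- lgpdf v x) :> R.
Proof. by rewrite expRN -gpdf_expR. Qed.

Lemma measurable_inv_gpdf {d} {T : measurableType d} v (f : T -> R) : measurable_fun setT f ->
  measurable_fun setT (fun t => (gpdf v (f t))^-1).
Proof.
move=> mf; under eq_fun do rewrite inv_gpdf.
by apply: measurableT_comp => //; apply: measurable_funN; exact: (measurableT_comp (measurable_lgpdf v)).
Qed.

Lemma measurable_lratio N : measurable_fun setT (lratio N).
Proof.
elim: N => [|N IH].
  rewrite (_ : lratio 0 = cst 1); first exact: measurable_cst.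
  by apply/funext => y; rewrite /lratio big_ord0.
rewrite (_ : lratio N.+1 = fun y => lratio N y *
  (gpdf (w N) (y N - beta N (trunc N y)) / gpdf 1 (y N - alpha N (trunc N y)))); last first.
  by apply/funext => y; rewrite /lratio big_ord_recr.
apply: measurable_funM => //; apply: measurable_funM; first exact: mfac.
apply: measurable_inv_gpdf; apply: measurable_funB; first exact: measurable_coord.
exact: (measurableT_comp (malpha N) (measurable_trunc N)).
Qed.

Lemma trunc_past {d} {T : measurableType d} (eta : nat -> T -> R) s N t : (s <= N)%N ->
  trunc s (past eta N t) = past eta s t.
Proof.
move=> sN; apply/funext => i; rewrite /trunc /past.
by case: ltnP => // si; rewrite (leq_trans si sN).
Qed.

Lemma lratio_past {d} {T : measurableType d} (eta : nat -> T -> R) N t :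
  lratio N (past eta N t) =
  \prod_(s < N) (gpdf (w s) (eta s t - beta s (past eta s t)) /
                 gpdf 1 (eta s t - alpha s (past eta s t))).
Proof.
apply: eq_bigr => s _; rewrite !trunc_past ?(ltnW (ltn_ord s))//.
by rewrite /past ltn_ord.
Qed.

Context {d : measure_display} {T : measurableType d} (Pr : {measure set T -> \bar R}).
Variables (D : set T) (eta zeta : nat -> T -> R).
Hypothesis mD : measurable D.

(** By induction on [N]. Given the past, the last output is N([alpha], 1), and the last factor of
    [lratio] turns this density into that of N([beta], [w]), which is one application of [Kop]. *)
Lemma change_of_measure N (G : seqspace R -> \bar R) :
  (forall s t, (s < N)%N -> D t -> eta s t = alpha s (past eta s t) + zeta s t) ->
  (forall s, (s < N)%N -> gauss_given Pr D (past eta s : T -> seqspace R) 1 (zeta s)) ->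
  nnfun setT G ->
  (\int[Pr]_(t in D) ((lratio N (past eta N t))%:E * G (past eta N t)) = Pr D * iterK N G)%E.
Proof.
elim: N G => [|N IH] G Heta Hg nG.
  rewrite (eq_integral (fun=> G (fun=> 0))) => [|t _].
    by rewrite (integral_cst Pr mD) muleC.
  by rewrite /lratio big_ord0 mul1e; congr G; apply/funext => i; rewrite /past ltn0.
rewrite /= -IH; last 3 first.
- by move=> s t sN; apply: Heta; exact: ltnW.
- by move=> s sN; apply: Hg; exact: ltnW.
- exact: nnfun_Kop.
have [mU mZ _ HN] := Hg N (ltnSn N).
pose f (p : seqspace R * R) : R := lratio N p.1 *
  (gpdf (w N) (alpha N p.1 + p.2 - beta N p.1) / gpdf 1 p.2).
pose F (p : seqspace R * R) : \bar R := ((f p)%:E * G (upd p.1 N (alpha N p.1 + p.2)))%E.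
have m1 : measurable_fun setT (fun p : seqspace R * R => alpha N p.1 + p.2).
  by apply: measurable_funD => //; exact: (measurableT_comp (malpha N)).
have nF : nnfun setT F.
  apply: nnfunM.
    apply: (nnfun_EFin (f := f)) => [|p]; last first.
      by apply: mulr_ge0; [exact: lratio_ge0|apply: divr_ge0; exact: gpdf_ge0].
    apply: measurable_funM; first exact: (measurableT_comp (measurable_lratio N)).
    apply: measurable_funM; last exact: measurable_inv_gpdf.
    apply: (measurableT_comp (measurable_gpdf _)); apply: measurable_funB => //.
    exact: (measurableT_comp (mbeta N)).
  apply: (nnfun_comp (U := fun p : seqspace R * R => upd p.1 N (alpha N p.1 + p.2))) nG.
  exact: measurable_upd.
transitivity (\int[Pr]_(t in D) F (past eta N t, zeta N t))%E.
  apply: eq_integral => t /set_mem Dt; rewrite /F/= -(Heta N t)// -upd_past.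
  apply: (f_equal (fun z => z%:E * _)%E); rewrite !lratio_past big_ord_recr/= /f/=.
  by rewrite lratio_past -(Heta N t)//; congr (_ * (_ / gpdf _ _)); rewrite (Heta N t)// addrAC subrr add0r.
rewrite (HN F nF); apply: eq_integral => t _; rewrite /gint; set y := past eta N t.
have nf := nnfun_Kop_body N y nG.
have nf' : nnfun setT (fun z : R => (G (upd y N (z + alpha N y)) *
    (gpdf (w N) (z + alpha N y - beta N y))%:E)%E).
  by apply: (nnfun_comp (U := fun z : R => z + alpha N y)) nf; exact: measurable_funD.
have l0 : (0 <= (lratio N y)%:E)%E by rewrite lee_fin lratio_ge0.
apply: etrans (f_equal (fun z => _ * z)%E (ge0_integral_shift (alpha N y) nf.1 nf.2)).
rewrite -(nnintZ mu measurableT l0 nf'); apply: eq_integral => z _; rewrite /F /f/=.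
have alg (p q r : R) (x : \bar R) : r != 0 ->
    ((p * (q / r))%:E * x * r%:E = p%:E * (x * q%:E))%E.
  move=> r0; rewrite muleAC -EFinM (_ : p * (q / r) * r = p * q); last by field.
  by rewrite EFinM -muleA (muleC x).
by rewrite (addrC z) alg// gt_eqF// gpdf_gt0.
Qed.

End AutoregressiveKernels.

(** * The comparison law seen through the relevant outputs only *)

Section KernelInvariance.
Context {R : realType}.
Variables (w : nat -> R) (rel : pred nat).
Hypothesis w0 : forall s, 0 < w s.

Definition depends_on {V : Type} (G : seqspace R -> V) :=
  forall y y' : seqspace R, (forall s, rel s -> y s = y' s) -> G y = G y'.

Lemma depends_on_Kop beta s G : rel s -> depends_on (beta s) -> depends_on G ->
  depends_on (Kop w beta s G).
Proof.
move=> rs hb hG y y' yy'; rewrite /Kop (hb _ _ yy').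
apply: eq_integral => u _; congr (_ * _)%E; apply: hG => i ri; rewrite /upd.
by case: (i == s) => //; exact: yy'.
Qed.

Lemma Kop_id beta s G : ~~ rel s -> depends_on G -> (forall y, 0 <= G y)%E -> Kop w beta s G = G.
Proof.
move=> rs hG G0; apply/funext => y; rewrite /Kop.
transitivity (\int[@lebesgue_measure R]_u (G y * (gpdf (w s) (u - beta s y))%:E))%E.
  apply: eq_integral => u _; congr (_ * _)%E; apply: hG => i ri; rewrite /upd.
  by case: eqP ri => // ->; rewrite (negbTE rs).
rewrite nnintZ//; first by rewrite integral_gpdf// mule1.
apply: (nnfun_EFin (f := fun u : R => gpdf (w s) (u - beta s y))) => [|u]; last exact: gpdf_ge0.
by apply: (measurableT_comp (measurable_gpdf _)); exact: measurable_funB.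
Qed.

(** Kernels at coordinates that [G] does not read integrate to 1. This lets the comparison law keep
    the true signals, message-dependent though they are, at outputs that the receivers of a cut do
    not see. *)
Lemma iterK_depends beta beta' N G :
  (forall s, measurable_fun setT (beta s)) ->
  (forall s, rel s -> beta s = beta' s) -> (forall s, rel s -> depends_on (beta s)) ->
  nnfun setT G -> depends_on G -> iterK w beta N G = iterK w beta' N G.
Proof.
move=> mb bb hb; elim: N G => [//|N IH] G nG hG; rewrite [LHS]/= [RHS]/=.
have [rN|rN] := boolP (rel N).
  have -> : Kop w beta' N G = Kop w beta N G by rewrite /Kop (bb N rN).
  by apply: IH; [exact: nnfun_Kop|apply: depends_on_Kop => //; exact: hb].
by rewrite (Kop_id _ rN hG nG.2) (Kop_id _ rN hG nG.2); exact: IH.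
Qed.

End KernelInvariance.

Section ConditionedMoments.
Context {R : realType} {d : measure_display} {T : measurableType d}.
Variables (Pr : probability T R) (D : set T).
Hypothesis mD : measurable D.
Local Notation mu := (@lebesgue_measure R).

Lemma gauss_given_integral_sqrD {dS} {S : measurableType dS} (U : T -> S) (W : T -> R)
    (f : S -> R) : gauss_given Pr D U 1 W -> measurable_fun setT f ->
  (\int[Pr]_(t in D) ((f (U t) + W t) ^+ 2)%:E =
   \int[Pr]_(t in D) ((f (U t)) ^+ 2)%:E + Pr D)%E.
Proof.
move=> [mU mW v0 H] mf.
pose F (p : S * R) : \bar R := ((f p.1 + p.2) ^+ 2)%:E.
have nF : nnfun setT F.
  apply: (nnfun_EFin (f := fun p : S * R => (f p.1 + p.2) ^+ 2)) => [|p]; last exact: sqr_ge0.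
  apply: measurable_funX; apply: measurable_funD; last exact: measurable_snd.
  exact: (measurableT_comp mf).
rewrite (H F nF).
transitivity (\int[Pr]_(t in D) ((f (U t) ^+ 2)%:E + 1))%E.
  apply: eq_integral => t _; rewrite /gint /F/=.
  under eq_integral do rewrite -EFinM.
  by rewrite integral_sqrD_gpdf.
rewrite nnintD//; first by rewrite (integral_cst Pr mD) mul1e.
- apply: (nnfun_EFin (f := fun t => f (U t) ^+ 2)) => [|t]; last exact: sqr_ge0.
  by apply: measurable_funX; exact: (measurableT_comp mf).
Qed.

End ConditionedMoments.

(** * Log-likelihood ratio and acceptance for a single message tuple *)

Section ChangeOfMeasureBound.
Context {R : realType} {d : measure_display} {T : measurableType d}.
Variables (Pr : probability T R) (D : set T).
Hypothesis mD : measurable D.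
Variables (N : nat) (eta zeta : nat -> T -> R) (alpha beta : nat -> seqspace R -> R) (w : nat -> R).
Hypothesis w1 : forall s, 1 <= w s.
Hypothesis malpha : forall s, measurable_fun setT (alpha s).
Hypothesis mbeta : forall s, measurable_fun setT (beta s).
Hypothesis Heta : forall s t, (s < N)%N -> D t -> eta s t = alpha s (past eta s t) + zeta s t.
Hypothesis Hg : forall s, (s < N)%N ->
  gauss_given Pr D (past eta s : T -> seqspace R) 1 (zeta s).
Variables (Acc : set (seqspace R)) (M : R).
Hypothesis mAcc : measurable Acc.
Hypothesis M1 : 1 <= M.

Let w0 s : 0 < w s. Proof. by apply: lt_le_trans (w1 s). Qed.

Let loss s t := ln (w s) / 2 + (eta s t - beta s (past eta s t)) ^+ 2 / (2 * w s).

Lemma measurable_past_given s : (s <= N)%N -> measurable_fun D (past eta s : T -> seqspace R).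
Proof.
case: s => [|s] sN; first by apply: measurable_past.
apply: measurable_past => i iN.
have iN' : (i < N)%N by apply: leq_trans sN; rewrite -ltnS in iN *; exact: leq_trans iN _.
have [mUi mZi _ _] := Hg iN'.
apply: (eq_measurable_fun (fun t => alpha i (past eta i t : seqspace R) + zeta i t)).
  by move=> t /set_mem Dt; rewrite -Heta.
by apply: measurable_funD => //; exact: (measurableT_comp (malpha i)).
Qed.

Lemma lratio_loss t : D t ->
  lratio w beta alpha N (past eta N t) =
  expR (\sum_(s < N) (zeta s t ^+ 2 / 2) - \sum_(s < N) loss s t).
Proof.
move=> Dt; rewrite lratio_past -sumrB.
rewrite (big_morph expR (@expRD R) (@expR0 R)); apply: eq_bigr => s _.
rewrite -[X in _ / gpdf 1 X](_ : zeta s t = _); last by rewrite {1}Heta// addrAC subrr add0r.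
rewrite !gpdf_expR -expRN -expRD; congr expR; rewrite /lgpdf /loss.
rewrite !lnM ?posrE ?mulr_gt0 ?pi_gt0// ln1.
by field; rewrite gt_eqF.
Qed.

(** One instance of [1 + x <= expR x] on each side: [x] is the log-likelihood ratio, increased by
    [ln M] when the output is accepted. *)
Lemma loss_bound t : D t ->
  \1_Acc (past eta N t : seqspace R) * ln M + \sum_(s < N) (zeta s t ^+ 2 / 2) + 1 <=
  lratio w beta alpha N (past eta N t) * (M * \1_Acc (past eta N t : seqspace R)) +
  lratio w beta alpha N (past eta N t) + \sum_(s < N) loss s t.
Proof.
move=> Dt; rewrite (lratio_loss Dt).
set z := \sum_(s < N) (zeta s t ^+ 2 / 2); set l := \sum_(s < N) loss s t.
have M0 : 0 < M by apply: lt_le_trans M1.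
rewrite indicE; case: (_ \in Acc); rewrite ?mul1r ?mulr1 ?mul0r ?mulr0.
  have := expR_ge1Dx (z - l + ln M); rewrite expRD lnK ?posrE//.
  by have := expR_ge0 (z - l); lra.
by have := expR_ge1Dx (z - l); lra.
Qed.

(** The integral of [loss_bound] over [D]. By the change of measure, the likelihood ratio integrates
    to [p] and, on acceptance, to [p * q]; each squared residual contributes [e s] plus the variance
    of fresh noise. *)
Lemma integrated_loss_bound (p q pA : R) (e : nat -> R) :
  Pr D = p%:E -> iterK w beta N (fun y => (\1_Acc y : R)%:E) = q%:E ->
  Pr (D `&` [set t | Acc (past eta N t)]) = pA%:E ->
  (forall s, (s < N)%N ->
    (\int[Pr]_(t in D) ((alpha s (past eta s t) - beta s (past eta s t)) ^+ 2)%:E = (e s)%:E)%E) ->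
  pA * ln M + \sum_(s < N) (p / 2) + p <=
  M * (p * q) + p + \sum_(s < N) (ln (w s) / 2 * p + (e s + p) / (2 * w s)).
Proof.
move=> pE qE pAE eE.
have mp s := @measurable_past_given s.
pose U t : seqspace R := past eta N t.
have mU : measurable_fun D U by exact: mp.
have nA : nnfun D (fun t => (\1_Acc (U t) : R)%:E).
  refine (@nnfun_comp _ _ _ _ R D U (fun y : seqspace R => (\1_Acc y)%:E) mU _).
  exact: nnfun_indic.
have nL : nnfun D (fun t => (lratio w beta alpha N (U t))%:E).
  apply: (nnfun_comp (f := fun y => (lratio w beta alpha N y)%:E) mU).
  apply: (nnfun_EFin (f := lratio w beta alpha N)); first exact: measurable_lratio.
  exact: lratio_ge0.
have nLA : nnfun D (fun t => (lratio w beta alpha N (U t))%:E * (\1_Acc (U t))%:E)%E.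
  exact: nnfunM.
have M0 : (0 <= M%:E)%E by rewrite lee_fin; apply: le_trans M1.
have lM0 : (0 <= (ln M)%:E)%E by rewrite lee_fin ln_ge0.
have ir0 : (0 <= (2^-1 : R)%:E)%E by rewrite lee_fin.
have nz (s : 'I_N) : nnfun D (fun t => (2^-1)%:E * (zeta s t ^+ 2)%:E)%E.
  apply: nnfunZ => //; apply: (nnfun_EFin (f := fun t => zeta s t ^+ 2)) => [|t]; last exact: sqr_ge0.
  by apply: measurable_funX; have [] := Hg (ltn_ord s).
have k0 s : (0 <= ((2 * w s)^-1)%:E)%E.
  by rewrite lee_fin invr_ge0 mulr_ge0// ltW.
have lw0 s : (0 <= (ln (w s) / 2)%:E)%E.
  by rewrite lee_fin divr_ge0// ln_ge0.
have nres (s : 'I_N) : nnfun D (fun t => ((eta s t - beta s (past eta s t)) ^+ 2)%:E).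
  apply: (nnfun_EFin (f := fun t => (eta s t - beta s (past eta s t)) ^+ 2)) => [|t]; last exact: sqr_ge0.
  apply: measurable_funX; have [mUi mZi _ _] := Hg (ltn_ord s).
  apply: measurable_funB; last exact: (measurableT_comp (mbeta s)).
  apply: (eq_measurable_fun (fun t => alpha s (past eta s t : seqspace R) + zeta s t)).
    by move=> t /set_mem Dt; rewrite -Heta.
  by apply: measurable_funD => //; exact: (measurableT_comp (malpha s)).
have nloss (s : 'I_N) : nnfun D (fun t => (ln (w s) / 2)%:E +
    ((2 * w s)^-1)%:E * ((eta s t - beta s (past eta s t)) ^+ 2)%:E)%E.
  by apply: nnfunD; [exact: nnfun_cst|exact: nnfunZ].
have n1 : nnfun D (fun=> 1%E : \bar R) by exact: nnfun_cst.
pose lhs t := (((ln M)%:E * (\1_Acc (U t))%:E) + \sum_(s < N) ((2^-1)%:E * (zeta s t ^+ 2)%:E) + 1)%E.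
pose rhs t := ((M%:E * ((lratio w beta alpha N (U t))%:E * (\1_Acc (U t))%:E)) +
   (lratio w beta alpha N (U t))%:E +
   \sum_(s < N) ((ln (w s) / 2)%:E + ((2 * w s)^-1)%:E * ((eta s t - beta s (past eta s t)) ^+ 2)%:E))%E.
have nl1 := nnfunZ lM0 nA; have nl2 := nnfun_sum (index_enum 'I_N) nz.
have nr1 := nnfunZ M0 nLA; have nr3 := nnfun_sum (index_enum 'I_N) nloss.
have : (\int[Pr]_(t in D) lhs t <= \int[Pr]_(t in D) rhs t)%E.
  apply: nnint_le => //.
  - exact: (nnfunD (nnfunD nl1 nl2) n1).
  - exact: (nnfunD (nnfunD nr1 nL) nr3).
  move=> t Dt; have H := loss_bound Dt; rewrite /lhs /rhs /U.
  under eq_bigr do rewrite -EFinM.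
  under [X in (_ <= _ + X)%E]eq_bigr do rewrite -EFinM -EFinD.
  rewrite !sumEFin -!EFinM -!EFinD lee_fin.
  apply: le_trans (le_trans H _).
    rewrite le_eqVlt; apply/orP; left; apply/eqP; congr (_ + _ + _); first exact: mulrC.
    by apply: eq_bigr => s _; exact: mulrC.
  rewrite le_eqVlt; apply/orP; left; apply/eqP; congr (_ + _ + _); first by ring.
  by apply: eq_bigr => s _; rewrite /loss; congr (_ + _); exact: mulrC.
rewrite /lhs /rhs (nnintD Pr mD (nnfunD nl1 nl2) n1) (nnintD Pr mD nl1 nl2).
rewrite (nnintD Pr mD (nnfunD nr1 nL) nr3) (nnintD Pr mD nr1 nL).
rewrite (nnintZ Pr mD lM0 nA) (nnintZ Pr mD M0 nLA).
rewrite (nnint_sum Pr _ mD nz) (nnint_sum Pr _ mD nloss).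
have nAcc : nnfun setT (fun y : seqspace R => (\1_Acc y : R)%:E) by exact: nnfun_indic.
have -> : (\int[Pr]_(t in D) ((lratio w beta alpha N (U t))%:E * (\1_Acc (U t) : R)%:E) =
    p%:E * q%:E)%E.
  apply: etrans (change_of_measure w mbeta malpha mD Heta Hg nAcc) _; rewrite qE.
  by apply: (f_equal (fun z => z * _)%E); exact: pE.
have -> : (\int[Pr]_(t in D) (lratio w beta alpha N (U t))%:E = p%:E)%E.
  have n1T : nnfun setT (fun _ : seqspace R => 1%E : \bar R) by exact: nnfun_cst.
  have := change_of_measure w mbeta malpha mD Heta Hg n1T.
  rewrite (iterK1 beta w0) mule1 => E; apply: etrans pE; apply: etrans E.
  by apply: eq_integral => t _; rewrite mule1.
have -> : (\int[Pr]_(t in D) (\1_Acc (U t) : R)%:E = pA%:E)%E.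
  have mA : measurable (D `&` U @^-1` Acc) by exact: mU mD _ mAcc.
  transitivity (\int[Pr]_(t in D) (\1_(D `&` U @^-1` Acc) t)%:E)%E.
    apply: eq_integral => t Dt; congr EFin; rewrite !indicE; congr (nat_of_bool _)%:R.
    by rewrite in_setI Dt.
  rewrite (nnint_indic Pr mD mA) setIAC setIid; exact: pAE.
have Icst (k : \bar R) : (\int[Pr]_(t in D) cst k t = k * p%:E)%E.
  by apply: etrans (integral_cst Pr mD k) _; apply: (f_equal (fun z => k * z)%E); exact: pE.
rewrite (Icst 1%E) mul1e.
have Ez (s : 'I_N) : (\int[Pr]_(t in D) ((2^-1)%:E * (zeta s t ^+ 2)%:E) = (p / 2)%:E)%E.
  have [mUi mZi _ _] := Hg (ltn_ord s).
  rewrite nnintZ//; last first.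
    apply: (nnfun_EFin (f := fun t => zeta s t ^+ 2)) => [|t]; last exact: sqr_ge0.
    exact: measurable_funX.
  have E := gauss_given_integral_sqrD mD (Hg (ltn_ord s)) (measurable_cst (0 : R)).
  have E' : (\int[Pr]_(t in D) (zeta s t ^+ 2)%:E = p%:E)%E.
    transitivity (\int[Pr]_(t in D) ((cst 0 (past eta s t : seqspace R) + zeta s t) ^+ 2)%:E)%E.
      by apply: eq_integral => t _; rewrite /cst add0r.
    by rewrite E /cst expr0n/= integral0 add0e pE.
  by rewrite E' -EFinM mulrC.
have El (s : 'I_N) : (\int[Pr]_(t in D) ((ln (w s) / 2)%:E +
    ((2 * w s)^-1)%:E * ((eta s t - beta s (past eta s t)) ^+ 2)%:E) =
    (ln (w s) / 2 * p + (e s + p) / (2 * w s))%:E)%E.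
  rewrite (nnintD Pr mD (nnfun_cst D (lw0 s)) (nnfunZ (k0 s) (nres s))).
  rewrite Icst (nnintZ Pr mD (k0 s) (nres s)).
  transitivity ((ln (w s) / 2)%:E * p%:E + ((2 * w s)^-1)%:E * ((e s)%:E + p%:E))%E; last first.
    by rewrite -(EFinD (e s) p) -!EFinM -EFinD; congr EFin; rewrite (mulrC (e s + p)).
  apply: (f_equal (fun z => _ + _ * z)%E).
  rewrite -(eE s (ltn_ord s)) -pE.
  pose f y := alpha s y - beta s y.
  have mf : measurable_fun setT f by exact: measurable_funB.
  have := gauss_given_integral_sqrD mD (Hg (ltn_ord s)) mf.
  move=> <-; apply: eq_integral => t /set_mem Dt; rewrite Heta// /f; congr (_ ^+ 2)%:E; ring.
rewrite (eq_bigr _ (fun s _ => Ez s)) [X in (_ <= _ + X -> _)%E](eq_bigr _ (fun s _ => El s)).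
rewrite !sumEFin -!EFinM -!EFinD lee_fin => H.
by rewrite mulrC.
Qed.

End ChangeOfMeasureBound.

(** * Guessing the crossing messages under the comparison law *)

Section AcceptanceBound.
Context {R : realType} {d : measure_display} {T : measurableType d}.
Variables (Pr : probability T R) (I : finType) (r : I -> I) (D : I -> set T) (wt c : I -> R).
Hypothesis mD : forall a, measurable (D a).
Hypothesis Pr_D : forall a, Pr (D a) = (wt a)%:E.
Hypothesis wt1 : \sum_a wt a = 1.
Hypothesis c0 : forall b, 0 <= c b.
Hypothesis c1 : \sum_b c b <= 1.
Variables (N : nat) (rel : pred nat) (eta zeta : nat -> T -> R).
Variables (alpha beta : I -> nat -> seqspace R -> R) (w : nat -> R).
Hypothesis w1 : forall s, 1 <= w s.
Hypothesis malpha : forall a s, measurable_fun setT (alpha a s).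
Hypothesis mbeta : forall a s, measurable_fun setT (beta a s).
Hypothesis Heta : forall a s t, (s < N)%N -> D a t ->
  eta s t = alpha a s (past eta s t) + zeta s t.
Hypothesis Hg : forall a s, (s < N)%N ->
  gauss_given Pr (D a) (past eta s : T -> seqspace R) 1 (zeta s).
Hypothesis rel_beta : forall a s, rel s -> depends_on rel (beta a s).
Hypothesis beta_r : forall a s, rel s -> beta a s = beta (r a) s.
Variables (Acc : I -> set (seqspace R)) (M : R).
Hypothesis mAcc : forall a, measurable (Acc a).
Hypothesis rel_Acc : forall a, depends_on rel (Acc a).
Hypothesis Acc_disj : forall a a' y, r a = r a' -> Acc a y -> Acc a' y -> a = a'.
Hypothesis M1 : 1 <= M.
Hypothesis wtM : forall a, wt a * M <= c (r a).

Let w0 s : 0 < w s. Proof. by apply: lt_le_trans (w1 s). Qed.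

Let acc a := iterK w (beta a) N (fun y => (\1_(Acc a) y : R)%:E).

Let n1T : nnfun setT (fun _ : seqspace R => 1%E : \bar R).
Proof. exact: nnfun_cst. Qed.

Let nAcc a : nnfun setT (fun y => (\1_(Acc a) y : R)%:E).
Proof. exact: nnfun_indic. Qed.

(** Within a fiber of [r] all tuples share one comparison law on the relevant outputs, and their
    acceptance sets are disjoint. *)
Lemma acceptance_fiber_le1 b : (\sum_(a | r a == b) acc a <= 1)%E.
Proof.
have -> : (\sum_(a | r a == b) acc a =
    \sum_(a | r a == b) iterK w (beta b) N (fun y => (\1_(Acc a) y : R)%:E))%E.
  apply: eq_bigr => a /eqP rab; apply: (iterK_depends (rel := rel) w0 N) => //.
  - by move=> s rs; rewrite -rab; exact: beta_r.
  - by move=> s rs; exact: rel_beta.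
  - by move=> y y' yy'; have E := rel_Acc a yy'; rewrite !indicE; congr (nat_of_bool _)%:R%:E;
    apply/idP/idP => /set_mem Ay; apply/mem_set; [rewrite -E|rewrite E].
rewrite -big_filter -(iterK_sum w (mbeta b) N _ nAcc) -(iterK1 (beta b) w0 N).
apply: (le_iterK w (mbeta b) N _ n1T); first exact: nnfun_sum.
move=> y; rewrite big_filter sumEFin lee_fin.
have [[a0 /andP[/eqP ra0 Aa0]]|noacc] := pselect (exists a, (r a == b) && (y \in Acc a)).
  rewrite (bigD1 a0) ?ra0//= big1 ?addr0 => [|a /andP[/eqP ra a_neq]].
    by rewrite indicE; case: (_ \in _).
  rewrite indicE; case: (boolP (y \in Acc a)) => // /set_mem Aa; case/eqP: a_neq.
  by apply: (Acc_disj (y := y)) => //; [rewrite ra|exact: set_mem].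
rewrite big1// => a /eqP ra; rewrite indicE; case: (boolP (y \in Acc a)) => // Aa.
by case: noacc; exists a; rewrite ra eqxx.
Qed.

Lemma acceptance_ge0 a : (0 <= acc a)%E.
Proof. exact: (iterK_ge0 w (mbeta a) N (nAcc a)). Qed.

Lemma acceptance_fin a : acc a = (fine (acc a))%:E.
Proof.
rewrite fineK// ge0_fin_numE ?acceptance_ge0//.
apply: le_lt_trans (ltry 1); rewrite -(iterK1 (beta a) w0 N).
apply: (le_iterK w (mbeta a) N (nAcc a) n1T) => y.
by rewrite lee_fin indicE; case: (_ \in _).
Qed.

(** This is the success probability [1 / M] of a guess: [wtM] says that, given [r a], each
    completion has probability at most [1 / M]. *)
Lemma weighted_acceptance_le1 : M * \sum_a (wt a * fine (acc a)) <= 1.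
Proof.
apply: le_trans c1; rewrite mulr_sumr.
apply: (@le_trans _ _ (\sum_a (c (r a) * fine (acc a)))).
  apply: ler_sum => a _; rewrite mulrA (mulrC M); apply: ler_wpM2r => //.
  by apply: fine_ge0; exact: acceptance_ge0.
rewrite (partition_big r predT)//=; apply: ler_sum => b _.
rewrite (eq_bigr (fun a => c b * fine (acc a))) => [|a /eqP ->//].
rewrite -mulr_sumr ler_piMr// -lee_fin -sumEFin.
rewrite (eq_bigr (fun a => acc a)) => [|a _]; first exact: acceptance_fiber_le1.
by rewrite -acceptance_fin.
Qed.

(** The sum of [integrated_loss_bound] over all tuples. The leading 1 is the bound
    [weighted_acceptance_le1]; the total masses on the two sides cancel. *)
Lemma log_message_count_le (pc : R) (e : nat -> R) :
  (pc%:E <= \sum_a Pr (D a `&` [set t | Acc a (past eta N t)]))%E ->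
  (forall s, (s < N)%N ->
    (\sum_a \int[Pr]_(t in D a)
       ((alpha a s (past eta s t) - beta a s (past eta s t)) ^+ 2)%:E <= (e s)%:E)%E) ->
  pc * ln M <= 1 + \sum_(s < N) (ln (w s) / 2 + (e s + 1) / (2 * w s) - 2^-1).
Proof.
move=> pcE eE.
pose en a s := (\int[Pr]_(t in D a)
       ((alpha a s (past eta s t) - beta a s (past eta s t)) ^+ 2)%:E)%E.
have en0 a s : (0 <= en a s)%E by apply: integral_ge0 => t _; rewrite lee_fin sqr_ge0.
have en_le a s : (s < N)%N -> (en a s <= (e s)%:E)%E.
  move=> sN; apply: le_trans (eE s sN); rewrite (bigD1 a)//=.
  by apply: leeDl; apply: sume_ge0 => i _; exact: en0.
have en_fin a s : (s < N)%N -> en a s = (fine (en a s))%:E.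
  move=> sN; rewrite fineK// ge0_fin_numE//.
  by apply: le_lt_trans (en_le a s sN) _; exact: ltry.
pose pA a := fine (Pr (D a `&` [set t | Acc a (past eta N t)])).
have pAE a : Pr (D a `&` [set t | Acc a (past eta N t)]) = (pA a)%:E.
  rewrite /pA fineK//; apply: fin_num_measure.
  exact: (measurable_past_given (malpha a) (fun s t => @Heta a s t) (Hg a) (leqnn N) (mD a) (mAcc a)).
have H a := integrated_loss_bound (mD a) w1 (malpha a) (mbeta a) (fun s t => @Heta a s t)
  (Hg a) (mAcc a) M1 (Pr_D a) (acceptance_fin a) (pAE a) (fun s sN => en_fin a s sN).
have total : \sum_a (pA a * ln M + \sum_(s < N) (wt a / 2) + wt a) <=
    \sum_a (M * (wt a * fine (acc a)) + wt a +
      \sum_(s < N) (ln (w s) / 2 * wt a + (fine (en a s) + wt a) / (2 * w s))).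
  by apply: ler_sum => a _; exact: H.
have sum_wt (k : R) : \sum_a (k * wt a) = k by rewrite -mulr_sumr wt1 mulr1.
rewrite !big_split/= wt1 -mulr_suml -mulr_sumr exchange_big/= in total.
rewrite [X in _ <= _ + X]exchange_big/= in total.
have A : \sum_(s < N) \sum_a wt a / 2 = \sum_(s < N) (2^-1 : R).
  by apply: eq_bigr => s _; rewrite -mulr_suml wt1 mul1r.
have B : \sum_(s < N) \sum_a (ln (w s) / 2 * wt a + (fine (en a s) + wt a) / (2 * w s)) <=
    \sum_(s < N) (ln (w s) / 2 + (e s + 1) / (2 * w s)).
  apply: ler_sum => s _; rewrite big_split/= sum_wt lerD2l -mulr_suml.
  apply: ler_wpM2r; first by rewrite invr_ge0 mulr_ge0// ltW.
  rewrite big_split/= wt1 lerD2r -lee_fin -sumEFin.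
  apply: le_trans (eE s (ltn_ord s)); rewrite le_eqVlt; apply/orP; left; apply/eqP.
  by apply: eq_bigr => a _; rewrite -en_fin.
have W := weighted_acceptance_le1.
have C : pc * ln M <= (\sum_a pA a) * ln M.
  apply: ler_wpM2r; first exact: ln_ge0.
  by rewrite -lee_fin -sumEFin (eq_bigr _ (fun a _ => esym (pAE a))).
rewrite A in total; rewrite sumrB; lra.
Qed.

End AcceptanceBound.

(** * Law of a coded transmission *)

Section SequenceIndependence.
Context {R : realType}.

Definition rectangles : set (set (seqspace R)) :=
  [set A | exists C : nat -> set R, (forall i, measurable (C i)) /\ A = [set y | forall i, C i (y i)]].

Lemma rectangle_measurable (C : nat -> set R) : (forall i, measurable (C i)) ->
  measurable ([set y | forall i, C i (y i)] : set (seqspace R)).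
Proof.
move=> mC; rewrite (_ : [set y | _] = \bigcap_i ((fun y : seqspace R => y i) @^-1` C i)).
  by apply: bigcapT_measurable => i; rewrite -[X in measurable X]setTI; exact: measurable_coord.
by apply/seteqP; split=> [y Cy i _|y Cy i]; exact: Cy.
Qed.

Lemma measurable_rectangles : @measurable _ (seqspace R) = <<s rectangles >>.
Proof.
apply/seteqP; split.
  apply: smallest_sub; first exact: smallest_sigma_algebra.
  move=> _ [s [A [mA ->]]]; apply: sub_sigma_algebra.
  exists (fun i => if i == s then A else setT); split; first by move=> i; case: ifP.
  apply/seteqP; split=> y /= => [Ay i|/(_ s)]; last by rewrite eqxx.
  by case: eqP => // ->.
apply: smallest_sub; first exact: sigma_algebra_measurable.
by move=> _ [C [mC ->]]; exact: rectangle_measurable.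
Qed.

Lemma setI_closed_rectangles : setI_closed rectangles.
Proof.
move=> _ _ [C [mC ->]] [C' [mC' ->]]; exists (fun i => C i `&` C' i).
split; first by move=> i; exact: measurableI.
by apply/seteqP; split=> y => [[Cy Cy'] i|H]; [split|split=> i; have [] := H i].
Qed.

Context {d : measure_display} {T : measurableType d} (Pr : probability T R).

(** For fixed [B], both sides of the factorization are finite measures in the set of pasts, and they
    agree on the rectangles, a generating family closed under intersection. *)
Lemma gauss_given_past (D : set T) (V : nat -> T -> R) (W : T -> R) (v : R) (s : nat) :
  measurable D -> 0 < v -> (forall i, measurable_fun setT (V i)) -> measurable_fun setT W ->
  (forall (C : nat -> set R) (B : set R), (forall i, measurable (C i)) -> measurable B ->
     Pr (D `&` ([set t | forall i, (i < s)%N -> C i (V i t)] `&` W @^-1` B)) =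
     (Pr (D `&` [set t | forall i, (i < s)%N -> C i (V i t)]) *
      normal_prob 0 (Num.sqrt v) B)%E) ->
  gauss_given Pr D (past V s : T -> seqspace R) v W.
Proof.
move=> mD v0 mV mW H.
have mU : measurable_fun setT (past V s : T -> seqspace R) by exact: measurable_past.
apply: gauss_given_indep => // A B mA mB.
set U : T -> seqspace R := past V s.
have mWB : measurable (D `&` W @^-1` B).
  by apply: measurableI => //; rewrite -[X in measurable X]setTI; exact: mW.
have kfin : normal_prob 0 (Num.sqrt v) B = (fine (normal_prob 0 (Num.sqrt v) B))%:E.
  by rewrite fineK// fin_num_measure.
have k0 : 0 <= fine (normal_prob 0 (Num.sqrt v) B) by apply: fine_ge0.
pose law (m : {measure set T -> \bar R}) : {measure set (seqspace R) -> \bar R} :=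
  measure_function_pushforward__canonical__measure_function_Measure m mU.
pose m1 := law (mrestr Pr mWB); pose m2 := mscale (NngNum k0) (law (mrestr Pr mD)).
have E1 X : m1 X = Pr (D `&` (U @^-1` X `&` W @^-1` B)).
  by rewrite /m1 /law /= /pushforward /mrestr; congr (Pr _); rewrite setICA.
have E2 X : m2 X = (Pr (D `&` U @^-1` X) * normal_prob 0 (Num.sqrt v) B)%E.
  by rewrite /m2 /= /mscale /law /= /pushforward /mrestr [RHS]muleC kfin setIC.
rewrite -E1 -E2; apply: (measure_unique rectangles (fun=> setT)) => //.
- exact: measurable_rectangles.
- exact: setI_closed_rectangles.
- by move=> _; exists (fun=> setT); split=> //; apply/seteqP; split.
- by rewrite bigcup_const.
- move=> _ [C [mC ->]]; apply: etrans (E1 _) _; apply: etrans _ (esym (E2 _)).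
  (* [past] is 0 from index [s] on, so a rectangle with a later side that misses 0 has an empty
     preimage. *)
  have [Z|/existsNP [i /not_implyP [si nC]]] :=
      pselect (forall i, (s <= i)%N -> C i 0); last first.
    rewrite (_ : U @^-1` _ = set0); first by rewrite set0I setI0 measure0 mul0e.
    apply/seteqP; split=> // t /= /(_ i); rewrite /U /past ltnNge si; exact: nC.
  rewrite (_ : U @^-1` _ = [set t | forall i, (i < s)%N -> C i (V i t)]); first exact: H.
  apply/seteqP; split=> t /= Ht i => [si|]; first by have := Ht i; rewrite /U /past si.
  by rewrite /U /past; case: ltnP => si; [exact: Ht|exact: Z].
- move=> k; rewrite [X in (X < _)%E]E1; apply: le_lt_trans (probability_le1 Pr _) (ltry 1).
  by rewrite preimage_setT setTI.
Qed.

End SequenceIndependence.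

(** * Outputs as functions of the noises *)

Section FeedbackRecursion.
Context {R : realType} {d : measure_display} {T : measurableType d}.
Variables (Pr : probability T R) (D : set T) (N : nat).
Variables (eta zeta : nat -> T -> R) (alpha : nat -> seqspace R -> R).
Hypothesis malpha : forall s, measurable_fun setT (alpha s).
Hypothesis Heta : forall s t, (s < N)%N -> D t -> eta s t = alpha s (past eta s t) + zeta s t.

Fixpoint outputs_of (s : nat) (z : seqspace R) : seqspace R :=
  if s is s'.+1 then upd (outputs_of s' z) s' (alpha s' (outputs_of s' z) + z s')
  else fun=> 0.

Lemma measurable_outputs_of s : measurable_fun setT (outputs_of s).
Proof.
elim: s => [|s IH] /=; first exact: measurable_cst.
apply: measurable_upd => //; apply: measurable_funD; last exact: measurable_coord.
exact: (measurableT_comp (malpha s)).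
Qed.

Lemma outputs_of_past s k t : (s <= k)%N -> (s <= N)%N -> D t ->
  outputs_of s (past zeta k t) = past eta s t.
Proof.
elim: s => [|s IH] sk sN Dt /=; first by apply/funext => i; rewrite /past.
rewrite IH//; [|exact: ltnW|exact: ltnW].
by rewrite upd_past Heta//; congr (upd _ _ (_ + _)); rewrite /past sk.
Qed.

(** On [D] the past outputs are a measurable function of the past noises, so noise independent of
    the latter is independent of the former, feedback included. *)
Lemma gauss_given_feedback s : (s < N)%N -> measurable D ->
  gauss_given Pr D (past zeta s : T -> seqspace R) 1 (zeta s) ->
  gauss_given Pr D (past eta s : T -> seqspace R) 1 (zeta s).
Proof.
move=> sN mD /(gauss_given_map (measurable_outputs_of s)) [mU mW v0 H].
have E t : D t -> outputs_of s (past zeta s t) = past eta s t.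
  by move=> Dt; apply: outputs_of_past => //; exact: ltnW.
split; [|exact: mW|exact: v0|].
  by apply: (eq_measurable_fun (outputs_of s \o past zeta s)) => // t /set_mem; exact: E.
move=> F nF; have := H F nF => HF.
transitivity (\int[Pr]_(t in D) F ((outputs_of s \o past zeta s) t, zeta s t))%E.
  by apply: eq_integral => t /set_mem Dt; rewrite /= E.
by rewrite HF; apply: eq_integral => t /set_mem Dt; rewrite /= E.
Qed.

End FeedbackRecursion.

(** * One time axis for the four outputs *)

Section Interleaving.

(* The four observations of channel use [i] are read in the order relay, user 1, 2, 3;
   [None] stands for the relay. *)
Definition slot (o : option 'I_3) (i : nat) : nat := (4 * i + (if o is Some j then j.+1 else 0))%N.

Definition src (s : nat) : option 'I_3 := if (s %% 4)%N is c.+1 then Some (inord c) else None.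

Let tag_lt4 (o : option 'I_3) : ((if o is Some j then (j : nat).+1 else 0) < 4)%N.
Proof. by case: o => [[j /=]|]. Qed.

Lemma slot_div o i : (slot o i %/ 4)%N = i.
Proof. by rewrite /slot mulnC divnMDl// divn_small ?addn0. Qed.

Lemma src_slot o i : src (slot o i) = o.
Proof.
rewrite /src /slot mulnC modnMDl modn_small//.
by case: o => [j|//]; congr Some; apply: val_inj; rewrite /= inordK.
Qed.

Lemma slot_src s : slot (src s) (s %/ 4) = s.
Proof.
rewrite {3}(divn_eq s 4) /slot /src mulnC; congr (_ + _)%N.
by case E: (s %% 4)%N => [//|c]; rewrite inordK// -ltnS -E ltn_mod.
Qed.

Lemma slot_lt_mul o i n : (slot o i < 4 * n)%N = (i < n)%N.
Proof. by rewrite mulnC -ltn_divLR// slot_div. Qed.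

Lemma slot_lt o i s : (i < s %/ 4)%N -> (slot o i < s)%N.
Proof.
by rewrite -(slot_lt_mul o) => H; apply: leq_trans H _; rewrite mulnC leq_divM.
Qed.

Lemma big_slot {V : Type} {idx : V} (op : Monoid.com_law idx) (F : nat -> V) n :
  \big[op/idx]_(s < 4 * n) F s =
  \big[op/idx]_(i < n) op (F (slot None i)) (\big[op/idx]_(j < 3) F (slot (Some j) i)).
Proof.
elim: n => [|n IH]; first by rewrite muln0 !big_ord0.
rewrite mulnS addnC !addnS addn0 !big_ord_recr/= IH big_ord0 /slot /=.
by rewrite Monoid.mul1m !addnS !addn0 !Monoid.mulmA.
Qed.

Context {R : realType}.

Definition interleave {T : Type} (V : 'I_3 -> nat -> T -> R) (Vr : nat -> T -> R) (s : nat) : T -> R :=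
  if src s is Some j then V j (s %/ 4)%N else Vr (s %/ 4)%N.

Definition proj (o : option 'I_3) (i : nat) (y : seqspace R) : seqspace R :=
  fun i' => if (i' < i)%N then y (slot o i') else 0.

Lemma measurable_proj o i : measurable_fun setT (proj o i).
Proof.
apply: measurable_to_seqspace => i'; rewrite /proj.
by case: (i' < i)%N; [exact: measurable_coord|exact: measurable_cst].
Qed.

Lemma proj_past {T : Type} (V : 'I_3 -> nat -> T -> R) Vr o i s t : (i <= s %/ 4)%N ->
  proj o i (past (interleave V Vr) s t) = past (if o is Some j then V j else Vr) i t.
Proof.
move=> is4; apply/funext => i'; rewrite /proj /past; case: ltnP => // i'i.
rewrite slot_lt; last exact: leq_trans is4.
by rewrite /interleave src_slot slot_div; case: o.
Qed.

Lemma cyl_measurable i (A : set (nat -> R)) : <<s cyl i >> A -> measurable (A : set (seqspace R)).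
Proof.
apply: (sub_sigma_algebra2 (D := setT)) A => _ [s [A [si [mA ->]]]].
by exists s, A.
Qed.

Lemma past_measurable_fun o i F : past_measurable i F ->
  measurable_fun setT (fun y : seqspace R => F (proj o i y)).
Proof.
move=> mF _ B mB; rewrite setTI.
rewrite [X in measurable X](_ : _ = setT `&` proj o i @^-1` (F @^-1` B)) ?setTI//.
by rewrite -[X in measurable X]setTI; apply: measurable_proj => //; exact: cyl_measurable (mF _ mB).
Qed.

Lemma past_measurable_nat_set o i F k : past_measurable_nat i F ->
  measurable ([set y | F (proj o i y) = k] : set (seqspace R)).
Proof.
move=> mF; rewrite [X in measurable X](_ : _ = setT `&` proj o i @^-1` (F @^-1` [set k])) ?setTI//.
by rewrite -[X in measurable X]setTI; apply: measurable_proj => //; exact: cyl_measurable (mF k).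
Qed.

End Interleaving.

Section MessageSize.
Context {R : realType}.

Lemma powR_le_msize n (r : R) : 2 `^ (n%:R * r) <= (msize n r)%:R.
Proof.
rewrite /msize natr_absz; apply: le_trans (ceil_ge _) _; rewrite ler_int; exact: ler_norm.
Qed.

Lemma msize_gt0 n (r : R) : (0 < msize n r)%N.
Proof. by rewrite -(ltr_nat R); apply: lt_le_trans (powR_le_msize n r); rewrite powR_gt0. Qed.

(** A message set always has at least one element, so a negative rate counts as 0. *)
Lemma ln_msize_ge n (r : R) : n%:R * Num.max 0 r * ln 2 <= ln (msize n r)%:R.
Proof.
have m1 : 1 <= (msize n r)%:R :> R by rewrite ler1n msize_gt0.
have [r0|r0] := leP r 0; first by rewrite mulr0 mul0r ln_ge0.
rewrite -ln_powR ler_ln; first exact: powR_le_msize.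
  by rewrite posrE powR_gt0.
by rewrite posrE; apply: lt_le_trans m1.
Qed.

End MessageSize.

Section CountableCover.
Context {d : measure_display} {T : measurableType d} {I : countType} (D : I -> set T).
Hypothesis D_cover : forall t, exists i, D i t.

(** Intended for the events that fix all messages: there are countably many, and on each of them
    inputs and decisions are measurable functions of the outputs. *)
Lemma measurable_cover (A : set T) : (forall i, measurable (D i `&` A)) -> measurable A.
Proof.
move=> mDA; rewrite (_ : A = \bigcup_i (D i `&` A)).
  exact: countable_bigcupT_measurable.
apply/seteqP; split=> t; last by case=> i _ [].
by move=> At; have [i Dit] := D_cover t; exists i.
Qed.

Lemma measurable_fun_cover {d' : measure_display} {T' : measurableType d'} (f : T -> T') :
  (forall i, measurable (D i)) -> (forall i, measurable_fun (D i) f) -> measurable_fun setT f.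
Proof.
by move=> mD mf _ B mB; rewrite setTI; apply: measurable_cover => i; exact: mf.
Qed.

End CountableCover.

Lemma sum_integral_disjoint_le {d : measure_display} {T : measurableType d} {R : realType}
    (mu : {measure set T -> \bar R}) {I : finType} (D : I -> set T) (f : T -> \bar R) :
  (forall i, measurable (D i)) -> (forall i j t, D i t -> D j t -> i = j) -> nnfun setT f ->
  (\sum_i \int[mu]_(t in D i) f t <= \int[mu]_t f t)%E.
Proof.
move=> mD dD [mf f0].
have mU : measurable (\big[setU/set0]_(i <- index_enum I) D i) by exact: bigsetU_measurable.
rewrite -(ge0_integral_bigsetU mu mD) => [||||//]; first last.
- exact: measurable_funTS.
- by move=> i j _ _ [t [Dit Djt]]; exact: dD Dit Djt.
- exact: index_enum_uniq.
by apply: ge0_subset_integral => //; exact: measurableT.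
Qed.

Section SecondMoments.
Context {R : realType} {d : measure_display} {T : measurableType d} (Pr : probability T R).

Lemma integral_quadratic (f g : T -> R) :
  measurable_fun setT f -> measurable_fun setT g ->
  (\int[Pr]_t (f t ^+ 2)%:E < +oo)%E -> (\int[Pr]_t (g t ^+ 2)%:E < +oo)%E ->
  exists c, forall p q : R, (\int[Pr]_t ((p * f t + q * g t) ^+ 2)%:E =
    (p ^+ 2 * fine (\int[Pr]_t (f t ^+ 2)%:E) + 2 * p * q * c +
     q ^+ 2 * fine (\int[Pr]_t (g t ^+ 2)%:E))%:E)%E.
Proof.
move=> mf mg ffin gfin.
have intsq (k : T -> R) : measurable_fun setT k -> (\int[Pr]_t (k t ^+ 2)%:E < +oo)%E ->
    Pr.-integrable setT (fun t => (k t ^+ 2)%:E).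
  move=> mk kfin; apply/integrableP; split.
    by apply/measurable_EFinP; exact: measurable_funX.
  by under eq_integral do rewrite abse_EFin ger0_norm ?sqr_ge0//.
have If := intsq f mf ffin; have Ig := intsq g mg gfin.
have Ifg : Pr.-integrable setT (fun t => (f t * g t)%:E).
  apply: (le_integrable measurableT) (integrableD measurableT If Ig).
    by apply/measurable_EFinP; exact: measurable_funM.
  move=> t _; rewrite /= lee_fin normrM (ger0_norm (addr_ge0 _ _)) ?sqr_ge0//.
  rewrite -(real_normK (num_real (f t))) -(real_normK (num_real (g t))).
  have := sqr_ge0 (`|f t| - `|g t|); have := normr_ge0 (f t); have := normr_ge0 (g t); nra.
have fineI (k : T -> R) : Pr.-integrable setT (fun t => (k t)%:E) ->
    (\int[Pr]_t (k t)%:E = (fine (\int[Pr]_t (k t)%:E))%:E)%E.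
  by move=> Ik; rewrite fineK//; exact: integrable_fin_num.
exists (fine (\int[Pr]_t (f t * g t)%:E)) => p q.
transitivity (\int[Pr]_t ((p ^+ 2)%:E * (f t ^+ 2)%:E + (2 * p * q)%:E * (f t * g t)%:E +
    (q ^+ 2)%:E * (g t ^+ 2)%:E))%E.
  by apply: eq_integral => t _; rewrite -!EFinM -!EFinD; congr EFin; ring.
have J1 := integrableZl measurableT (p ^+ 2) If.
have J2 := integrableZl measurableT (2 * p * q) Ifg.
have J3 := integrableZl measurableT (q ^+ 2) Ig.
rewrite (integralD measurableT (integrableD measurableT J1 J2) J3) (integralD measurableT J1 J2).
rewrite (integralZl measurableT If) (integralZl measurableT Ifg) (integralZl measurableT Ig).
by rewrite !EFinD !EFinM -(fineI _ If) -(fineI _ Ifg) -(fineI _ Ig).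
Qed.

Lemma gauss_given_integral_sqrDZ {dS} {S : measurableType dS} (D : set T) (U : T -> S)
    (W : T -> R) (f : S -> R) (k : R) : measurable D -> gauss_given Pr D U 1 W ->
  measurable_fun setT f ->
  (\int[Pr]_(t in D) ((f (U t) + k * W t) ^+ 2)%:E =
   \int[Pr]_(t in D) ((f (U t)) ^+ 2)%:E + (k ^+ 2)%:E * Pr D)%E.
Proof.
move=> mD HW mf; have [->|k0] := eqVneq k 0.
  rewrite expr0n/= mul0e adde0; apply: eq_integral => t _; by rewrite mul0r addr0.
have [mU mW _ _] := HW.
have k2 : (0 <= (k ^+ 2)%:E)%E by rewrite lee_fin sqr_ge0.
have msq (F : T -> R) : measurable_fun D F -> nnfun D (fun t => (F t ^+ 2)%:E).
  move=> mF; apply: (nnfun_EFin (f := fun t => F t ^+ 2)) => [|t]; last exact: sqr_ge0.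
  exact: measurable_funX.
have mfk : measurable_fun setT (fun u => k^-1 * f u).
  by apply: measurable_funM => //; exact: measurable_cst.
have mfU : measurable_fun D (fun t => k^-1 * f (U t)) by exact: (measurableT_comp mfk).
transitivity ((k ^+ 2)%:E * \int[Pr]_(t in D) ((k^-1 * f (U t) + W t) ^+ 2)%:E)%E.
  rewrite -(nnintZ Pr mD k2 (msq _ (measurable_funD mfU mW))); apply: eq_integral => t _.
  by rewrite /= -EFinM; congr EFin; field.
rewrite (gauss_given_integral_sqrD mD HW mfk) ge0_muleDr; last 2 first.
- by apply: integral_ge0 => t _; rewrite lee_fin sqr_ge0.
- exact: measure_ge0.
apply: (f_equal (fun z => z + _)%E).
rewrite -(nnintZ Pr mD k2 (msq _ mfU)); apply: eq_integral => t _.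
by rewrite -EFinM; congr EFin; field.
Qed.

End SecondMoments.

(** * Law of a run given its messages *)

Section RunLaw.
Context {R : realType} {d : measure_display} {T : measurableType d} (Pr : probability T R).
Variables (n : nat) (h : 'I_3 -> R) (Rt : 'I_3 -> 'I_3 -> R).
Variables (enc : 'I_3 -> nat -> ('I_3 -> nat) -> (nat -> R) -> R) (rel : nat -> (nat -> R) -> R).
Variables (dec : 'I_3 -> ('I_3 -> nat) -> (nat -> R) -> 'I_3 -> nat).
Variables (m : 'I_3 -> 'I_3 -> T -> nat) (Z : 'I_3 -> nat -> T -> R) (Zr : nat -> T -> R).
Variables (X : 'I_3 -> nat -> T -> R) (Xr : nat -> T -> R).
Variables (Y : 'I_3 -> nat -> T -> R) (Yr : nat -> T -> R).
Hypothesis Hcode : code_measurable n enc rel dec.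
Hypothesis Hrun : ychannel_run Pr n h Rt enc rel m Z Zr X Xr Y Yr.

Implicit Types a : 'I_3 * 'I_3 -> nat.

Definition msgs a : set T := [set t | forall j k, own m j t k = a (j, k)].

Definition own_of a (j : 'I_3) : 'I_3 -> nat := fun k => a (j, k).

Lemma own_msgs a t j : msgs a t -> own m j t = own_of a j.
Proof. by move=> at_; apply/funext => k; exact: at_. Qed.

(** The noiseless part of observation [s] when the messages are [a]. Inputs only use outputs of
    earlier channel uses, hence a prefix of the interleaved sequence. The value 0 from [4 * n] on
    makes it measurable for every [s]. *)
Definition signal a (s : nat) (y : seqspace R) : R :=
  if (s < 4 * n)%N then
    if src s is Some j then h j * rel (s %/ 4) (proj None (s %/ 4) y)
    else \sum_(j < 3) h j * enc j (s %/ 4) (own_of a j) (proj (Some j) (s %/ 4) y)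
  else 0.

Lemma measurable_enc j i a : (i < n)%N ->
  measurable_fun setT (fun y : seqspace R => enc j i (own_of a j) (proj (Some j) i y)).
Proof. by case: Hcode => [H _] iN; apply: past_measurable_fun; exact: H. Qed.

Lemma measurable_rel i : (i < n)%N ->
  measurable_fun setT (fun y : seqspace R => rel i (proj None i y)).
Proof. by case: Hcode => [_ [H _]] iN; apply: past_measurable_fun; exact: H. Qed.

Lemma measurable_signal a s : measurable_fun setT (signal a s).
Proof.
rewrite /signal; case: ltnP => [sN|_]; last exact: measurable_cst.
have iN : (s %/ 4 < n)%N by rewrite ltn_divLR// mulnC.
case: (src s) => [j|].
  by apply: measurable_funM; [exact: measurable_cst|exact: measurable_rel].
apply: measurable_sum => j; apply: measurable_funM; first exact: measurable_cst.
exact: measurable_enc.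
Qed.

Lemma signal_run a s t : (s < 4 * n)%N -> msgs a t ->
  interleave Y Yr s t = signal a s (past (interleave Y Yr) s t) + interleave Z Zr s t.
Proof.
move=> sN at_; case: Hrun => [_ [_ [_ [_ [HYr [HY [HX HXr]]]]]]].
have iN : (s %/ 4 < n)%N by rewrite ltn_divLR// mulnC.
rewrite /signal sN {1 4}/interleave; case: (src s) => [j|].
  by rewrite HY// HXr// proj_past.
rewrite HYr//; congr (_ + _); apply: eq_bigr => j _.
by rewrite HX// proj_past// (own_msgs _ at_).
Qed.

Lemma measurable_msgs a : measurable (msgs a).
Proof.
have [Hm _] := Hrun.
have -> : msgs a = \bigcap_(p in setT) [set t | own m p.1 t p.2 = a p].
  by apply/seteqP; split => t /= H; [move=> [j k] _; exact: H|move=> j k; exact: (H (j, k) I)].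
apply: fin_bigcap_measurable => [|[j k] _]; first exact: finite_finset.
rewrite /own /=; case: (k == j); last exact: Hm.
by have [<-|ne] := eqVneq 0%N (a (j, k)); [rewrite (_ : mkset _ = setT)//; apply/seteqP; split|
  rewrite (_ : mkset _ = set0)//; apply/seteqP; split=> // t /= /eqP; rewrite (negbTE ne)].
Qed.


(** Diagonal entries get a point mass at 0, so that the tuple of messages has a product law over all
    pairs. *)
Definition msg_prob (p : 'I_3 * 'I_3) (x : nat) : R :=
  if p.1 == p.2 then (x == 0)%:R
  else if (x < msize n (Rt p.1 p.2))%N then (msize n (Rt p.1 p.2))%:R^-1 else 0.

Lemma run_law a (C : nat -> set R) : (forall s, measurable (C s)) ->
  Pr (msgs a `&` [set t | forall s, (s < 4 * n)%N -> C s (interleave Z Zr s t)]) =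
  ((\prod_p msg_prob p (a p)) * \prod_(s < 4 * n) fine (gauss (C s)))%:E.
Proof.
move=> mC; have [_ [_ [_ [Hlaw _]]]] := Hrun.
have [a0|/existsNP[j /eqP aj]] := pselect (forall j, a (j, j) = 0%N); last first.
  rewrite (_ : msgs a = set0) ?set0I ?measure0; last first.
    apply/seteqP; split => // t /(_ j j); rewrite /own eqxx => E.
    by rewrite -E eqxx in aj.
  by rewrite (bigD1 (j, j))//= {1}/msg_prob/= eqxx (negbTE aj) !mul0r.
transitivity (Pr [set t | (forall j k, j != k -> m j k t = a (j, k)) /\
    (forall i, (i < n)%N -> C (slot None i) (Zr i t) /\
      forall j, C (slot (Some j) i) (Z j i t))]).
  congr (Pr _); apply/seteqP; split => t /=.
    move=> [at_ Ct]; split=> [j k jk|i iN].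
      by rewrite -at_ /own eq_sym (negbTE jk).
    have Hslot o := Ct (slot o i); split=> [|j].
      by have := Hslot None; rewrite slot_lt_mul /interleave src_slot slot_div; exact.
    by have := Hslot (Some j); rewrite slot_lt_mul /interleave src_slot slot_div; exact.
  move=> [at_ Ct]; split=> [j k|s sN].
    by rewrite /own; case: eqVneq => [->|kj]; [rewrite a0|apply: at_; rewrite eq_sym].
  have iN : (s %/ 4 < n)%N by rewrite ltn_divLR// mulnC.
  have [H1 H2] := Ct _ iN; rewrite /interleave.
  by case: (src s) (slot_src s) => [j|] E; rewrite -[X in C X]E; [exact: H2|exact: H1].
rewrite (Hlaw (fun j k => a (j, k)) (fun j i => C (slot (Some j) i)) (fun i => C (slot None i)))//.
congr ((_ * _)%:E); last by rewrite (big_slot _ (fun s => fine (gauss (C s)))).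
transitivity (\prod_(j < 3) \prod_(k < 3) msg_prob (j, k) (a (j, k))).
  apply: eq_bigr => j _; rewrite big_mkcond; apply: eq_bigr => k _; rewrite /msg_prob/=.
  by case: eqVneq => //= <-; rewrite a0.
by rewrite pair_bigA; apply: eq_bigr => [[j k]].
Qed.

Lemma gaussT : gauss setT = 1%E :> \bar R.
Proof. exact: probability_setT. Qed.

Lemma prob_msgs a : Pr (msgs a) = (\prod_p msg_prob p (a p))%:E.
Proof.
have := @run_law a (fun=> setT) (fun=> measurableT).
rewrite (_ : [set t | _] = setT) ?setIT => [->|]; last by apply/seteqP; split.
by rewrite [X in _ * X]big1 ?mulr1// => s _; rewrite gaussT.
Qed.

Lemma measurable_noise s : measurable_fun setT (interleave Z Zr s).
Proof.
have [_ [mZ [mZr _]]] := Hrun.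
by rewrite /interleave; case: (src s).
Qed.

Lemma gauss_given_noise a s : (s < 4 * n)%N ->
  gauss_given Pr (msgs a) (past (interleave Z Zr) s : T -> seqspace R) 1 (interleave Z Zr s).
Proof.
move=> sN; apply: gauss_given_past => //; first exact: measurable_msgs.
- by move=> i; exact: measurable_noise.
- exact: measurable_noise.
move=> C B mC mB.
pose C' (B' : set R) (i : nat) := if (i < s)%N then C i else if i == s then B' else setT.
have mC' B' : measurable B' -> forall i, measurable (C' B' i).
  by move=> mB' i; rewrite /C'; case: ifP => // _; case: ifP.
have HC (B' : set R) :
    [set t | forall i, (i < 4 * n)%N -> C' B' i (interleave Z Zr i t)] =
    [set t | forall i, (i < s)%N -> C i (interleave Z Zr i t)] `&` interleave Z Zr s @^-1` B'.
  apply/seteqP; split => t /=.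
    move=> Ht; split=> [i si|].
      by have := Ht i (ltn_trans si sN); rewrite /C' si.
    by have := Ht s sN; rewrite /C' ltnn eqxx.
  move=> [H1 H2] i iN; rewrite /C'; case: ifP => [|_]; first exact: H1.
  by case: eqP => // ->.
have := run_law a (mC' _ mB); rewrite HC => ->.
have := run_law a (mC' _ measurableT); rewrite HC preimage_setT setIT => ->.
have kfin : normal_prob 0 (Num.sqrt 1) B = (fine (gauss B))%:E.
  by rewrite sqrtr1 fineK// fin_num_measure.
rewrite kfin -EFinM -mulrA; congr (_ * _)%:E.
rewrite [LHS](bigD1 (Ordinal sN))//= [X in _ = X * _](bigD1 (Ordinal sN))//=.
rewrite {1 3}/C' ltnn eqxx gaussT mul1r mulrC; congr (_ * _).
apply: eq_bigr => i /eqP si; rewrite /C'; case: ifP => // _.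
by case: eqP => // E; case: si; exact: val_inj.
Qed.

Lemma gauss_given_run a s : (s < 4 * n)%N ->
  gauss_given Pr (msgs a) (past (interleave Y Yr) s : T -> seqspace R) 1 (interleave Z Zr s).
Proof.
move=> sN; apply: (gauss_given_feedback (measurable_signal a) _ sN (measurable_msgs a)).
  by move=> s' t; exact: signal_run.
exact: gauss_given_noise.
Qed.


Lemma msgs_cover t : exists f : {ffun 'I_3 * 'I_3 -> nat}, msgs f t.
Proof. by exists [ffun p => own m p.1 t p.2] => j k; rewrite ffunE. Qed.

Lemma measurable_input j i : (i < n)%N -> measurable_fun setT (X j i).
Proof.
move=> iN; have [_ [_ [_ [_ [_ [_ [HX _]]]]]]] := Hrun.
apply: (measurable_fun_cover msgs_cover) => [f|f]; first exact: measurable_msgs.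
have sN : (slot None i < 4 * n)%N by rewrite slot_lt_mul.
have [mU _ _ _] := gauss_given_run f sN.
apply: (eq_measurable_fun (fun t => enc j i (own_of f j)
    (proj (Some j) i (past (interleave Y Yr) (slot None i) t)))).
  by move=> t /set_mem ft; rewrite HX// (own_msgs _ ft) proj_past// slot_div.
exact: (measurableT_comp (measurable_enc j f iN) mU).
Qed.

Lemma measurable_relay_input i : (i < n)%N -> measurable_fun setT (Xr i).
Proof.
move=> iN; have [_ [_ [_ [_ [_ [_ [_ HXr]]]]]]] := Hrun.
apply: (measurable_fun_cover msgs_cover) => [f|f]; first exact: measurable_msgs.
have sN : (slot None i < 4 * n)%N by rewrite slot_lt_mul.
have [mU _ _ _] := gauss_given_run f sN.
apply: (eq_measurable_fun (fun t => rel i (proj None i (past (interleave Y Yr) (slot None i) t)))).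
  by move=> t /set_mem ft; rewrite HXr// proj_past// slot_div.
exact: (measurableT_comp (measurable_rel iN) mU).
Qed.

Definition correct (W : pred ('I_3 * 'I_3)) a : set (seqspace R) :=
  [set y | forall p, W p -> dec p.2 (own_of a p.2) (proj (Some p.2) n y) p.1 = a p].

Lemma measurable_correct W a : measurable (correct W a).
Proof.
rewrite (_ : correct W a = \bigcap_(p in [set p | W p])
    [set y | dec p.2 (own_of a p.2) (proj (Some p.2) n y) p.1 = a p]); last first.
  by apply/seteqP; split=> y H p Wp; exact: H.
apply: fin_bigcap_measurable => [|p _]; first exact: finite_finset.
case: Hcode => [_ [_ Hd]].
exact: (@past_measurable_nat_set R (Some p.2) n _ (a p) (Hd p.2 (own_of a p.2) p.1)).
Qed.

Lemma measurable_outputs_given a s : (s <= 4 * n)%N ->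
  measurable_fun (msgs a) (past (interleave Y Yr) s : T -> seqspace R).
Proof.
exact: (measurable_past_given (measurable_signal a) (fun s t => @signal_run a s t)
  (gauss_given_run a)).
Qed.

Definition error_event : set T :=
  [set t | exists j k : 'I_3, j != k /\ dec j (own m j t) (past (Y j) n t) k != m k j t].

Lemma no_error_msgs a :
  msgs a `&` ~` error_event =
  msgs a `&` past (interleave Y Yr) (4 * n) @^-1` correct (fun p => p.1 != p.2) a.
Proof.
have E j t : proj (Some j) n (past (interleave Y Yr) (4 * n) t) = past (Y j) n t.
  by rewrite proj_past// mulKn.
apply/seteqP; split => t [at_ H]; split => //=.
  move=> p pW; rewrite E -(own_msgs _ at_); apply: contra_notP H => H.
  exists p.2, p.1; rewrite eq_sym; split=> //; apply/eqP => H'; apply: H.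
  by rewrite H' [in RHS](surjective_pairing p) -at_ /own eq_sym (negbTE pW).
move=> [j [k [jk /eqP]]]; have := H (k, j); rewrite /= eq_sym => /(_ jk)/=; rewrite E -(own_msgs _ at_) => ->.
by rewrite -at_ /own (negbTE jk).
Qed.

(** Given the messages, absence of error is a condition on the outputs, and countably many message
    tuples cover the space. *)
Lemma measurable_no_error : measurable (~` error_event).
Proof.
apply: (measurable_cover msgs_cover) => f; rewrite no_error_msgs.
by apply: measurable_outputs_given => //; [exact: measurable_msgs|exact: measurable_correct].
Qed.


(** * The bound for one cut: [W] holds the crossing messages, [rsrc] the outputs of the receiving
    side *)

Section Cut.
Variables (K : nat) (W : pred ('I_3 * 'I_3)) (rsrc : pred (option 'I_3)) (v : option 'I_3 -> R).
Variable beta : ('I_3 * 'I_3 -> nat) -> nat -> seqspace R -> R.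
Hypothesis HK : forall j k, (msize n (Rt j k) <= K.+1)%N.
Hypothesis W_ne : forall p, W p -> p.1 != p.2.
Hypothesis W_recv : forall p q, W p -> W q -> p.2 != q.1.
Hypothesis W_rsrc : forall p, W p -> rsrc (Some p.2).
Hypothesis v0 : forall o, 0 <= v o.

Let val_of (f : {ffun 'I_3 * 'I_3 -> 'I_K.+1}) : 'I_3 * 'I_3 -> nat := fun p => f p.

Definition mask a : 'I_3 * 'I_3 -> nat := fun p => if W p then 0%N else a p.

Hypothesis mbeta : forall a s, measurable_fun setT (beta a s).
Hypothesis rsrc_beta : forall a s, rsrc (src s) -> depends_on (fun s => rsrc (src s)) (beta a s).
Hypothesis beta_mask : forall a s, rsrc (src s) -> beta a s = beta (mask a) s.

Lemma sum_msg_prob p : \sum_(x < K.+1) msg_prob p x = 1.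
Proof.
rewrite /msg_prob; case: (p.1 == p.2).
  rewrite (bigD1 ord0)//= big1 ?addr0// => x x0.
  by rewrite (_ : (nat_of_ord x == 0%N) = false)//; apply/negbTE.
rewrite -big_mkcond/= -(big_ord_widen_cond _ xpredT (fun=> _) (HK p.1 p.2)).
by rewrite sumr_const card_ord -[LHS]mulr_natr mulVf// pnatr_eq0 -lt0n msize_gt0.
Qed.

Lemma sum_prob_msgs : \sum_f \prod_p msg_prob p (val_of f p) = 1.
Proof.
rewrite -(bigA_distr_bigA (fun p (x : 'I_K.+1) => msg_prob p x)).
by rewrite big1// => p _; exact: sum_msg_prob.
Qed.

Lemma disjoint_msgs f g t : msgs (val_of f) t -> msgs (val_of g) t -> f = g.
Proof.
move=> ft gt; apply/ffunP => -[j k]; apply: val_inj.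
by transitivity (own m j t k); [exact: esym (ft j k)|exact: gt].
Qed.

Lemma prob_correct_ge pe : (Pr error_event <= pe%:E)%E ->
  ((1 - pe)%:E <= \sum_f Pr (msgs (val_of f) `&`
     [set t | correct W (val_of f) (past (interleave Y Yr) (4 * n) t)]))%E.
Proof.
move=> errE.
have mE : measurable error_event by rewrite -[error_event]setCK; exact: measurableC measurable_no_error.
have D_le : (\sum_f Pr (msgs (val_of f) `&` error_event) <= pe%:E)%E.
  apply: le_trans errE.
  have := @sum_integral_disjoint_le _ T R Pr _ (fun f => msgs (val_of f))
    (fun t => (\1_error_event t)%:E) (fun f => measurable_msgs (val_of f)) disjoint_msgs
    (nnfun_indic _ mE).
  rewrite (nnint_indic Pr measurableT mE) setIT; apply: le_trans.
  rewrite le_eqVlt; apply/orP; left; apply/eqP; apply: eq_bigr => f _.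
  by rewrite (nnint_indic Pr (measurable_msgs _) mE) setIC.
have sum1 : (\sum_f Pr (msgs (val_of f)) = 1)%E.
  by rewrite (eq_bigr _ (fun f _ => prob_msgs (val_of f))) sumEFin sum_prob_msgs.
have split_msgs f : (Pr (msgs (val_of f)) = Pr (msgs (val_of f) `&` ~` error_event) +
    Pr (msgs (val_of f) `&` error_event))%E.
  by rewrite -setDE; apply: measureDI => //; exact: measurable_msgs.
rewrite (eq_bigr _ (fun f _ => split_msgs f)) big_split/= in sum1.
rewrite EFinB leeBlDr// -sum1; apply: leeD => //; apply: lee_sum => f _.
have mf := measurable_msgs (val_of f); have mN := measurable_no_error.
apply: le_measure; rewrite ?inE; first exact: measurableI.
  by apply: measurable_outputs_given => //; exact: measurable_correct.
rewrite no_error_msgs => t [ft H]; split=> // p Wp; apply: H; exact: W_ne.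
Qed.

(** [log_message_count_le] with [M] the number of values of the crossing messages and comparison
    variance [1 + v o] for source [o]. Messages are bounded by [K], which makes the set of tuples
    finite. *)
Lemma cut_bound pe : (Pr error_event <= pe%:E)%E ->
  (forall o, (\sum_(i < n) \sum_f \int[Pr]_(t in msgs (val_of f))
     ((signal (val_of f) (slot o i) (past (interleave Y Yr) (slot o i) t) -
       beta (val_of f) (slot o i) (past (interleave Y Yr) (slot o i) t)) ^+ 2)%:E <=
     (n%:R * v o)%:E)%E) ->
  (1 - pe) * (n%:R * (\sum_(p | W p) Num.max 0 (Rt p.1 p.2)) * ln 2) <=
  1 + n%:R * (ln (1 + v None) / 2 + \sum_(j < 3) ln (1 + v (Some j)) / 2).
Proof.
move=> errE energy.
have RHS0 : 0 <= 1 + n%:R * (ln (1 + v None) / 2 + \sum_(j < 3) ln (1 + v (Some j)) / 2).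
  have l0 o : 0 <= ln (1 + v o) / 2 by rewrite divr_ge0// ln_ge0// lerDl.
  by rewrite addr_ge0// mulr_ge0// addr_ge0// sumr_ge0.
have S0 : 0 <= n%:R * (\sum_(p | W p) Num.max 0 (Rt p.1 p.2)) * ln 2.
  rewrite !mulr_ge0// ?ln_ge0//; last by rewrite ler1n.
  by apply: sumr_ge0 => p _; rewrite le_max lexx.
(* [pe] is only an upper bound and may exceed 1; the claim is then trivial. *)
have [pe1|pe1] := ltP (1 - pe) 0.
  by apply: le_trans RHS0; rewrite mulr_le0_ge0// ltW.
pose M : R := \prod_(p | W p) (msize n (Rt p.1 p.2))%:R.
have M_ge1 p : 1 <= (msize n (Rt p.1 p.2))%:R :> R by rewrite ler1n msize_gt0.
have lnM : n%:R * (\sum_(p | W p) Num.max 0 (Rt p.1 p.2)) * ln 2 <= ln M.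
  have [M0 <-] : 0 < M /\ \sum_(p | W p) ln (msize n (Rt p.1 p.2))%:R = ln M.
    rewrite /M; apply: (big_rec2 (fun m s => 0 < m /\ s = ln m)) => [|p m' s Wp [m0 ->]].
      by rewrite ln1.
    have p0 : 0 < (msize n (Rt p.1 p.2))%:R :> R by rewrite ltr0n msize_gt0.
    by rewrite mulr_gt0// lnM.
  rewrite mulr_sumr mulr_suml; apply: ler_sum => p _; exact: ln_msize_ge.
have M1 : 1 <= M.
  by apply: (big_ind (fun x => 1 <= x)) => // x y x1 y1; exact: mulr_ege1.
have en0 f s : (0 <= \int[Pr]_(t in msgs (val_of f))
     ((signal (val_of f) s (past (interleave Y Yr) s t) -
       beta (val_of f) s (past (interleave Y Yr) s t)) ^+ 2)%:E)%E.
  by apply: integral_ge0 => t _; rewrite lee_fin sqr_ge0.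
pose e s := fine (\sum_f \int[Pr]_(t in msgs (val_of f))
     ((signal (val_of f) s (past (interleave Y Yr) s t) -
       beta (val_of f) s (past (interleave Y Yr) s t)) ^+ 2)%:E)%E.
have eE s : (s < 4 * n)%N -> (\sum_f \int[Pr]_(t in msgs (val_of f))
     ((signal (val_of f) s (past (interleave Y Yr) s t) -
       beta (val_of f) s (past (interleave Y Yr) s t)) ^+ 2)%:E = (e s)%:E)%E.
  move=> sN; rewrite fineK// ge0_fin_numE; last by apply: sume_ge0 => f _; exact: en0.
  have iN : (s %/ 4 < n)%N by rewrite ltn_divLR// mulnC.
  apply: le_lt_trans (le_trans _ (energy (src s))) (ltry _).
  rewrite [leRHS](bigD1 (Ordinal iN))//= slot_src.
  by apply: leeDl; apply: sume_ge0 => i _; apply: sume_ge0 => f _; exact: en0.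
have energy' o : \sum_(i < n) e (slot o i) <= n%:R * v o.
  rewrite -lee_fin -sumEFin; apply: le_trans (energy o).
  rewrite le_eqVlt; apply/orP; left; apply/eqP; apply: eq_bigr => i _.
  by rewrite -eE// slot_lt_mul.
pose r (f : {ffun 'I_3 * 'I_3 -> 'I_K.+1}) : {ffun 'I_3 * 'I_3 -> 'I_K.+1} :=
  [ffun p => if W p then ord0 else f p].
have val_r f : val_of (r f) = mask (val_of f).
  by apply/funext => p; rewrite /val_of /mask ffunE; case: (W p).
(* The law of the messages once those that cross the cut have been set to 0. *)
pose c (b : {ffun 'I_3 * 'I_3 -> 'I_K.+1}) : R :=
  \prod_p (if W p then (b p == ord0)%:R else msg_prob p (b p)).
have msg_prob0 p x : 0 <= msg_prob p x.
  by rewrite /msg_prob; case: ifP => _; [exact: ler0n|case: ifP => _ //; rewrite invr_ge0].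
have c1 : \sum_b c b = 1.
  rewrite -(bigA_distr_bigA (fun p (x : 'I_K.+1) => if W p then (x == ord0)%:R else msg_prob p x)).
  rewrite big1// => p _; case: (W p); last exact: sum_msg_prob.
  by rewrite (bigD1 ord0)//= big1 ?addr0// => x /negbTE ->.
have wtM f : (\prod_p msg_prob p (val_of f p)) * M <= c (r f).
  rewrite /M [X in _ * X]big_mkcond -big_split /c /=.
  apply: ler_prod => p _; rewrite ffunE; case: (boolP (W p)) => Wp; last by rewrite mulr1 msg_prob0 lexx.
  rewrite /msg_prob (negbTE (W_ne Wp)) eqxx; case: ifP => _; last by rewrite mul0r lexx ler01.
  by rewrite mulVf ?ler01 ?lexx// gt_eqF// (lt_le_trans ltr01).
have accept := @log_message_count_le R d T Pr _ r (fun f => msgs (val_of f))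
  (fun f => \prod_p msg_prob p (val_of f p)) c (fun f => measurable_msgs (val_of f))
  (fun f => prob_msgs (val_of f)) sum_prob_msgs.
have c0 b : 0 <= c b by apply: prodr_ge0 => p _; case: (W p).
have w1 s : 1 <= 1 + v (src s) by rewrite lerDl.
have := accept c0 _ (4 * n)%N (fun s => rsrc (src s)) (interleave Y Yr) (interleave Z Zr)
  (fun f => signal (val_of f)) (fun f => beta (val_of f)) (fun s => 1 + v (src s)) w1
  (fun f => measurable_signal (val_of f)) (fun f => mbeta (val_of f))
  (fun f s t => @signal_run (val_of f) s t) (fun f s => @gauss_given_run (val_of f) s)
  (fun f => rsrc_beta (val_of f)) _ (fun f => correct W (val_of f)) M
  (fun f => measurable_correct W (val_of f)) _ _ M1 wtM (1 - pe) e (prob_correct_ge errE).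
rewrite c1 => {}accept.
apply: le_trans (ler_wpM2l pe1 lnM) _; apply: le_trans (accept _ _ _ _ _) _ => //.
- by move=> f s rs; rewrite val_r; exact: beta_mask.
- move=> f y y' yy'; apply/propext.
  have E p : W p -> proj (Some p.2) n y = proj (Some p.2) n y'.
    move=> Wp; apply/funext => i; rewrite /proj; case: ltnP => // iN.
    by apply: yy'; rewrite src_slot; exact: W_rsrc.
  by split=> H p Wp; [rewrite -E//|rewrite E//]; exact: H.
(* By [W_recv] the decoders at work own no crossing message, so they act alike for [f] and [f'] and
   return a single value for each crossing message. *)
- move=> f f' y rff' fy f'y; apply/ffunP => p; apply: val_inj.
  have E q : ~~ W q -> f q = f' q.
    by move=> nWq; have := congr1 (fun g : {ffun _ -> _} => g q) rff'; rewrite !ffunE (negbTE nWq).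
  case: (boolP (W p)) => Wp; last by rewrite E.
  rewrite -[LHS](fy p Wp) -[RHS](f'y p Wp); congr (dec _ _ _ _).
  apply/funext => k; rewrite /own_of /val_of E//; apply/negP => Wq.
  by have := W_recv Wp Wq; rewrite eqxx.
- by move=> s sN; rewrite eE.
rewrite lerD2l (big_slot _ (fun s => ln (1 + v (src s)) / 2 +
  (e s + 1) / (2 * (1 + v (src s))) - 2^-1)) big_split/= exchange_big/= mulrDr mulr_sumr.
(* With [1 + v o] as comparison variance, the energy bound makes the fractions average to at most
   1/2, which the subtracted [2^-1] cancels. *)
have cost o : \sum_(i < n) (ln (1 + v (src (slot o i))) / 2 +
    (e (slot o i) + 1) / (2 * (1 + v (src (slot o i)))) - 2^-1) <= n%:R * (ln (1 + v o) / 2).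
  have vo : 0 < 1 + v o by rewrite ltr_pwDl.
  pose k := (2 * (1 + v o))^-1.
  rewrite (eq_bigr (fun i : 'I_n => (ln (1 + v o) / 2 + k - 2^-1) + e (slot o i) * k)); last first.
    by move=> i _; rewrite src_slot /k; ring.
  rewrite big_split/= sumr_const card_ord -mulr_suml -[X in X + _]mulr_natl.
  have k0 : 0 <= k by rewrite /k invr_ge0 mulr_ge0// ltW.
  have S1 := ler_wpM2r k0 (energy' o).
  have S2 : n%:R * v o * k + n%:R * k = n%:R / 2 by rewrite /k; field; rewrite gt_eqF.
  lra.
by apply: lerD; [exact: cost|apply: ler_sum => j _; exact: cost].
Qed.

End Cut.


(** * The cuts of the Y-channel *)

Section Cuts.
Variables (K : nat) (pe : R).
Hypothesis HK : forall j k, (msize n (Rt j k) <= K.+1)%N.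
Hypothesis errE : (Pr error_event <= pe%:E)%E.

Local Notation eta := (interleave Y Yr).
Local Notation val_of f := (fun p => nat_of_ord ((f : {ffun 'I_3 * 'I_3 -> 'I_K.+1}) p)).

Lemma input_given a j o i t : (i < n)%N -> msgs a t ->
  enc j i (own_of a j) (proj (Some j) i (past eta (slot o i) t)) = X j i t.
Proof.
move=> iN at_; have [_ [_ [_ [_ [_ [_ [HX _]]]]]]] := Hrun.
by rewrite HX// proj_past ?slot_div// (own_msgs _ at_).
Qed.

Lemma relay_input_given a o i t : (i < n)%N -> msgs a t ->
  rel i (proj None i (past eta (slot o i) t)) = Xr i t.
Proof.
move=> iN at_; have [_ [_ [_ [_ [_ [_ [_ HXr]]]]]]] := Hrun.
by rewrite HXr// proj_past ?slot_div.
Qed.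

Lemma sum_residual_le (D := fun f => msgs (val_of f)) (res : _ -> T -> R) (g : T -> R) :
  measurable_fun setT g -> (forall f t, D f t -> res f t = g t) ->
  (\sum_f \int[Pr]_(t in D f) ((res f t) ^+ 2)%:E <= \int[Pr]_t (g t ^+ 2)%:E)%E.
Proof.
move=> mg resg.
have -> : (\sum_f \int[Pr]_(t in D f) (res f t ^+ 2)%:E =
    \sum_f \int[Pr]_(t in D f) (g t ^+ 2)%:E)%E.
  by apply: eq_bigr => f _; apply: eq_integral => t /set_mem ft; rewrite resg.
apply: sum_integral_disjoint_le => [f|f f' t|]; first exact: measurable_msgs.
  exact: disjoint_msgs.
apply: (nnfun_EFin (f := fun t => g t ^+ 2)) => [|t]; last exact: sqr_ge0.
exact: measurable_funX.
Qed.

(** All outputs, the relay's included, are given to the receiving side. The relay input is a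
    function of these, so user outputs are predicted exactly at no cost. The relay output is
    predicted from inputs with free coefficients [g], which must vanish for users that own a
    crossing message. *)
Lemma uplink_cut (W : pred ('I_3 * 'I_3)) (g : 'I_3 -> R) (sg : R) :
  (forall p, W p -> p.1 != p.2) -> (forall p q, W p -> W q -> p.2 != q.1) ->
  (forall p, W p -> g p.1 = 0) -> 0 <= sg ->
  (\sum_(i < n) \int[Pr]_t ((\sum_(j < 3) (h j - g j) * X j i t) ^+ 2)%:E <= (n%:R * sg)%:E)%E ->
  (1 - pe) * (n%:R * (\sum_(p | W p) Num.max 0 (Rt p.1 p.2)) * ln 2) <=
  1 + n%:R * (ln (1 + sg) / 2).
Proof.
move=> W_ne W_recv gW sg0 energy.
pose v (o : option 'I_3) := if o is None then sg else 0.
pose beta a s (y : seqspace R) : R := if (s < 4 * n)%N then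
    if src s is None then \sum_(j < 3) g j * enc j (s %/ 4) (own_of a j) (proj (Some j) (s %/ 4) y)
    else signal a s y else 0.
have := @cut_bound K W predT v beta HK W_ne W_recv (fun _ _ => isT).
rewrite [X in _ -> _ -> _ -> _ -> forall pe, _ -> _ -> _ <= 1 + n%:R * (_ + X)]big1; last first.
  by move=> j _; rewrite /v addr0 ln1 mul0r.
rewrite addr0; apply => //.
- by case.
- move=> a s; rewrite /beta; case: ltnP => [sN|_]; last exact: measurable_cst.
  have iN : (s %/ 4 < n)%N by rewrite ltn_divLR// mulnC.
  case: (src s) => [j|]; first exact: measurable_signal.
  apply: measurable_sum => j; apply: measurable_funM; first exact: measurable_cst.
  exact: measurable_enc.
- by move=> a s _ y y' yy'; congr beta; apply/funext => i; exact: yy'.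
- move=> a s _; apply/funext => y; rewrite /beta /signal; case: ltnP => // sN.
  case: (src s) => // ; apply: eq_bigr => j _.
  have [->|gj] := eqVneq (g j) 0; first by rewrite !mul0r.
  congr (_ * enc _ _ _ _); apply/funext => k; rewrite /own_of /mask.
  by case: (boolP (W (j, k))) => // /gW /= E; rewrite E eqxx in gj.
- move=> [j|]; last first.
    apply: le_trans energy; apply: lee_sum => i _.
    apply: (sum_residual_le (g := fun t => \sum_(j < 3) (h j - g j) * X j i t)).
      apply: measurable_sum => j; apply: measurable_funM; first exact: measurable_cst.
      exact: measurable_input.
    move=> f t ft; rewrite /signal /beta slot_lt_mul ltn_ord src_slot -sumrB slot_div.
    by apply: eq_bigr => j _; rewrite input_given// mulrBl.
  rewrite /v mulr0 big1// => i _; rewrite big1// => f _.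
  by rewrite integral0_eq// => t _; rewrite /beta src_slot slot_lt_mul ltn_ord subrr expr0n.
Qed.

Lemma measurable_square (f : T -> R) : measurable_fun setT f ->
  nnfun setT (fun t => (f t ^+ 2)%:E).
Proof.
move=> mf; apply: (nnfun_EFin (f := fun t => f t ^+ 2)) => [|t]; last exact: sqr_ge0.
exact: measurable_funX.
Qed.

Lemma scaled_energy_le (k P : R) (f : 'I_n -> T -> R) : (forall i, measurable_fun setT (f i)) ->
  (\sum_(i < n) \int[Pr]_t (f i t ^+ 2)%:E <= (n%:R * P)%:E)%E ->
  (\sum_(i < n) \int[Pr]_t ((k * f i t) ^+ 2)%:E <= (n%:R * (k ^+ 2 * P))%:E)%E.
Proof.
move=> mf fP; have k2 : (0 <= (k ^+ 2)%:E)%E by rewrite lee_fin sqr_ge0.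
have -> : (\sum_(i < n) \int[Pr]_t ((k * f i t) ^+ 2)%:E =
    (k ^+ 2)%:E * \sum_(i < n) \int[Pr]_t (f i t ^+ 2)%:E)%E.
  rewrite ge0_sume_distrr => [|i _]; last by apply: integral_ge0 => t _; rewrite lee_fin sqr_ge0.
  apply: eq_bigr => i _; rewrite -(nnintZ Pr measurableT k2 (measurable_square (mf i))).
  by apply: eq_integral => t _; rewrite exprMn EFinM.
by apply: le_trans (lee_wpmul2l k2 fP) _; rewrite -EFinM lee_fin mulrCA.
Qed.

(** User [l] sees only its own output, predicted by 0. Every other output keeps its true signal in
    the comparison law, hence costs nothing. *)
Lemma downlink_cut (l : 'I_3) (P : R) : 0 <= P ->
  (\sum_(i < n) \int[Pr]_t (Xr i t ^+ 2)%:E <= (n%:R * P)%:E)%E ->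
  (1 - pe) * (n%:R * (\sum_(p | (p.2 == l) && (p.1 != l)) Num.max 0 (Rt p.1 p.2)) * ln 2) <=
  1 + n%:R * (ln (1 + h l ^+ 2 * P) / 2).
Proof.
move=> P0 energy.
pose W : pred ('I_3 * 'I_3) := fun p => (p.2 == l) && (p.1 != l).
pose rsrc : pred (option 'I_3) := fun o => o == Some l.
pose v (o : option 'I_3) := if o == Some l then h l ^+ 2 * P else 0.
pose beta a s (y : seqspace R) : R := if src s == Some l then 0 else signal a s y.
have vl : \sum_(j < 3) ln (1 + v (Some j)) / 2 = ln (1 + h l ^+ 2 * P) / 2.
  rewrite (bigD1 l)//= /v eqxx big1 ?addr0// => j jl.
  by rewrite (inj_eq Some_inj) (negbTE jl) addr0 ln1 mul0r.
have := @cut_bound K W rsrc v beta HK.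
rewrite vl /v /= addr0 ln1 mul0r add0r; apply => //.
- by move=> p /andP[/eqP ->].
- by move=> p q /andP[/eqP -> _] /andP[_]; rewrite eq_sym.
- by move=> p /andP[/eqP ->] _; rewrite /rsrc.
- by move=> o; case: ifP => // _; rewrite mulr_ge0// sqr_ge0.
- move=> a s; rewrite /beta; case: (src s == Some l); first exact: measurable_cst.
  exact: measurable_signal.
- by move=> a s; rewrite /rsrc /beta => -> y y' _.
- by move=> a s; rewrite /rsrc /beta => ->.
- move=> o; case: eqVneq => [->|ol]; last first.
    rewrite mulr0 big1// => i _; rewrite big1// => f _.
    by rewrite integral0_eq// => t _; rewrite /beta src_slot (negbTE ol) subrr expr0n.
  apply: le_trans (scaled_energy_le (h l) (f := fun i => Xr i) _ energy); last first.
    by move=> i; exact: measurable_relay_input.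
  apply: lee_sum => i _; apply: (sum_residual_le (g := fun t => h l * Xr i t)).
    by apply: measurable_funM; [exact: measurable_cst|exact: measurable_relay_input].
  move=> f t ft; rewrite /signal /beta slot_lt_mul ltn_ord src_slot eqxx subr0 slot_div.
  by rewrite (relay_input_given _ _ ft).
Qed.

(* User [B] predicts its output from that of user [A] in the same channel use by the linear
   minimum mean square error estimator, whose residual variance is [1 + h B ^+ 2 P / (1 + h A ^+ 2 P)]. *)
Lemma downlink_pair_cut (A B : 'I_3) (P : R) : (A < B)%N -> 0 <= P ->
  (\sum_(i < n) \int[Pr]_t (Xr i t ^+ 2)%:E <= (n%:R * P)%:E)%E ->
  (1 - pe) * (n%:R * (\sum_(p | [&& p.2 \in [:: A; B] & p.1 \notin [:: A; B]])
    Num.max 0 (Rt p.1 p.2)) * ln 2) <=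
  1 + n%:R * (ln (1 + (h A ^+ 2 + h B ^+ 2) * P) / 2).
Proof.
move=> AB P0 energy.
have AneB : A != B by apply: contraTneq AB => ->; rewrite ltnn.
pose W : pred ('I_3 * 'I_3) := fun p => [&& p.2 \in [:: A; B] & p.1 \notin [:: A; B]].
pose rsrc : pred (option 'I_3) := fun o => (o == Some A) || (o == Some B).
pose u := 1 + h A ^+ 2 * P; pose kap := h A * h B * P / u.
have u0 : 0 < u by rewrite ltr_pwDl// mulr_ge0// sqr_ge0.
pose vB := h B ^+ 2 * P / u.
have vB0 : 0 <= vB by rewrite divr_ge0 ?(ltW u0)// mulr_ge0// sqr_ge0.
pose v (o : option 'I_3) := if o == Some A then h A ^+ 2 * P else if o == Some B then vB else 0.
pose beta a s (y : seqspace R) : R := if src s == Some A then 0 else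
  if src s == Some B then kap * y (slot (Some A) (s %/ 4)) else signal a s y.
have vAB : \sum_(j < 3) ln (1 + v (Some j)) / 2 = ln (1 + (h A ^+ 2 + h B ^+ 2) * P) / 2.
  rewrite (bigD1 A)//= (bigD1 B)/=; last by rewrite eq_sym.
  rewrite /v eqxx (inj_eq Some_inj) (eq_sym B) (negbTE AneB) eqxx big1 => [|j /andP[jA jB]]; last first.
    by rewrite !(inj_eq Some_inj) (negbTE jA) (negbTE jB) addr0 ln1 mul0r.
  rewrite addr0 -mulrDl -lnM ?posrE; [|exact: u0|by rewrite ltr_pwDl].
  congr (ln _ / 2).
  by rewrite /vB -/u mulrDr mulr1 mulrCA divff ?gt_eqF// mulr1 /u; ring.
have := @cut_bound K W rsrc v beta HK.
rewrite vAB {1}/v /= addr0 ln1 mul0r add0r; apply => //.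
- by move=> p /andP[p2 p1]; apply: contraNneq p1 => ->.
- by move=> p q /andP[p2 _] /andP[_ q1]; apply: contraNneq q1 => <-.
- by move=> p /andP[]; rewrite !inE /rsrc !(inj_eq Some_inj).
- move=> o; rewrite /v; case: ifP => _; first by rewrite mulr_ge0// sqr_ge0.
  by case: ifP.
- move=> a s; rewrite /beta; case: (src s == Some A); first exact: measurable_cst.
  case: (src s == Some B); last exact: measurable_signal.
  by apply: measurable_funM; [exact: measurable_cst|exact: measurable_coord].
- move=> a s /orP[] /eqP E y y' yy'; rewrite /beta E eqxx//.
  rewrite (inj_eq Some_inj) (eq_sym B) (negbTE AneB) yy'// src_slot /rsrc eqxx//.
- by move=> a s /orP[] /eqP E; rewrite /beta E eqxx//; case: eqP.
- move=> o; rewrite /v; case: eqVneq => [->|oA].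
    apply: le_trans (scaled_energy_le (h A) (f := fun i => Xr i) _ energy); last first.
      by move=> i; exact: measurable_relay_input.
    apply: lee_sum => i _; apply: (sum_residual_le (g := fun t => h A * Xr i t)).
      by apply: measurable_funM; [exact: measurable_cst|exact: measurable_relay_input].
    move=> f t ft; rewrite /signal /beta slot_lt_mul ltn_ord src_slot eqxx subr0 slot_div.
    by rewrite (relay_input_given _ _ ft).
  case: eqVneq => [oB|oB]; last first.
    rewrite mulr0 big1// => i _; rewrite big1// => f _.
    by rewrite integral0_eq// => t _; rewrite /beta src_slot (negbTE oA) (negbTE oB) subrr expr0n.
  (* Predicting the output of [B] by [kap] times that of [A] leaves the error [q * Xr - kap * Z A]
     on the signal of [B]; its energy per channel use is at most [q ^+ 2 * P + kap ^+ 2 = vB]. *)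
  pose q := h B - kap * h A.
  have mq (i : 'I_n) : measurable_fun setT (fun t => q * Xr i t).
    by apply: measurable_funM; [exact: measurable_cst|exact: measurable_relay_input].
  have Ei (i : 'I_n) : (\sum_f \int[Pr]_(t in msgs (val_of f))
      ((signal (val_of f) (slot o i) (past eta (slot o i) t) -
        beta (val_of f) (slot o i) (past eta (slot o i) t)) ^+ 2)%:E <=
      \int[Pr]_t ((q * Xr i t) ^+ 2)%:E + (kap ^+ 2)%:E)%E.
    have sN : (slot (Some A) i < 4 * n)%N by rewrite slot_lt_mul.
    pose fq (y : seqspace R) : R := q * rel i (proj None i y).
    have mfq : measurable_fun setT fq.
      by apply: measurable_funM; [exact: measurable_cst|exact: measurable_rel].
    have Ef f : (\int[Pr]_(t in msgs (val_of f))
        ((signal (val_of f) (slot o i) (past eta (slot o i) t) -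
          beta (val_of f) (slot o i) (past eta (slot o i) t)) ^+ 2)%:E =
        \int[Pr]_(t in msgs (val_of f)) ((fq (past eta (slot (Some A) i) t)) ^+ 2)%:E +
        (kap ^+ 2)%:E * Pr (msgs (val_of f)))%E.
      have := gauss_given_integral_sqrDZ (- kap) (measurable_msgs (val_of f))
        (gauss_given_run (val_of f) sN) mfq.
      rewrite sqrrN => <-; apply: eq_integral => t /set_mem ft.
      rewrite /signal /beta slot_lt_mul ltn_ord src_slot (negbTE oA) oB eqxx !slot_div.
      (* Here [A < B] matters: within a channel use the output of [A] is read before that of [B]. *)
      have lt_slot : (slot (Some A) i < slot (Some B) i)%N by rewrite /slot ltn_add2l ltnS.
      rewrite {2}/past lt_slot.
      rewrite (signal_run sN ft) /signal sN src_slot slot_div /fq !(relay_input_given _ _ ft)//.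
      congr (_ ^+ 2)%:E; rewrite /q; ring.
    rewrite (eq_bigr _ (fun f _ => Ef f)) big_split/=; apply: leeD.
      by apply: (sum_residual_le (mq i)) => f t ft; rewrite /fq (relay_input_given _ _ ft).
    rewrite -ge0_sume_distrr => [|f _]; last exact: measure_ge0.
    rewrite (eq_bigr _ (fun f _ => prob_msgs (val_of f))) sumEFin (sum_prob_msgs HK).
    by rewrite mule1.
  apply: le_trans (lee_sum _ (fun i _ => Ei i)) _; rewrite big_split/=.
  rewrite sumEFin sumr_const card_ord -[X in (_ + X%:E)%E]mulr_natl.
  apply: le_trans (leeD (scaled_energy_le q (f := fun i => Xr i) _ energy) (lexx _)) _.
    by move=> i; exact: measurable_relay_input.
  rewrite -EFinD lee_fin -mulrDr le_eqVlt; apply/orP; left; apply/eqP; congr (_ * _).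
  rewrite /q /kap /vB /u; field; exact: lt0r_neq0.
Qed.


(** Prediction coefficients are constant over the block, so the total second moments [a], [b] and
    the total cross moment [c] determine every residual energy. *)
Lemma energy_quadratic (A B : 'I_3) (P : R) :
  (forall j, (\sum_(i < n) \int[Pr]_t (X j i t ^+ 2)%:E <= (n%:R * P)%:E)%E) ->
  exists (a b c : R), [/\ a <= n%:R * P, b <= n%:R * P & forall p q : R,
    (\sum_(i < n) \int[Pr]_t ((p * X A i t + q * X B i t) ^+ 2)%:E =
     (p ^+ 2 * a + 2 * p * q * c + q ^+ 2 * b)%:E)%E].
Proof.
move=> power.
have sq0 j i : (0 <= \int[Pr]_t (X j i t ^+ 2)%:E)%E.
  by apply: integral_ge0 => t _; rewrite lee_fin sqr_ge0.
have fin j (i : 'I_n) : (\int[Pr]_t (X j i t ^+ 2)%:E < +oo)%E.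
  apply: le_lt_trans (le_trans _ (power j)) (ltry _).
  by rewrite [leRHS](bigD1 i)//=; apply: leeDl; apply: sume_ge0.
pose mom j (i : 'I_n) := fine (\int[Pr]_t (X j i t ^+ 2)%:E).
have momE j (i : 'I_n) : (\int[Pr]_t (X j i t ^+ 2)%:E = (mom j i)%:E)%E.
  by rewrite fineK// ge0_fin_numE.
have mom_le j : \sum_i mom j i <= n%:R * P.
  by rewrite -lee_fin -sumEFin (eq_bigr _ (fun i _ => esym (momE j i))).
have [c cE] := choice (fun i : 'I_n => integral_quadratic (measurable_input A (ltn_ord i))
  (measurable_input B (ltn_ord i)) (fin A i) (fin B i)).
exists (\sum_i mom A i), (\sum_i mom B i), (\sum_i c i); split=> // p q.
rewrite (eq_bigr _ (fun i _ => cE i p q)) sumEFin; congr EFin.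
by rewrite !big_split/= -!mulr_sumr.
Qed.

Lemma cut_rate (S I : R) : (0 < n)%N -> (1 - pe) * (n%:R * S * ln 2) <= 1 + n%:R * (ln (1 + I) / 2) ->
  (1 - pe) * S <= n%:R^-1 / ln 2 + capacity I.
Proof.
move=> n0 H; have n0' : 0 < n%:R :> R by rewrite ltr0n.
have l2 : 0 < ln 2 :> R := ln2_gt0.
rewrite -(ler_pM2r (mulr_gt0 n0' l2)) [leRHS]mulrDl.
rewrite [leLHS](_ : _ = (1 - pe) * (n%:R * S * ln 2)); last by ring.
rewrite (_ : _ / ln 2 * _ = 1); last by field; rewrite !gt_eqF.
rewrite (_ : capacity I * _ = n%:R * (ln (1 + I) / 2))//.
by rewrite /capacity; field; rewrite gt_eqF.
Qed.

Lemma sum_pair2 (W : pred ('I_3 * 'I_3)) (F : 'I_3 * 'I_3 -> R) p q : p != q ->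
  (forall x, W x = (x == p) || (x == q)) -> \sum_(x | W x) F x = F p + F q.
Proof.
move=> pq WE; rewrite (bigD1 p) ?WE ?eqxx//= (bigD1 q) ?WE ?eqxx ?orbT//=; last by rewrite eq_sym.
by rewrite big1 ?addr0// => x; rewrite WE => /andP[/andP[/orP[/eqP->|/eqP->]]]; rewrite eqxx.
Qed.

Definition rate j k := Num.max 0 (Rt j k).

Definition supported (S I : R) := (1 - pe) * S <= n%:R^-1 / ln 2 + capacity I.

(** The cut around user [j]: the inputs of [k] and [l] are known, and [X j] is predicted by
    [kap * X k], whence the coefficient [h k + h j * kap]. *)
Lemma user_rates (j k l : 'I_3) (kap sg : R) : (0 < n)%N ->
  j != k -> j != l -> k != l -> 0 <= sg ->
  (\sum_(i < n) \int[Pr]_t ((h j * X j i t + - (h j * kap) * X k i t) ^+ 2)%:E <=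
    (n%:R * sg)%:E)%E ->
  supported (rate j k + rate j l) sg.
Proof.
move=> n0 jk jl kl sg0 energy; apply: cut_rate => //.
pose W : pred ('I_3 * 'I_3) := fun p => (p.1 == j) && (p.2 != j).
rewrite /rate -(sum_pair2 (W := W) (fun p => Num.max 0 (Rt p.1 p.2)) (p := (j, k)) (q := (j, l))); first last.
- move=> [x y]; rewrite /W /= !xpair_eqE; case: eqVneq => //= _.
  case: (ord3_cases y jk jl kl) => ->; rewrite ?eqxx ?(negbTE jk) ?(negbTE jl) ?(eq_sym k) ?(eq_sym l)
    ?(negbTE jk) ?(negbTE jl) ?orbT//.
- by rewrite xpair_eqE eqxx.
apply: (uplink_cut (g := fun x => if x == j then 0 else if x == k then h k + h j * kap else h x)) => //.
- by move=> p /andP[/eqP ->]; rewrite eq_sym.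
- by move=> p q /andP[_ p2] /andP[/eqP -> _].
- by move=> p /andP[/eqP -> _]; rewrite eqxx.
apply: le_trans energy; rewrite le_eqVlt; apply/orP; left; apply/eqP; apply: eq_bigr => i _.
apply: eq_integral => t _; congr (_ ^+ 2)%:E; rewrite (sum_ord3 _ jk jl kl) eqxx.
rewrite !(eq_sym _ j) (negbTE jk) (negbTE jl) eqxx (eq_sym l) (negbTE kl); ring.
Qed.

Lemma run_rates (L A B : 'I_3) (P : R) : (0 < n)%N -> 0 < P -> power_ok Pr n P X Xr ->
  L != A -> L != B -> (A < B)%N ->
  exists rho, [/\ -1 <= rho <= 1,
    supported (rate A B + rate A L) (h A ^+ 2 * (P * (1 - rho ^+ 2))),
    supported (rate B A + rate B L) (h B ^+ 2 * (P * (1 - rho ^+ 2))) &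
    supported (rate A L + rate B L) (P * (h A ^+ 2 + h B ^+ 2 + 2 * rho * h A * h B))] /\
  [/\ supported (rate L A + rate L B) (h L ^+ 2 * P),
    supported (rate L A + rate L B) ((h A ^+ 2 + h B ^+ 2) * P) &
    forall j k l : 'I_3, j != k -> j != l -> k != l ->
      supported (rate j l + rate k l) (h l ^+ 2 * P)].
Proof.
move=> n0 P0 [power powerr] LA LB AB.
have AneB : A != B by apply: contraTneq AB => ->; rewrite ltnn.
have n0' : 0 < n%:R :> R by rewrite ltr0n.
have nP : 0 < n%:R * P by rewrite mulr_gt0.
have [a [b [c [aP bP quad]]]] := energy_quadratic A B power.
have quad0 p q : 0 <= p ^+ 2 * a + 2 * p * q * c + q ^+ 2 * b.
  rewrite -lee_fin -quad; apply: sume_ge0 => i _; apply: integral_ge0 => t _.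
  by rewrite lee_fin sqr_ge0.
(* Dividing by the power budget rather than by the actual energies gives one [rho] for both users:
   [a - 2 rho c + rho^2 b] and its mirror image are at most [n P (1 - rho^2)] because [a] and [b]
   are at most [n P]. *)
pose rho := c / (n%:R * P).
have cE : c = n%:R * P * rho by rewrite /rho mulrC divfK// gt_eqF.
have rho1 : -1 <= rho <= 1.
  have q1 := quad0 1 1; have q2 := quad0 1 (-1).
  by rewrite /rho ler_pdivlMr// ler_pdivrMr// mulN1r mul1r; apply/andP; split; lra.
have rho2 : 0 <= 1 - rho ^+ 2 by move/andP: rho1 => [? ?]; nra.
have V0 k : 0 <= h k ^+ 2 * (P * (1 - rho ^+ 2)) by apply: mulr_ge0; [exact: sqr_ge0|apply: mulr_ge0 => //; exact: ltW].
have P0' := ltW P0.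
have BA : B != A by rewrite eq_sym.
have AL : A != L by rewrite eq_sym.
have BL : B != L by rewrite eq_sym.
exists rho; split; split.
- exact: rho1.
- apply: (user_rates (kap := rho)) => //; rewrite quad lee_fin cE.
  have k1 := ler_wpM2l (sqr_ge0 (h A)) aP.
  have k2 := ler_wpM2l (mulr_ge0 (sqr_ge0 (h A)) (sqr_ge0 rho)) bP.
  lra.
- apply: (user_rates (kap := rho)) => //.
  rewrite (eq_bigr (fun i : 'I_n => \int[Pr]_t ((- (h B * rho) * X A i t + h B * X B i t) ^+ 2)%:E)%E).
    rewrite quad lee_fin cE.
    have k1 := ler_wpM2l (sqr_ge0 (h B)) bP.
    have k2 := ler_wpM2l (mulr_ge0 (sqr_ge0 (h B)) (sqr_ge0 rho)) aP.
    lra.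
  by move=> i _; apply: eq_integral => t _; rewrite addrC.
- apply: cut_rate => //.
  pose W : pred ('I_3 * 'I_3) := fun p => (p.1 != L) && (p.2 == L).
  rewrite /rate -(sum_pair2 (W := W) (fun p => Num.max 0 (Rt p.1 p.2)) (p := (A, L)) (q := (B, L))); first last.
  + move=> [x y]; rewrite /W /= !xpair_eqE; case: (y == L) => //=; rewrite ?andbT ?andbF//.
    case: (ord3_cases x LA LB AneB) => ->; by rewrite ?eqxx ?(negbTE LA) ?(negbTE LB) ?(negbTE AL) ?(negbTE BL) ?orbT.
  + by rewrite xpair_eqE negb_and AneB.
  have sumE i t : \sum_(j < 3) (h j - (if j == L then h L else 0)) * X j i t = h A * X A i t + h B * X B i t.
    by rewrite (sum_ord3 _ LA LB AneB) eqxx (negbTE AL) (negbTE BL); ring.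
  have bound : h A ^+ 2 * a + 2 * h A * h B * c + h B ^+ 2 * b <=
      n%:R * (P * (h A ^+ 2 + h B ^+ 2 + 2 * rho * h A * h B)).
    rewrite cE; have k1 := ler_wpM2l (sqr_ge0 (h A)) aP; have k2 := ler_wpM2l (sqr_ge0 (h B)) bP; lra.
  apply: (uplink_cut (g := fun j => if j == L then h L else 0)) => //.
  + by move=> p /andP[p1 /eqP ->].
  + by move=> p q /andP[_ /eqP ->] /andP[q1 _]; rewrite eq_sym.
  + by move=> p /andP[/negbTE ->].
  + by rewrite -(pmulr_rge0 _ n0'); apply: le_trans (quad0 _ _) bound.
  rewrite (eq_bigr (fun i : 'I_n => \int[Pr]_t ((h A * X A i t + h B * X B i t) ^+ 2)%:E)%E).
    by rewrite quad lee_fin.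
  by move=> i _; apply: eq_integral => t _; rewrite sumE.
- apply: (user_rates (kap := 0)) => //; first by rewrite mulr_ge0// sqr_ge0.
  apply: le_trans (scaled_energy_le (h L) (f := fun i => X L i) _ (power L)).
    rewrite le_eqVlt; apply/orP; left; apply/eqP; apply: eq_bigr => i _.
    by apply: eq_integral => t _; rewrite mulr0 oppr0 mul0r addr0.
  by move=> i; exact: measurable_input.
- apply: cut_rate => //.
  rewrite /rate -(sum_pair2 (W := fun p => [&& p.2 \in [:: A; B] & p.1 \notin [:: A; B]])
    (fun p => Num.max 0 (Rt p.1 p.2)) (p := (L, A)) (q := (L, B))); first exact: downlink_pair_cut.
  + by rewrite xpair_eqE eqxx.
  + move=> [x y]; rewrite /= !xpair_eqE !inE.
    case: (ord3_cases x LA LB AneB) => ->; case: (ord3_cases y LA LB AneB) => ->;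
      by rewrite ?eqxx ?(negbTE LA) ?(negbTE LB) ?(negbTE AL) ?(negbTE BL) ?(negbTE AneB) ?(negbTE BA) ?orbT.
- move=> j k l jk jl kl; apply: cut_rate => //.
  rewrite /rate -(sum_pair2 (W := fun p => (p.2 == l) && (p.1 != l))
    (fun p => Num.max 0 (Rt p.1 p.2)) (p := (j, l)) (q := (k, l))); first exact: downlink_cut.
  + by rewrite xpair_eqE negb_and jk.
  + move=> [x y]; rewrite /= !xpair_eqE; case: (y == l); rewrite ?andbF//= ?andbT.
    case: (ord3_cases x jk jl kl) => ->; rewrite ?eqxx ?jl ?kl ?orbT//.
    by rewrite !(eq_sym l) (negbTE jl) (negbTE kl).
Qed.

End Cuts.

End RunLaw.

(** * Letting the block length grow *)

Section Limit.
Context {R : realType}.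

Lemma exists_small_slack (pe : nat -> R) (S eps : R) : pe @ \oo --> 0 -> 0 < eps ->
  exists2 n, (0 < n)%N & n%:R^-1 / ln 2 + pe n * S < eps.
Proof.
move=> pe0 eps0.
have H : (fun n => n.+1%:R^-1 / ln 2 + pe n.+1 * S) @ \oo --> (0 / ln 2 + 0 * S : R).
  apply: cvgD; apply: cvgM; try exact: cvg_cst; first exact: cvg_harmonic.
  by rewrite (cvg_shiftS pe).
have /cvgrPdist_lt /(_ _ eps0) [N _ HN] := H.
exists N.+1 => //; have := HN N (leqnn N).
rewrite !mul0r addr0 sub0r normrN; apply: le_lt_trans; exact: ler_norm.
Qed.

Lemma supported_cvg (pe : nat -> R) (S I : R) : pe @ \oo --> 0 ->
  (forall n, (0 < n)%N -> supported n (pe n) S I) -> S <= capacity I.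
Proof.
move=> pe0 H; rewrite leNgt; apply/negP; rewrite -subr_gt0 => /(exists_small_slack S pe0) [n n0].
by have := H n n0; rewrite /supported; lra.
Qed.

Lemma continuous_capacity (f : R -> R) x : 0 <= f x -> {for x, continuous f} ->
  {for x, continuous (fun y => capacity (f y))}.
Proof.
move=> fx cf; rewrite /capacity; apply: cvgM; last exact: cvg_cst.
apply: cvgM; last exact: cvg_cst.
have c1 : (fun y => 1 + f y) @ x --> 1 + f x by apply: cvgD => //; exact: cvg_cst.
have c2 : (@ln R) @ (1 + f x) --> ln (1 + f x) by apply: continuous_ln; rewrite ltr_pwDl.
exact: (cvg_comp _ _ c1 c2).
Qed.

Lemma capacity_ge0 (I : R) : 0 <= I -> 0 <= capacity I.
Proof. by move=> I0; rewrite /capacity !divr_ge0 ?ln_ge0 ?lerDl ?ler1n. Qed.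

(* The correlations used by the codes vary with [n]; the worst slack of the three bounds is
   continuous in the correlation, so it is enough to take its maximizer. *)
Lemma exists_limit_correlation (pe : nat -> R) (S1 S2 S3 P a b : R) : pe @ \oo --> 0 ->
  (forall n, 0 <= pe n) -> 0 <= S1 -> 0 <= S2 -> 0 <= S3 -> 0 <= P ->
  (forall n, (0 < n)%N -> exists2 rho, -1 <= rho <= 1 &
    [/\ supported n (pe n) S1 (a ^+ 2 * (P * (1 - rho ^+ 2))),
        supported n (pe n) S2 (b ^+ 2 * (P * (1 - rho ^+ 2))) &
        supported n (pe n) S3 (P * (a ^+ 2 + b ^+ 2 + 2 * rho * a * b))]) ->
  exists2 rho, -1 <= rho <= 1 &
    [/\ S1 <= capacity (a ^+ 2 * (P * (1 - rho ^+ 2))),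
        S2 <= capacity (b ^+ 2 * (P * (1 - rho ^+ 2))) &
        S3 <= capacity (P * (a ^+ 2 + b ^+ 2 + 2 * rho * a * b))].
Proof.
move=> pe0 pe_ge0 S10 S20 S30 P0 H.
pose g1 (k x : R) := k ^+ 2 * (P * (1 - x ^+ 2)).
pose g3 (x : R) := P * (a ^+ 2 + b ^+ 2 + 2 * x * a * b).
have g10 k x : -1 <= x <= 1 -> 0 <= g1 k x.
  by move=> /andP[? ?]; apply: mulr_ge0; [exact: sqr_ge0|apply: mulr_ge0 => //; nra].
have g30 x : -1 <= x <= 1 -> 0 <= g3 x.
  move=> /andP[? ?]; apply: mulr_ge0 => //.
  have [ab|ab] := leP 0 (a * b).
    by have := sqr_ge0 (a - b); nra.
  by have := sqr_ge0 (a + b); nra.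
have cX (x : R) : {for x, continuous (fun y : R => y)} by move=> ?; exact.
have cg1 k x : {for x, continuous (g1 k)}.
  apply: cvgM; first exact: cvg_cst. apply: cvgM; first exact: cvg_cst.
  by apply: cvgB; [exact: cvg_cst|apply: cvgM; exact: cX].
have cg3 x : {for x, continuous g3}.
  apply: cvgM; first exact: cvg_cst. apply: cvgD; first exact: cvg_cst.
  apply: cvgM; last exact: cvg_cst. apply: cvgM; last exact: cvg_cst.
  by apply: cvgM; [exact: cvg_cst|exact: cX].
pose F := ((fun x => capacity (g1 a x) - S1) \min (fun x => capacity (g1 b x) - S2)) \min
  (fun x => capacity (g3 x) - S3).
have m11 : (-1 <= 1 :> R) by lra.
have cF : {within `[-1, 1], continuous F}.
  apply: continuous_in_subspaceT => x; rewrite inE/= in_itv/= => x1.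
  apply: continuous_min; first apply: continuous_min.
  - by apply: cvgB; [apply: continuous_capacity; [exact: g10|exact: cg1]|exact: cvg_cst].
  - by apply: cvgB; [apply: continuous_capacity; [exact: g10|exact: cg1]|exact: cvg_cst].
  - by apply: cvgB; [apply: continuous_capacity; [exact: g30|exact: cg3]|exact: cvg_cst].
have [rho] := EVT_max m11 cF; rewrite in_itv/= => rho1 Fmax.
have F0 : 0 <= F rho.
  (* If the maximal slack were negative, a length [n] whose error terms are below this gap would
     give a correlation with larger slack. The sum [S1 + S2 + S3] lets one [n] serve all three
     bounds. *)
  rewrite leNgt; apply/negP; rewrite -oppr_gt0 => /(exists_small_slack (S1 + S2 + S3) pe0) [n n0 small].
  have [x x1 [H1 H2 H3]] := H n n0.
  have := Fmax x; rewrite in_itv/= => /(_ x1); apply/negP; rewrite -ltNge.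
  rewrite ltrNr in small.
  apply: lt_le_trans small _; rewrite /F /= !le_min.
  have p1 := mulr_ge0 (pe_ge0 n) S10; have p2 := mulr_ge0 (pe_ge0 n) S20.
  have p3 := mulr_ge0 (pe_ge0 n) S30.
  move: H1 H2 H3; rewrite /supported -/(g1 a x) -/(g1 b x) -/(g3 x) => H1 H2 H3.
  by apply/andP; split; [apply/andP; split|]; lra.
exists rho => //; move: F0; rewrite /F /= !le_min => /andP[/andP[H1 H2] H3].
by split; rewrite -subr_ge0.
Qed.

End Limit.

Lemma exists_max_gain {R : realType} (h : 'I_3 -> R) : exists L A B : 'I_3,
  [/\ L != A, L != B, (A < B)%N, h A ^+ 2 <= h L ^+ 2 & h B ^+ 2 <= h L ^+ 2].
Proof.
have [L _ HL] := @Order.TotalTheory.arg_maxP _ _ _ (ord0 : 'I_3) xpredT (fun j => h j ^+ 2) isT.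
have H j : h j ^+ 2 <= h L ^+ 2 by exact: HL.
pose o1 : 'I_3 := Ordinal (isT : (1 < 3)%N); pose o2 : 'I_3 := Ordinal (isT : (2 < 3)%N).
case: L HL H => [[|[|[|//]]] Li] HL H.
- by exists (Ordinal Li), o1, o2; split.
- by exists (Ordinal Li), ord0, o2; split.
- by exists (Ordinal Li), ord0, o1; split.
Qed.

Lemma achievable_region {R : realType} (h : 'I_3 -> R) (P : R) (Rt : 'I_3 -> 'I_3 -> R) :
  0 < P -> achievable h P Rt -> in_single_letter_region h P Rt.
Proof.
move=> P0 [enc [rel [dec [pe [pe0 codes]]]]].
have [L [A [B [LA LB AB hA hB]]]] := exists_max_gain h.
have AneB : A != B by apply: contraTneq AB => ->; rewrite ltnn.
have rates n : (0 < n)%N -> 0 <= pe n /\ exists rho, [/\ -1 <= rho <= 1,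
    supported n (pe n) (rate Rt A B + rate Rt A L) (h A ^+ 2 * (P * (1 - rho ^+ 2))),
    supported n (pe n) (rate Rt B A + rate Rt B L) (h B ^+ 2 * (P * (1 - rho ^+ 2))) &
    supported n (pe n) (rate Rt A L + rate Rt B L)
      (P * (h A ^+ 2 + h B ^+ 2 + 2 * rho * h A * h B))] /\
  [/\ supported n (pe n) (rate Rt L A + rate Rt L B) (h L ^+ 2 * P),
    supported n (pe n) (rate Rt L A + rate Rt L B) ((h A ^+ 2 + h B ^+ 2) * P) &
    forall j k l : 'I_3, j != k -> j != l -> k != l ->
      supported n (pe n) (rate Rt j l + rate Rt k l) (h l ^+ 2 * P)].
  move=> n0; have [Hcode [d [T [Pr [m [Z [Zr [X [Xr [Y [Yr [Hrun [Hpow Herr]]]]]]]]]]]]] := codes n.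
  split; first by rewrite -lee_fin; apply: le_trans Herr; exact: measure_ge0.
  have HK j k : (msize n (Rt j k) <= (\max_(p : 'I_3 * 'I_3) msize n (Rt p.1 p.2)).+1)%N.
    by apply: leqW; exact: (@leq_bigmax _ (fun p : 'I_3 * 'I_3 => msize n (Rt p.1 p.2)) (j, k)).
  exact: (run_rates Hcode Hrun HK Herr n0 P0 Hpow LA LB AB).
have rate0 j k : 0 <= rate Rt j k by rewrite /rate le_max lexx.
have Rt_le j k : Rt j k <= rate Rt j k by rewrite /rate le_max lexx orbT.
(* [rates] covers positive lengths only, so the value at length 0 is replaced; the limit is
   unchanged. *)
pose pe' n := if (0 < n)%N then pe n else 0.
have pe'0 : pe' @ \oo --> 0 by rewrite -cvg_shiftS; rewrite -(cvg_shiftS pe) in pe0.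
have pe'_ge0 n : 0 <= pe' n by rewrite /pe'; case: ltnP => // /rates [].
have pe'E n : (0 < n)%N -> pe' n = pe n by rewrite /pe' => ->.
have fixed S I : (forall n, (0 < n)%N -> supported n (pe n) S I) -> S <= capacity I.
  by move=> H; exact: supported_cvg H.
have B1 : rate Rt L A + rate Rt L B <= capacity (h L ^+ 2 * P).
  by apply: fixed => n /rates[_ [rho [_ []]]].
have B2 : rate Rt L A + rate Rt L B <= capacity ((h A ^+ 2 + h B ^+ 2) * P).
  by apply: fixed => n /rates[_ [rho [_ []]]].
have B3 (j k l : 'I_3) : j != k -> j != l -> k != l ->
    rate Rt j l + rate Rt k l <= capacity (h l ^+ 2 * P).
  by move=> jk jl kl; apply: fixed => n /rates[_ [rho [_ [_ _ /(_ j k l jk jl kl)]]]].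
have [rho rho1 [C1 C2 C3]] : exists2 rho, -1 <= rho <= 1 &
    [/\ rate Rt A B + rate Rt A L <= capacity (h A ^+ 2 * (P * (1 - rho ^+ 2))),
        rate Rt B A + rate Rt B L <= capacity (h B ^+ 2 * (P * (1 - rho ^+ 2))) &
        rate Rt A L + rate Rt B L <= capacity (P * (h A ^+ 2 + h B ^+ 2 + 2 * rho * h A * h B))].
  apply: (exists_limit_correlation pe'0 pe'_ge0); rewrite ?addr_ge0// ?(ltW P0)//.
  move=> n n0; have [_ [rho [[rho1 H1 H2 H3] _]]] := rates n n0.
  by exists rho => //; rewrite pe'E.
have conclude r : r ^+ 2 < 1 ->
    rate Rt A B + rate Rt A L <= capacity (h A ^+ 2 * (P * (1 - r ^+ 2))) ->
    rate Rt B A + rate Rt B L <= capacity (h B ^+ 2 * (P * (1 - r ^+ 2))) ->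
    rate Rt A L + rate Rt B L <= capacity (P * (h A ^+ 2 + h B ^+ 2 + 2 * r * h A * h B)) ->
    in_single_letter_region h P Rt.
  move=> r1 D1 D2 D3; have D j k l m := lerD (Rt_le j k) (Rt_le l m).
  apply: (gaussian_region P0 r1 LA LB AneB hA hB); try by apply: le_trans (D _ _ _ _) _.
  by move=> j k l jk jl kl; apply: le_trans (D _ _ _ _) (B3 _ _ _ jk jl kl).
have [r1|r1] := ltP (rho ^+ 2) 1; first exact: (conclude rho).
have rho2 : 1 - rho ^+ 2 = 0 by move/andP: rho1 => [? ?]; nra.
(* [C1] and [C2] now bound sums of nonnegative parts of rates by 0, which leaves
   [rate Rt A L + rate Rt B L <= 0] for the pair cut as well. *)
rewrite rho2 !mulr0 /capacity addr0 ln1 !mul0r in C1 C2.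
have r0 := rate0; have rAB := r0 A B; have rAL := r0 A L; have rBA := r0 B A; have rBL := r0 B L.
have nn k : 0 <= k -> rate Rt A L + rate Rt B L <= capacity k.
  by move=> k0; apply: le_trans (capacity_ge0 k0); lra.
have hP k : 0 <= h k ^+ 2 * (P * (1 - 0 ^+ 2)).
  by rewrite expr0n/= subr0 mulr1 mulr_ge0 ?sqr_ge0// ltW.
apply: (conclude 0); first by rewrite expr0n/= ltr01.
- by apply: le_trans C1 _; exact: capacity_ge0.
- by apply: le_trans C2 _; exact: capacity_ge0.
- apply: nn; rewrite mulr0 !mul0r addr0; apply: mulr_ge0; first exact: ltW.
  by rewrite addr_ge0 ?sqr_ge0.
Qed.

Theorem theorem1 (R : realType) (h : 'I_3 -> R) (Pw : R) (Rt : 'I_3 -> 'I_3 -> R) :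
  0 < Pw ->
  achievable h Pw Rt ->
  exists (d : measure_display) (T : measurableType d) (Pr : probability T R)
         (X : 'I_3 -> T -> R) (Xr : T -> R) (Z : 'I_3 -> T -> R) (Zr : T -> R),
    single_letter Pr Pw X Xr Z Zr /\
    let Yr : T -> R := fun t => \sum_(j < 3) h j * X j t + Zr t in
    let Y : 'I_3 -> T -> R := fun j t => h j * Xr t + Z j t in
    forall j k l : 'I_3, j != k -> j != l -> k != l ->
      ((Rt j k + Rt j l)%:E <= cond_mutual_info Pr [:: X j] [:: X k; X l; Xr] [:: Yr])%E /\
      ((Rt j k + Rt j l)%:E <= cond_mutual_info Pr [:: Xr] [:: X k; X l] [:: Y k; Y l])%E /\
      ((Rt j l + Rt k l)%:E <= cond_mutual_info Pr [:: X j; X k] [:: X l; Xr] [:: Yr])%E /\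
      ((Rt j l + Rt k l)%:E <= cond_mutual_info Pr [:: Xr] [:: X l] [:: Y l])%E.
Proof. exact: achievable_region. Qed.
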